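(* The following are valid for a field $\mathbb F$. (a) A finite-dimensional IAC algebra over $\mathbb F$ is the direct sum of pairwise isomorphic simple IAC algebras. (b) If $\mathrm{char}(\mathbb F)\neq 2$, then a non-abelian $3$-dimensional IAC algebra over $\mathbb F$ is a simple Lie algebra. (c) Suppose that $\mathbb F$ is a finite field of $q=p^f$ elements where $p$ is an odd prime. Then the number of isomorphism types of $4$-dimensional IAC algebras over $\mathbb F$ is (i) $0$ if $p=5$, (ii) $1$ if $f$ is even or $p\equiv\pm1\pmod 5$, and (iii) $2$ if $f$ is odd and $p\equiv\pm2\pmod 5$. (d) If $m\geq 2$, $m\equiv 2\pmod 4$, and either $\mathrm{char}(\mathbb F)=0$ or $2m<\mathrm{char}(\mathbb F)$, then there is an $(m+1)$-dimensional IAC algebra $L$ over $\mathbb F$ whose automorphism group contains a subgroup isomorphic to $\mathrm{SL}(2,\mathbb F)$ acting absolutely irreducibly on $L$.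
   Context: An anti-commutative algebra over a field is a (not necessarily associative) algebra, with product written $\llbracket x,y\rrbracket$, satisfying $\llbracket x,x\rrbracket=0$ for all $x$. Such an algebra $L$ is IAC if in addition its automorphism group $\mathrm{Aut}(L)$ acts irreducibly on the vector space $L$. The algebra is abelian if all products are zero. It is simple if it is non-zero and its only ideals are $0$ and itself (so a one-dimensional abelian algebra counts as simple).
   Formalization: In (c) only non-abelian IAC algebras are counted (the abelian one is also IAC), and (ii) excludes p=5, where it clashes with (i) for f even; in (d) SL(2,F) acts by automorphisms with kernel exactly {1,-1}, so the subgroup is SL(2,F)/{1,-1}, since a faithful copy cannot exist. *)

(* Defs.v *)
From HB Require Import structures.
From mathcomp Require Import all_boot all_order all_algebra.
Set Implicit Arguments.
Unset Strict Implicit.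
Unset Printing Implicit Defensive.
Import GRing.Theory.
Local Open Scope ring_scope.

(* Finite-dimensional anti-commutative algebras over F. *)
Record acAlg (F : fieldType) := AcAlg {
  ac_space :> vectType F;
  br : {bilinear ac_space -> ac_space -> ac_space};
  brxx : forall x, br x x = 0 }.

Section GroupActions.
Variables (F : fieldType) (V : vectType F).

Definition irreducible_action (G : 'End(V) -> Prop) : Prop :=
  ({:V} != 0)%VS /\
  forall U : {vspace V},
    (forall f, G f -> (f @: U <= U)%VS) -> U = 0%VS \/ U = {:V}%VS.

(* The scalar extension of V along iota is the space of row vectors over K;
   mxof is the matrix of f acting on rows by right multiplication, and U
   stands for its row space. *)
Definition absolutely_irreducible_action (G : 'End(V) -> Prop) : Prop :=
  ({:V} != 0)%VS /\
  forall (K : fieldType) (iota : {rmorphism F -> K}) (U : 'M[K]_(\dim {:V})),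
    (forall f, G f ->
       stablemx U (map_mx iota (passmx.mxof (vbasis {:V}) (vbasis {:V}) f))) ->
    U = 0 \/ row_full U.

End GroupActions.

Section Algebras.
Variable F : fieldType.
Implicit Types A B : acAlg F.

Definition is_iso A B (f : 'Hom(A, B)) : Prop :=
  bijective f /\ forall x y : A, f (br A x y) = br B (f x) (f y).

Definition isomorphic A B : Prop := exists f : 'Hom(A, B), is_iso f.

Definition is_aut A (f : 'End(A)) : Prop := is_iso f.

Definition IAC A : Prop := irreducible_action (@is_aut A).

Definition abelian_alg A : Prop := forall x y : A, br A x y = 0.

Definition is_ideal A (U : {vspace A}) : Prop :=
  forall x u : A, u \in U -> (br A x u \in U) /\ (br A u x \in U).

Definition simple_alg A : Prop :=
  ({:A} != 0)%VS /\
  forall U : {vspace A}, is_ideal U -> U = 0%VS \/ U = {:A}%VS.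

Definition is_Lie A : Prop :=
  forall x y z : A,
    br A x (br A y z) + br A y (br A z x) + br A z (br A x y) = 0.

Section Subalgebra.
Variables (A : acAlg F) (U : {vspace A}).

(* vsproj U is a linear projection onto U, hence the identity on products that
   lie in U; sub_br is the restricted product only when U is a subalgebra. *)
Definition sub_br (x y : subvs_of U) : subvs_of U :=
  vsproj U (br A (vsval x) (vsval y)).

Lemma sub_br_bilinear : bilinear_for *:%R *:%R sub_br.
Proof.
split=> z a x y; rewrite /applyr /sub_br [vsval (_ + _)]linearP.
  by rewrite linearPl linearP.
by rewrite linearPr linearP.
Qed.

HB.instance Definition _ := bilinear_isBilinear.Build F
  (subvs_of U) (subvs_of U) (subvs_of U) *:%R *:%R sub_br sub_br_bilinear.

Lemma sub_brxx x : sub_br x x = 0.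
Proof. by rewrite /sub_br brxx linear0. Qed.

Definition subalg : acAlg F := @AcAlg F (subvs_of U) sub_br sub_brxx.

End Subalgebra.

(* The algebras satisfying P form exactly n isomorphism classes. *)
Definition num_iso_types (P : acAlg F -> Prop) (n : nat) : Prop :=
  exists B : 'I_n -> acAlg F,
    [/\ forall i, P (B i),
        forall i j, isomorphic (B i) (B j) -> i = j
      & forall A, P A -> exists i, isomorphic A (B i)].

(* rho, restricted to SL(2, F), is a group homomorphism into Aut(A) with kernel
   {1, -1}; equivalently, its image is a subgroup of Aut(A) isomorphic to
   SL(2, F) / {1, -1}. *)
Definition SL2_action A (rho : 'M[F]_2 -> 'End(A)) : Prop :=
  [/\ forall g, \det g = 1 -> is_aut (rho g),
      forall g h, \det g = 1 -> \det h = 1 ->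
        rho (g *m h) = (rho g \o rho h)%VF
    & forall g, \det g = 1 -> (rho g = \1%VF <-> g = 1 \/ g = - 1)].

Definition SL2_image A (rho : 'M[F]_2 -> 'End(A)) (f : 'End(A)) : Prop :=
  exists2 g, \det g = 1 & f = rho g.

End Algebras.

(* Main.v *)
Require Import Defs.
From HB Require Import structures.
From mathcomp Require Import all_boot all_order all_algebra.
From mathcomp Require Import all_field boolp ring.
Set Implicit Arguments.
Unset Strict Implicit.
Unset Printing Implicit Defensive.
Import GRing.Theory.
Local Open Scope ring_scope.

(* (a) Let I be a minimal ideal. The sum of its images under Aut(A) is A by
   irreducibility, so A is a direct sum of some of them; if A is not abelian
   these are all the minimal ideals, hence Aut(A) permutes them.

   (b) In dimension 3 the Jacobian is alternating and trilinear, so it spans an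
   Aut(A)-invariant subspace of dimension at most 1, which must be 0.

   (c) Extend scalars to an algebraic closure K, where the automorphisms and the
   Frobenius map phi act irreducibly (Galois descent). The bracket has a
   two-dimensional kernel on bivectors; a zero of the Pfaffian gives an abelian
   plane, and irreducibility gives V = W1 + W2 with W1, W2 abelian and W1 (x) W2
   isomorphic to V. For x in W1, (ad x)^2 is a scalar modulo W1, which defines a
   quadratic form on W1; it is nondegenerate, and likewise for W2. The four
   isotropic lines are permuted by Aut(A), and an automorphism fixing one of them
   fixes all. An irreducible group has more than 4 elements, so some g <> 1 fixes
   the four lines; comparing its eigenvalues on V and on W1 (x) W2 shows that g
   has order 5, and A becomes h_j h_{j+1} = h_{j+3}, h_j h_{j+2} = 0 (j mod 4)
   with h_j in the z^(2^j)-eigenspace of g, z a primitive fifth root of unity. The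
   F-forms of this algebra are given by phi(h_j) = w^(2^j) h_{j+s}, w^5 = 1,
   q = 2^s mod 5; w matters only up to w -> w^2, and if w <> 1 then Aut(A)
   fixes the four lines, so that A is irreducible only when s is odd.

   (d) For m = 2n with n odd, the n-th transvectant on binary forms of degree m
   is anticommutative and SL(2)-equivariant: it sends (l1^m, l2^m) to
   (det(l1, l2) l1 l2)^n, and the powers l^m span. *)

(** * Algebras on row vectors *)

(** The obstacle in (c) is that Aut(A) need not stay irreducible over K; only together with the
    semilinear map phi does it leave no proper subspace stable. So the structure theory is developed
    for semilinear automorphisms, and irreducibility enters as a spanning principle: a set of
    vectors described by the product alone spans V once it contains a non-zero vector. This is
    applied to brackets, to vectors whose ad has rank at most 1, to vectors of abelian planes and to
    isotropic vectors. The Pfaffian is a quadratic form on the 6-dimensional space of bivectors, so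
    over a closed field it has a zero on any two-dimensional subspace. The order 5 comes from
    eigenvalues: a, a^-1, b, b^-1 on W1 + W2 must agree with the four products of a or a^-1 by b or
    b^-1 on W1 (x) W2. The four lines then carry the four non-trivial weights modulo 5, cyclically
    ordered by the generator 2 of the units; in characteristic 5 there is no primitive fifth root of
    unity and nothing survives. In (d), m even makes -1 act trivially, n odd makes det(l1, l2)^n
    change sign while (l1 l2)^n is symmetric, and the bound on the characteristic keeps the
    binomials of m non-zero and 0, ..., m distinct. *)

Section Isomorphism.
Variable F : fieldType.
Implicit Types A B D : acAlg F.

Lemma is_iso_comp A B D (f : 'Hom(A, B)) (g : 'Hom(B, D)) :
  is_iso f -> is_iso g -> is_iso (g \o f)%VF.
Proof.
move=> [bf mf] [bg mg]; split; last by move=> x y; rewrite !comp_lfunE mf mg.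
by apply: (eq_bij (bij_comp bg bf)) => x; rewrite /= comp_lfunE.
Qed.

Lemma is_iso_inv A B (f : 'Hom(A, B)) : is_iso f ->
  exists2 g : 'Hom(B, A), is_iso g & cancel f g /\ cancel g f.
Proof.
move=> [[h fh hf] mf].
have k0 : lker f == 0%VS by apply/lker0P; apply: can_inj fh.
have fK : cancel f (f^-1)%VF by apply: lker0_lfunK.
have Kf : cancel (f^-1)%VF f by move=> x; rewrite -{1}(hf x) fK hf.
exists (f^-1)%VF; last by split.
split; first by exists f.
by move=> x y; apply: (can_inj fK); rewrite mf !Kf.
Qed.

Lemma is_iso_id A : is_iso (\1%VF : 'Hom(A, A)).
Proof. by split=> [|x y]; [exists id => x; rewrite id_lfunE | rewrite !id_lfunE]. Qed.

Lemma isomorphic_sym A B : isomorphic A B -> isomorphic B A.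
Proof. by case=> f /is_iso_inv[g ig _]; exists g. Qed.

Lemma isomorphic_trans A B D : isomorphic A B -> isomorphic B D -> isomorphic A D.
Proof. by case=> f If [g Ig]; exists (g \o f)%VF; apply: is_iso_comp. Qed.

Lemma isomorphic_dim A B : isomorphic A B -> \dim {:A} = \dim {:B}.
Proof.
case=> f [[h fh hf] _].
have k0 : lker f == 0%VS by apply/lker0P; apply: can_inj fh.
have <- : (f @: {:A})%VS = {:B}%VS.
  apply/eqP; rewrite eqEsubv subvf; apply/subvP => x _.
  by rewrite -(hf x) memv_img ?memvf.
by rewrite limg_dim_eq //; apply/eqP; rewrite -subv0 -(eqP k0) capvSr.
Qed.

Lemma isomorphic_abelian A B : isomorphic A B -> abelian_alg A -> abelian_alg B.
Proof.
move=> [f [[h fh hf] mf]] a x y.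
by rewrite -(hf x) -(hf y) -mf a linear0.
Qed.

Lemma isomorphic_IAC A B : isomorphic A B -> IAC A -> IAC B.
Proof.
move=> iAB [n0 irr]; have dAB := isomorphic_dim iAB.
have [f If] := iAB; have [g Ig [fK gK]] := is_iso_inv If.
split; first by rewrite -dimv_eq0 -dAB dimv_eq0.
move=> U stU; have [|E|E] := irr (g @: U)%VS.
- move=> h Ah; rewrite -limg_comp.
  have Ah' : is_aut (f \o (h \o g))%VF by do 2!apply: is_iso_comp => //.
  have := limgS g (stU _ Ah'); rewrite -limg_comp.
  congr (_ @: _ <= _)%VS; apply/lfunP => x.
  by rewrite !comp_lfunE fK.
- left; apply/eqP; rewrite -subv0; apply/subvP => x xU.
  have : g x \in (g @: U)%VS by rewrite memv_img.
  by rewrite E !memv0 => /eqP gx; rewrite -(gK x) gx linear0.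
- right; apply/eqP; rewrite eqEsubv subvf; apply/subvP => x _.
  have : g x \in (g @: U)%VS by rewrite E memvf.
  by case/memv_imgP => y yU /(can_inj gK) ->.
Qed.

End Isomorphism.

(** * Products given by structure constants *)

Section Tensor.
Variables (R : comNzRingType) (n : nat).
Variable C : 'I_n -> 'I_n -> 'rV[R]_n.

(** Algebras are replaced by arrays of structure constants on row vectors, so that scalars are
    extended by applying a ring morphism to the entries of [C]; see [map_tbr]. *)
Definition tbr (x y : 'rV[R]_n) : 'rV[R]_n :=
  \sum_i \sum_j (x 0 i * y 0 j) *: C i j.

Lemma tbr_bilinear : bilinear_for *:%R *:%R tbr.
Proof.
split=> z a x y; rewrite /applyr /tbr /= scaler_sumr -big_split; apply: eq_bigr => i _;
  rewrite /= scaler_sumr -big_split; apply: eq_bigr => j _ /=;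
  rewrite !mxE scalerA -scalerDl; congr (_ *: _).
  by rewrite mulrDl mulrA.
by rewrite mulrDr mulrCA.
Qed.

HB.instance Definition _ := bilinear_isBilinear.Build R
  'rV[R]_n 'rV[R]_n 'rV[R]_n *:%R *:%R tbr tbr_bilinear.

Lemma tbr_delta i j : tbr (delta_mx 0 i) (delta_mx 0 j) = C i j.
Proof.
rewrite /tbr (bigD1 i) //= [X in _ + X]big1 ?addr0; last first.
  by move=> k ki; apply: big1 => l _; rewrite !mxE (negPf ki) andbF mul0r scale0r.
rewrite (bigD1 j) //= big1 ?addr0; first by rewrite !mxE !eqxx mulr1 scale1r.
by move=> l lj; rewrite !mxE (negPf lj) andbF mulr0 scale0r.
Qed.

Lemma tbr_unique (b : {bilinear 'rV[R]_n -> 'rV[R]_n -> 'rV[R]_n}) :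
  (forall i j, b (delta_mx 0 i) (delta_mx 0 j) = C i j) ->
  forall x y, b x y = tbr x y.
Proof.
move=> E x y; rewrite {1}(row_sum_delta x) {1}(row_sum_delta y).
rewrite linear_sumlz; apply: eq_bigr => i _.
rewrite linear_sumr; apply: eq_bigr => j _.
by rewrite linearZl_LR linearZr_LR /= scalerA E.
Qed.

End Tensor.

Lemma map_tbr (R S : comNzRingType) (f : {rmorphism R -> S}) n
    (C : 'I_n -> 'I_n -> 'rV[R]_n) x y :
  map_mx f (tbr C x y) = tbr (fun i j => map_mx f (C i j)) (map_mx f x) (map_mx f y).
Proof.
rewrite /tbr raddf_sum; apply: eq_bigr => i _; rewrite raddf_sum; apply: eq_bigr => j _.
by rewrite /= map_mxZ rmorphM !mxE.
Qed.

Definition isaut (R : comUnitRingType) n (b : 'rV[R]_n -> 'rV[R]_n -> 'rV[R]_n)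
  (g : 'M[R]_n) :=
  g \in unitmx /\ forall x y, b x y *m g = b (x *m g) (y *m g).

Definition irrmx (F : fieldType) n (G : 'M[F]_n -> Prop) :=
  forall U : 'M[F]_n, (forall g, G g -> (U *m g <= U)%MS) -> U = 0 \/ row_full U.

Section Model.
Variables (F : fieldType) (n : nat) (C : 'I_n -> 'I_n -> 'rV[F]_n).
Hypothesis Cxx : forall x, tbr C x x = 0.

Definition model : acAlg F := @AcAlg F 'rV[F]_n (tbr C) Cxx.

Lemma dim_model : \dim {:model} = n.
Proof. by rewrite dimvf /dim /= mul1n. Qed.

Lemma mulmxr_lfunE (g : 'M[F]_n) (x : 'rV[F]_n) : linfun (mulmxr g) x = x *m g.
Proof. by rewrite lfunE. Qed.

Lemma isaut_is_aut (g : 'M[F]_n) : isaut (tbr C) g ->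
  @is_aut F model (linfun (mulmxr g)).
Proof.
move=> [Ug ag]; split; last by move=> x y; rewrite !mulmxr_lfunE; apply: ag.
by exists (mulmxr (invmx g)) => x; rewrite mulmxr_lfunE /= ?mulmxK ?mulmxKV.
Qed.

Definition lfmx (f : 'End(model)) : 'M[F]_n := lin1_mx (f : 'rV[F]_n -> 'rV[F]_n).

Lemma lfmxE (f : 'End(model)) (x : 'rV[F]_n) : x *m lfmx f = f x.
Proof. by rewrite mul_rV_lin1. Qed.

Lemma is_aut_isaut (f : 'End(model)) : is_aut f -> isaut (tbr C) (lfmx f).
Proof.
move=> [[h fh hf] mf]; split; last by move=> x y; rewrite !lfmxE; apply: mf.
rewrite -row_free_unit; apply/inj_row_free => v; rewrite lfmxE => E.
by apply: (can_inj fh); rewrite E linear0.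
Qed.

(** [genmx] turns the [\dim U] basis rows into a square matrix with the same row space, the format
    of [irrmx]. *)
Definition vsmx (U : {vspace model}) : 'M[F]_n :=
  <<\matrix_(i < \dim U) ((vbasis U)`_i : 'rV[F]_n)>>%MS.

Lemma mem_vsmx (U : {vspace model}) (x : 'rV[F]_n) : (x <= vsmx U)%MS = (x \in U).
Proof.
rewrite genmxE; apply/idP/idP.
  case/submxP => D ->; rewrite mulmx_sum_row; apply: memv_suml => i _.
  by rewrite rowK memvZ // vbasis_mem // mem_nth // size_tuple.
move=> xU; rewrite (coord_vbasis xU); apply: summx_sub => i _.
by apply: scalemx_sub; rewrite -[X in (X <= _)%MS](rowK (fun i => (vbasis U)`_i)) row_sub.
Qed.

Lemma irr_IAC : (0 < n)%N -> irrmx (isaut (tbr C)) -> IAC model.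
Proof.
move=> n0 irr; split; first by rewrite -dimv_eq0 dim_model -lt0n.
move=> U stU; case: (irr (vsmx U)) => [g Ag|E|E].
- apply/row_subP => i; rewrite row_mul.
  have := stU _ (isaut_is_aut Ag).
  set x := row i _ => /subvP/(_ (x *m g)); rewrite mem_vsmx; apply.
  by rewrite -mulmxr_lfunE memv_img // -mem_vsmx row_sub.
- left; apply/eqP; rewrite -subv0; apply/subvP => x; rewrite -mem_vsmx E submx0.
  by move/eqP ->; rewrite mem0v.
- right; apply/eqP; rewrite eqEsubv subvf; apply/subvP => x _.
  by rewrite -mem_vsmx submx_full.
Qed.

Lemma IAC_irr : IAC model -> irrmx (isaut (tbr C)).
Proof.
move=> [_ irr] U stU; pose W : {vspace model} := <<[seq row i U | i : 'I_n]>>%VS.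
have memW (x : 'rV[F]_n) : (x \in W) = (x <= U)%MS.
  apply/idP/idP => [xW|/submxP[D ->]].
    rewrite (coord_span (X := in_tuple _) xW); apply: summx_sub => i _.
    apply: scalemx_sub; have : (i < size [seq row i U | i : 'I_n])%N by [].
    by move/(mem_nth 0)/imageP => [j _ /= ->]; rewrite row_sub.
  rewrite mulmx_sum_row; apply: memv_suml => i _; rewrite memvZ // memv_span //.
  by apply/imageP; exists i.
have [|E|E] := irr W.
- move=> f Af; apply/subvP => _ /memv_imgP[x xW ->]; rewrite memW -lfmxE.
  by apply: submx_trans (stU _ (is_aut_isaut Af)); rewrite submxMr // -memW.
- left; apply/row_matrixP => i; rewrite row0; apply/eqP; rewrite -submx0.
  have : row i U \in W by rewrite memW row_sub.
  by rewrite E memv0 => /eqP ->; rewrite sub0mx.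
- right; rewrite -sub1mx; apply/row_subP => i; rewrite -memW E.
  exact: memvf.
Qed.

Lemma model_abelian : abelian_alg model -> forall x y, tbr C x y = 0.
Proof. by move=> a x y; apply: a. Qed.

End Model.

Lemma model_iso (F : fieldType) n (C C' : 'I_n -> 'I_n -> 'rV[F]_n) Cxx C'xx
    (T : 'M[F]_n) : T \in unitmx ->
  (forall x y, tbr C x y *m T = tbr C' (x *m T) (y *m T)) ->
  isomorphic (@model F n C Cxx) (@model F n C' C'xx).
Proof.
move=> UT mT; exists (linfun (mulmxr T)); split.
  by exists (mulmxr (invmx T)) => x; rewrite mulmxr_lfunE /= ?mulmxK ?mulmxKV.
by move=> x y; rewrite !mulmxr_lfunE; apply: mT.
Qed.

Lemma iso_model (F : fieldType) n (C C' : 'I_n -> 'I_n -> 'rV[F]_n) Cxx C'xx :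
  isomorphic (@model F n C Cxx) (@model F n C' C'xx) ->
  exists2 T : 'M[F]_n, T \in unitmx &
    forall x y, tbr C x y *m T = tbr C' (x *m T) (y *m T).
Proof.
case=> f [[h fh hf] mf]; exists (lin1_mx (f : 'rV[F]_n -> 'rV[F]_n)).
  rewrite -row_free_unit; apply/inj_row_free => v; rewrite mul_rV_lin1 => E.
  by apply: (can_inj fh); rewrite E linear0.
by move=> x y; rewrite !mul_rV_lin1; apply: mf.
Qed.

Lemma to_model (F : fieldType) (A : acAlg F) n : \dim {:A} = n ->
  exists (C : 'I_n -> 'I_n -> 'rV[F]_n) Cxx, isomorphic A (@model F n C Cxx).
Proof.
move=> dA; have [X bX] : exists X : n.-tuple A, basis_of {:A} X.
  by rewrite -dA; exists (vbasis {:A}); apply: vbasisP.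
have fX := basis_free bX; have sX := span_basis bX.
pose r (x : A) : 'rV[F]_n := \row_i coord X i x.
pose v (u : 'rV[F]_n) : A := \sum_i u 0 i *: X`_i.
have vK : cancel v r.
  move=> u; apply/rowP => i; rewrite mxE /v linear_sum /= (bigD1 i) //=.
  rewrite linearZ /= coord_free // eqxx mulr1 big1 ?addr0 // => j ji.
  by rewrite linearZ /= coord_free // (negPf ji) mulr0.
have rK : cancel r v.
  by move=> x; rewrite [RHS](coord_basis bX (memvf x)); apply: eq_bigr => i _; rewrite mxE.
have r_lin : linear r by move=> a x y; apply/rowP => i; rewrite !mxE linearP.
pose rL := GRing.isLinear.Build F A 'rV[F]_n _ r r_lin.
pose rl : {linear A -> 'rV[F]_n} := HB.pack r rL.
pose C i j := r (br A X`_i X`_j).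
have E x y : r (br A (v x) (v y)) = tbr C x y.
  rewrite -[r]/(rl : A -> _) /v linear_sumlz linear_sum; apply: eq_bigr => i _.
  rewrite linear_sumr linear_sum; apply: eq_bigr => j _.
  by rewrite linearZl_LR linearZr_LR scalerA linearZ.
have Cxx x : tbr C x x = 0 by rewrite -E brxx -[r]/(rl : A -> _) linear0.
exists C, Cxx, (linfun rl); split.
  by exists v => x; rewrite lfunE /= ?rK ?vK.
by move=> x y; rewrite !lfunE /= -E !rK.
Qed.

(** * Decomposition into simple ideals *)

Section Ideals.
Variables (F : fieldType) (A : acAlg F).
Implicit Types (I J U : {vspace A}) (g h : 'End(A)).

Lemma br_anti (x y : A) : br A x y = - br A y x.
Proof.
apply/eqP; rewrite -addr_eq0; have := brxx (x + y).
by rewrite linearDl !linearDr !brxx add0r addr0 => ->.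
Qed.

Lemma ideal_intro I : (forall x u : A, u \in I -> br A x u \in I) -> is_ideal I.
Proof. by move=> H x u uI; rewrite (br_anti u) memvN; split; apply: H. Qed.

Definition min_ideal I :=
  [/\ is_ideal I, I != 0%VS & forall J, is_ideal J -> (J <= I)%VS -> J = 0%VS \/ J = I].

Lemma exists_min_ideal : ({:A} != 0)%VS -> exists I, min_ideal I.
Proof.
move=> n0; have [I [idI I0]] : exists I, is_ideal I /\ I != 0%VS.
  by exists {:A}%VS; split=> // x u _; rewrite !memvf.
have [n] := ubnP (\dim I); elim: n => // n IH in I idI I0 *; rewrite ltnS => dI.
have [H|] := EM (forall J, is_ideal J -> (J <= I)%VS -> J = 0%VS \/ J = I).
  by exists I.
move/existsNP => [J /not_implyP[idJ /not_implyP[JI /not_orP[J0 nJI]]]].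
apply: (IH J) => //; first exact/eqP.
apply: leq_trans dI; rewrite ltn_neqAle dimvS // andbT.
apply: contra_not_neq nJI => /eqP; rewrite (eqn_leq (\dim J)) => /andP[_ d].
by apply/eqP; rewrite eqEdim JI.
Qed.

Lemma ideal_cap I J : is_ideal I -> is_ideal J -> is_ideal (I :&: J)%VS.
Proof.
move=> idI idJ x u; rewrite !memv_cap => /andP[uI uJ].
by have [-> ->] := idI x u uI; have [-> ->] := idJ x u uJ.
Qed.

Lemma ideal_sum (s : seq 'End(A)) U : (forall g, g \in s -> is_ideal (g @: U)%VS) ->
  is_ideal (\sum_(g <- s) (g @: U))%VS.
Proof.
elim: s => [|g s IH] H.
  by rewrite big_nil; apply: ideal_intro => x u; rewrite memv0 => /eqP ->; rewrite linear0r mem0v.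
rewrite big_cons; apply: ideal_intro => x _ /memv_addP[u ug [v vs ->]].
rewrite linearDr memv_add //.
  by have [] := H g (mem_head _ _) x u ug.
by have [] := IH (fun h hs => H h (@mem_behead _ (g :: s) h hs)) x v vs.
Qed.

Lemma limg_sum_seq h (s : seq 'End(A)) U :
  (h @: \sum_(g <- s) (g @: U))%VS = (\sum_(g <- [seq (h \o g)%VF | g <- s]) (g @: U))%VS.
Proof.
rewrite big_map; elim: s => [|g s IH]; first by rewrite !big_nil limg0.
by rewrite !big_cons limgD IH limg_comp.
Qed.

Lemma subv_sum_seq (s : seq 'End(A)) U W : (forall g, g \in s -> (g @: U <= W)%VS) ->
  (\sum_(g <- s) (g @: U) <= W)%VS.
Proof.
elim: s => [|g s IH] H; first by rewrite big_nil sub0v.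
rewrite big_cons subv_add H ?mem_head //=; apply: IH => h hs.
by apply: H; rewrite inE hs orbT.
Qed.

Lemma min_ideal_cap I J : min_ideal I -> min_ideal J -> I != J -> (I :&: J)%VS = 0%VS.
Proof.
move=> [idI I0 mI] [idJ J0 mJ] IJ.
have [//|E] := mI _ (ideal_cap idI idJ) (capvSl _ _).
have := mJ I idI; case; first by rewrite -E capvSr.
  by move=> I00; rewrite I00 eqxx in I0.
by move=> IJE; rewrite IJE eqxx in IJ.
Qed.

Lemma ideal_br0 I J (x y : A) : is_ideal I -> is_ideal J -> (I :&: J)%VS = 0%VS ->
  x \in I -> y \in J -> br A x y = 0.
Proof.
move=> idI idJ IJ xI yJ; apply/eqP; rewrite -memv0 -IJ memv_cap.
by have [_ ->] := idI y x xI; have [-> _] := idJ x y yJ.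
Qed.

Lemma aut_lker g : is_aut g -> lker g = 0%VS.
Proof. by move=> [bg _]; apply/eqP/lker0P; apply: bij_inj. Qed.

Lemma aut_dim g U : is_aut g -> \dim (g @: U) = \dim U.
Proof. by move=> /aut_lker k0; rewrite limg_dim_eq // k0 capv0. Qed.

Lemma aut_ideal g I : is_aut g -> is_ideal I -> is_ideal (g @: I)%VS.
Proof.
move=> Ag idI; have [h Ah [gK hK]] := is_iso_inv Ag; have [_ mg] := Ag.
apply: ideal_intro => x _ /memv_imgP[u uI ->].
by rewrite -(hK x) -mg memv_img //; case: (idI (h x) u uI).
Qed.

Lemma aut_inv_img g h U : cancel g h -> (h @: (g @: U))%VS = U.
Proof.
move=> gK; rewrite -limg_comp -[RHS](lim1g U); congr (_ @: _)%VS.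
by apply/lfunP => x; rewrite comp_lfunE gK id_lfunE.
Qed.

Lemma aut_min_ideal g I : is_aut g -> min_ideal I -> min_ideal (g @: I)%VS.
Proof.
move=> Ag [idI I0 mI]; have [h Ah [gK hK]] := is_iso_inv Ag.
split; first exact: aut_ideal.
  by rewrite -dimv_eq0 aut_dim // dimv_eq0.
move=> J idJ JgI; have := mI _ (aut_ideal Ah idJ).
rewrite -{1}(aut_inv_img I gK) limgS // => /(_ isT)[E|E].
  by left; rewrite -(aut_inv_img J hK) E limg0.
by right; rewrite -(aut_inv_img J hK) E.
Qed.

Lemma isomorphic_subalg g U W : is_aut g -> is_ideal U -> is_ideal W ->
  (g @: U)%VS = W -> isomorphic (subalg U) (subalg W).
Proof.
move=> Ag idU idW gU; have [h Ah [gK hK]] := is_iso_inv Ag; have [_ mg] := Ag.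
have hW : (h @: W)%VS = U by rewrite -gU aut_inv_img.
pose f : 'Hom(subalg U, subalg W) := (linfun (vsproj W) \o (g \o linfun (@vsval F A U)))%VF.
pose f' : 'Hom(subalg W, subalg U) := (linfun (vsproj U) \o (h \o linfun (@vsval F A W)))%VF.
have fE x : vsval (f x) = g (vsval x).
  by rewrite !comp_lfunE !lfunE /= vsprojK // -gU memv_img // subvsP.
have f'E x : vsval (f' x) = h (vsval x).
  by rewrite !comp_lfunE !lfunE /= vsprojK // -hW memv_img // subvsP.
exists f; split.
  exists f' => x; apply: subvs_inj.
    by rewrite f'E fE gK.
  by rewrite fE f'E hK.
move=> x y; apply: subvs_inj; rewrite fE /= /sub_br.
have inU : br A (vsval x) (vsval y) \in U by case: (idU (vsval x) _ (subvsP y)).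
by rewrite vsprojK // !fE -mg vsprojK // -gU memv_img.
Qed.

Section Decomposition.
Variables (I : {vspace A}).
Hypotheses (iacA : IAC A) (minI : min_ideal I).

(** Each image of [I] is a minimal ideal, so it meets an ideal in 0 or lies in it. A direct sum of
    images with as many terms as possible therefore contains every image; it is then stable under
    Aut(A) and equal to [A]. *)
Lemma exists_decomposition : exists s : seq 'End(A),
  [/\ forall g, g \in s -> is_aut g,
      (\sum_(g <- s) (g @: I))%VS = {:A}%VS &
      \dim {:A} = (size s * \dim I)%N].
Proof.
have [idI I0 mI] := minI; have [_ irr] := iacA.
(* Directness is recorded by the dimension [k * \dim I], which also bounds [k]. *)
pose P k := `[< exists s : seq 'End(A), [/\ forall g, g \in s -> is_aut g, size s = k &
   \dim (\sum_(g <- s) (g @: I))%VS = (k * \dim I)%N] >].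
have P0 : exists k, P k.
  by exists 0%N; apply/asboolP; exists [::]; split=> //; rewrite big_nil dimv0.
have Pb k : P k -> (k <= \dim {:A})%N.
  move/asboolP => [s [_ _ ds]]; apply: leq_trans (dimvS (subvf (\sum_(g <- s) (g @: I))%VS)).
  by rewrite ds leq_pmulr // lt0n dimv_eq0.
have [k /asboolP[s [As sk ds]] kmax] := ex_maxnP P0 Pb.
pose S := (\sum_(g <- s) (g @: I))%VS.
have idS : is_ideal S.
  apply: ideal_sum => g gs; exact: aut_ideal (As g gs) idI.
have subS g : is_aut g -> (g @: I <= S)%VS.
  move=> Ag; have [idg I0g mg] := aut_min_ideal Ag minI.
  have [cap0|capI] := mg _ (ideal_cap idg idS) (capvSl _ _); last by rewrite -capI capvSr.
  suff /kmax : P k.+1 by rewrite ltnn.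
  apply/asboolP; exists (g :: s); split=> [h||].
  - by rewrite inE => /orP[/eqP ->|/As].
  - by rewrite /= sk.
  - by rewrite big_cons dimv_disjoint_sum // aut_dim // ds mulSn.
have fS : S = {:A}%VS.
  case: (irr S) => // [h Ah|S0].
    rewrite limg_sum_seq; apply: subv_sum_seq => _ /mapP[g gs ->].
    by apply: subS; apply: is_iso_comp => //; apply: As.
  case/negP: I0; rewrite -subv0 -S0 -[X in (X <= _)%VS]lim1g; apply: subS.
  exact: is_iso_id.
by exists s; split=> //; rewrite -fS /S ds sk.
Qed.

(* A summand different from all [g @: I] would annihilate the algebra. *)
Lemma min_ideal_unique s h : ~ abelian_alg A -> (forall g, g \in s -> is_aut g) ->
  (\sum_(g <- s) (g @: I))%VS = {:A}%VS -> is_aut h ->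
  exists2 g, g \in s & (h @: I)%VS = (g @: I)%VS.
Proof.
move=> nab As sA Ah; apply/not_exists2P => H; apply: nab.
have br0 (t : seq 'End(A)) (x y : A) : {subset t <= s} -> x \in (h @: I)%VS ->
    y \in (\sum_(g <- t) (g @: I))%VS -> br A x y = 0.
  move=> + xJ; elim: t y => [|g t IH] y ts.
    by rewrite big_nil memv0 => /eqP ->; rewrite linear0r.
  rewrite big_cons => /memv_addP[u ug [v vt ->]]; rewrite linearDr (IH v) // ?addr0; last first.
    by move=> k kt; apply: ts; rewrite inE kt orbT.
  have gs : g \in s by apply: ts; rewrite mem_head.
  have mh := aut_min_ideal Ah minI; have mg := aut_min_ideal (As g gs) minI.
  apply: (ideal_br0 (I := (h @: I)%VS) (J := (g @: I)%VS)) => //; first by case: mh.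
    by case: mg.
  apply: min_ideal_cap => //; apply/eqP => E.
  by have [] := H g.
have Jann (x y : A) : x \in (h @: I)%VS -> br A x y = 0.
  by move=> xJ; apply: (br0 s) => //; rewrite sA memvf.
have [k Ak [hK kK]] := is_iso_inv Ah.
have Iann (x y : A) : x \in I -> br A x y = 0.
  move=> xI; apply: (can_inj hK); have [_ mh] := Ah.
  by rewrite mh linear0 Jann // memv_img.
have gann g (x y : A) : is_aut g -> x \in (g @: I)%VS -> br A x y = 0.
  move=> Ag /memv_imgP[u uI ->]; have [g' _ [gK g'K]] := is_iso_inv Ag; have [_ mg] := Ag.
  by rewrite -(g'K y) -mg Iann // linear0.
have tann (t : seq 'End(A)) (x y : A) : {subset t <= s} ->
    x \in (\sum_(g <- t) (g @: I))%VS -> br A x y = 0.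
  elim: t x => [|g t IH] x ts.
    by rewrite big_nil memv0 => /eqP ->; rewrite linear0l.
  rewrite big_cons => /memv_addP[u ug [v vt ->]]; rewrite linearDl (IH v) //; last first.
    by move=> l lt; apply: ts; rewrite inE lt orbT.
  by rewrite addr0; apply: gann ug; apply/As/ts/mem_head.
by move=> x y; apply: (tann s) => //; rewrite sA memvf.
Qed.

(** An automorphism of [A] that preserves [I] restricts to one of the algebra [I], so it preserves
    every subspace invariant under Aut(I). *)
Lemma subalg_stable (W : {vspace subvs_of I}) h :
  (forall f : 'End(subalg I), is_aut f -> (f @: W <= W)%VS) ->
  is_aut h -> (h @: I)%VS = I ->
  (h @: (linfun vsval @: W) <= (linfun vsval @: W : {vspace A}))%VS.
Proof.
move=> stW Ah hI; have [idI _ _] := minI; have [_ mh] := Ah.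
have [k Ak [hK kK]] := is_iso_inv Ah.
have kI : (k @: I)%VS = I by rewrite -{1}hI aut_inv_img.
have hin z : z \in I -> h z \in I by move=> zI; have := memv_img h zI; rewrite hI.
have kin z : z \in I -> k z \in I by move=> zI; have := memv_img k zI; rewrite kI.
pose f : 'End(subalg I) := (linfun (vsproj I) \o (h \o linfun (@vsval F A I)))%VF.
pose f' : 'End(subalg I) := (linfun (vsproj I) \o (k \o linfun (@vsval F A I)))%VF.
have fE x : vsval (f x) = h (vsval x).
  by rewrite !comp_lfunE !lfunE /= vsprojK // hin // subvsP.
have f'E x : vsval (f' x) = k (vsval x).
  by rewrite !comp_lfunE !lfunE /= vsprojK // kin // subvsP.
have Af : is_aut f.
  split.
    exists f' => x; apply: subvs_inj; first by rewrite f'E fE hK.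
    by rewrite fE f'E kK.
  move=> x y; apply: subvs_inj; rewrite fE /= /sub_br.
  have inI : br A (vsval x) (vsval y) \in I by case: (idI (vsval x) _ (subvsP y)).
  by rewrite vsprojK // !fE -mh vsprojK // hin.
apply/subvP => _ /memv_imgP[_ /memv_imgP[w wW ->] ->].
rewrite lfunE /= -fE.
have <- : linfun (@vsval F A I) (f w) = vsval (f w) by exact: lfunE.
by rewrite memv_img //; apply: (subvP (stW _ Af)); rewrite memv_img.
Qed.

Lemma vsval_img0 (W : {vspace subvs_of I}) : (linfun vsval @: W)%VS = 0%VS -> W = 0%VS.
Proof.
move=> W0; apply/eqP; rewrite -subv0; apply/subvP => w wW; rewrite memv0.
have : linfun vsval w \in (linfun vsval @: W)%VS by rewrite memv_img.
by rewrite W0 memv0 lfunE /= => /eqP E; apply/eqP/subvs_inj; rewrite E linear0.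
Qed.

Lemma vsval_dim (W : {vspace subvs_of I}) : \dim (linfun vsval @: W) = \dim W.
Proof.
rewrite limg_dim_eq //; apply/eqP; rewrite -subv0; apply/subvP => w.
rewrite memv_cap memv_ker lfunE /= memv0 => /andP[_ /eqP E].
by apply/eqP/subvs_inj; rewrite E linear0.
Qed.

Lemma dim_subvs : \dim {:subvs_of I} = \dim I.
Proof. by rewrite dimvf. Qed.

Lemma full_subvs (W : {vspace subvs_of I}) : (\dim I <= \dim W)%N -> W = {:subvs_of I}%VS.
Proof. by move=> d; apply/eqP; rewrite eqEdim subvf dim_subvs. Qed.

(** If [W] is invariant under Aut(I), the sum of the [g(W)] is invariant under Aut(A): [h g(I)] is
    some summand [k(I)], and [k^-1 h g] preserves [I], hence [W]. So the sum is 0 or [A], and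
    counting dimensions shows that [W] is 0 or [I]. In the abelian case [I] is a line. *)
Lemma IAC_subalg : IAC (subalg I).
Proof.
have [idI I0 mI] := minI; have [_ irr] := iacA.
split; first by rewrite -dimv_eq0 dim_subvs dimv_eq0.
move=> W stW; have [ab|nab] := EM (abelian_alg A).
  have dI : \dim I = 1%N.
    have [||H|H] := mI <[vpick I]>%VS.
    - by apply: ideal_intro => x u _; rewrite ab mem0v.
    - by rewrite -memvE memv_pick.
    - by move/eqP: H; rewrite -dimv_eq0 dim_vline vpick0 (negPf I0).
    - by rewrite -[in LHS]H dim_vline vpick0 (negPf I0).
  have [->|W0] := eqVneq W 0%VS; [by left | right].
  by apply: full_subvs; rewrite dI lt0n dimv_eq0.
have [s [As sA dA]] := exists_decomposition.
pose W' : {vspace A} := (linfun vsval @: W)%VS.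
have [|T0|Tf] := irr (\sum_(g <- s) (g @: W'))%VS.
- move=> h Ah; rewrite limg_sum_seq; apply: subv_sum_seq => _ /mapP[g gs ->].
  have Ahg : is_aut (h \o g)%VF by apply: is_iso_comp => //; apply: As.
  have [k ks E] := min_ideal_unique nab As sA Ahg.
  have [k' Ak' [kK k'K]] := is_iso_inv (As k ks).
  have : ((k' \o (h \o g)) @: W' <= W')%VS.
    apply: subalg_stable => //; first exact: is_iso_comp.
    by rewrite limg_comp E aut_inv_img.
  move/(limgS k); rewrite limg_comp (aut_inv_img _ k'K) => /subv_trans; apply.
  elim: (s) ks => // l t IH; rewrite big_cons inE => /orP[/eqP <-|/IH kt].
    exact: addvSl.
  by apply: subv_trans kt _; apply: addvSr.
- left; apply: vsval_img0; apply/eqP.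
  case: s As sA dA T0 => [|g s] As sA dA T0.
    case/negP: I0; rewrite -subv0; apply: subv_trans (subvf _) _.
    by rewrite -sA big_nil subv0.
  rewrite big_cons in T0; rewrite -dimv_eq0 -(aut_dim W' (As g (mem_head _ _))) dimv_eq0.
  by rewrite -subv0 -T0 addvSl.
right; apply: full_subvs; rewrite -vsval_dim -/W'.
have : (\dim {:A} <= size s * \dim W')%N.
  rewrite -Tf; elim: (s) As => [|g t IH] As; first by rewrite big_nil dimv0.
  rewrite big_cons (leq_trans (dimv_add_leqif _ _)) //= mulSn leq_add //.
    by rewrite aut_dim //; apply: As; apply: mem_head.
  by apply: IH => l lt; apply: As; rewrite inE lt orbT.
rewrite dA leq_pmul2l //; case: s As sA dA Tf => [|//] _ sA _ _.
case/negP: I0; rewrite -subv0; apply: subv_trans (subvf _) _.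
by rewrite -sA big_nil subv0.
Qed.

End Decomposition.

(** Distinct minimal ideals annihilate each other, so an ideal of one summand is an ideal of the
    whole algebra, and minimality applies. *)
Lemma simple_subalg I (s : seq 'End(A)) :
  min_ideal I -> (forall g, g \in s -> min_ideal (g @: I)%VS) ->
  (\sum_(g <- s) (g @: I))%VS = {:A}%VS -> forall h, h \in s -> simple_alg (subalg (h @: I)).
Proof.
move=> minI ms sA h hs; set U := (h @: I)%VS; have [idU U0 mU] := ms h hs.
split; first by rewrite -dimv_eq0 dim_subvs dimv_eq0.
move=> J idJ; pose J' : {vspace A} := (linfun vsval @: (J : {vspace subvs_of U}))%VS.
have JU : (J' <= U)%VS.
  by apply/subvP => _ /memv_imgP[w _ ->]; rewrite lfunE /= subvsP.
have brU (x u : A) : x \in U -> u \in J' -> br A x u \in J'.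
  move=> xU /memv_imgP[w wJ ->]; rewrite lfunE /=.
  have [brJ _] := idJ (vsproj U x) w wJ.
  have -> : br A x (vsval w) = linfun (@vsval F A U) (sub_br (vsproj U x) w).
    rewrite lfunE /= /sub_br vsprojK // vsprojK //.
    by case: (idU x _ (subvsP w)).
  exact: memv_img.
have idJ' : is_ideal J'.
  apply: ideal_intro => x u uJ; have : x \in (\sum_(g <- s) (g @: I))%VS by rewrite sA memvf.
  have : {subset s <= s} by [].
  elim: {1 3}s x => [|g t IH] x ts.
    by rewrite big_nil memv0 => /eqP ->; rewrite linear0l mem0v.
  rewrite big_cons => /memv_addP[y yg [z zt ->]]; rewrite linearDl rpredD //; last first.
    by apply: IH => // l lt; apply: ts; rewrite inE lt orbT.
  have mg := ms g (ts g (mem_head _ _)).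
  have [E|E] := eqVneq (g @: I)%VS U; first by apply: brU => //; rewrite -E.
  have [idg _ _] := mg; have cap := min_ideal_cap mg (ms h hs) E.
  by rewrite (ideal_br0 idg idU cap yg) ?mem0v //; apply: (subvP JU).
have [E|E] := mU _ idJ' JU; [left; exact: vsval_img0 | right].
by apply: full_subvs; rewrite -vsval_dim -/J' E.
Qed.

End Ideals.

Theorem IAC_decomposition (F : fieldType) (A : acAlg F) : IAC A ->
  exists (n : nat) (U : 'I_n -> {vspace A}),
    [/\ (\sum_(i < n) U i)%VS = {:A}%VS /\ directv (\sum_(i < n) U i),
        forall i, is_ideal (U i),
        forall i, simple_alg (subalg (U i)) /\ IAC (subalg (U i))
      & forall i j, isomorphic (subalg (U i)) (subalg (U j))].
Proof.
move=> iacA; have [n0 _] := iacA; have [I mI] := exists_min_ideal n0.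
have [s [As sA dA]] := exists_decomposition iacA mI; have [idI _ _] := mI.
pose g i := tnth (in_tuple s) i; have gs i : g i \in s by apply: mem_tnth.
have Ag i : is_aut (g i) by apply: As.
have idU i : is_ideal (g i @: I)%VS by apply: aut_ideal.
have isoI i : isomorphic (subalg I) (subalg (g i @: I)) by apply: isomorphic_subalg (Ag i) _ _ _.
have sE : (\sum_(i < size s) (g i @: I))%VS = {:A}%VS by rewrite -sA [RHS]big_tnth.
exists (size s), (fun i => g i @: I)%VS; split=> //.
- split=> //; rewrite directvE /= sE dA; under eq_bigr do rewrite aut_dim //.
  by rewrite sum_nat_const card_ord.
- move=> i; split; last by apply: isomorphic_IAC (isoI i) (IAC_subalg _ mI).
  by apply: (simple_subalg mI) (gs i) => // h hs; apply: aut_min_ideal => //; apply: As.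
by move=> i j; apply: isomorphic_trans (isoI j); apply: isomorphic_sym.
Qed.

(** * Dimension 3 *)

Section Jacobian.
Variables (F : fieldType) (A : acAlg F).

Definition jac (x y z : A) : A :=
  br A x (br A y z) + br A y (br A z x) + br A z (br A x y).

Lemma jac_rot x y z : jac x y z = jac y z x.
Proof. by rewrite /jac -addrA addrC. Qed.

Lemma jac_lin x y a z z' : jac x y (a *: z + z') = a *: jac x y z + jac x y z'.
Proof.
rewrite /jac !(linearDl, linearDr, linearZl_LR, linearZr_LR) /=.
by rewrite !scalerDr (addrACA (a *: _)) (addrACA (a *: _ + _)).
Qed.

Lemma jac_xxz x z : jac x x z = 0.
Proof. by rewrite /jac (br_anti z x) linearNr addrN brxx linear0r addr0. Qed.

Lemma jac_swap x y z : jac y x z = - jac x y z.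
Proof.
apply/eqP; rewrite -addr_eq0; have := jac_xxz (x + y) z.
have l u v w w' : jac u (w + w') v = jac u w v + jac u w' v.
  by rewrite !(jac_rot u) !(jac_rot _ v) -[w]scale1r jac_lin !scale1r.
have l' u v w w' : jac (w + w') u v = jac w u v + jac w' u v.
  by rewrite !(jac_rot _ u) -[w]scale1r jac_lin !scale1r.
by rewrite l' !l !jac_xxz add0r addr0 addrC => ->.
Qed.

Lemma linear_mem (f : A -> A) (X : 3.-tuple A) (W : {vspace A}) :
  basis_of {:A} X -> (forall a u v, f (a *: u + v) = a *: f u + f v) ->
  (forall i : 'I_3, f X`_i \in W) -> forall z, f z \in W.
Proof.
move=> bX flin fX z; rewrite (coord_basis bX (memvf z)).
have f0 : f 0 = 0 by have := flin (-1) 0 0; rewrite scaler0 addr0 scaleN1r addNr.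
apply: (big_ind (fun u => f u \in W)); first by rewrite f0 mem0v.
  by move=> u v fu fv; rewrite -[u]scale1r flin scale1r rpredD.
by move=> i _; rewrite -[_ *: _]addr0 flin f0 addr0 memvZ.
Qed.

(* In dimension 3 the Jacobian, an equivariant alternating trilinear map, takes
   its values in a line. *)
Lemma dim3_Lie : \dim {:A} = 3%N -> IAC A -> is_Lie A.
Proof.
move=> dA [_ irr]; have [X bX] : exists X : 3.-tuple A, basis_of {:A} X.
  by rewrite -dA; exists (vbasis {:A}); apply: vbasisP.
pose w := jac X`_0 X`_1 X`_2; pose W := <[w]>%VS.
have wW : w \in W by apply: memv_line.
have zx x y : jac x y x = 0 by rewrite jac_rot jac_rot jac_xxz.
have yz x y : jac x y y = 0 by rewrite jac_rot jac_xxz.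
have base (i j k : 'I_3) : jac X`_i X`_j X`_k \in W.
  have w1 : jac X`_1 X`_2 X`_0 \in W by rewrite -jac_rot.
  have w2 : jac X`_2 X`_0 X`_1 \in W by rewrite jac_rot.
  case: i j k => [[|[|[|i]]] Hi] // [[|[|[|j]]] Hj] // [[|[|[|k]]] Hk] //=;
    rewrite ?jac_xxz ?zx ?yz ?mem0v ?w1 ?w2 //; by rewrite jac_swap memvN.
have JW x y z : jac x y z \in W.
  apply: (linear_mem bX (jac_lin x y)) => k; rewrite jac_rot jac_rot.
  apply: (linear_mem bX (jac_lin X`_k x)) => j; rewrite jac_rot jac_rot.
  apply: (linear_mem bX (jac_lin X`_j X`_k)) => i; rewrite jac_rot jac_rot.
  by rewrite -jac_rot.
have [|W0|Wf] := irr W.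
- move=> f [_ mf]; rewrite limg_line -memvE.
  have -> : f w = jac (f X`_0) (f X`_1) (f X`_2) by rewrite /w /jac !linearD /= !mf.
  exact: JW.
- by move=> x y z; apply/eqP; rewrite -memv0 -W0; apply: JW.
- by have := dim_vline w; rewrite -/W Wf dA; case: (w != 0).
Qed.

(** The dimension of a minimal ideal divides 3. If it were 1, the algebra would be a sum of ideals
    that are lines; each has zero square and annihilates the others, so all products would
    vanish. *)
Lemma dim3_simple : \dim {:A} = 3%N -> IAC A -> ~ abelian_alg A -> simple_alg A.
Proof.
move=> dA iacA nab; have [n0 _] := iacA; have [I mI] := exists_min_ideal n0.
have [s [As sA]] := exists_decomposition iacA mI; rewrite dA => d3.
have [idI I0 m] := mI.
have [dI|dI] : \dim I = 3%N \/ \dim I = 1%N.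
  have : (\dim I %| 3)%N by rewrite d3 dvdn_mull.
  have [_ P3] := primeP (isT : prime 3).
  by move=> /P3/orP[/eqP ->|/eqP ->]; [right|left].
- split=> // J idJ; have fI : I = {:A}%VS by apply/eqP; rewrite eqEdim subvf dA dI.
  by have := m J idJ; rewrite fI subvf; apply.
case: nab => x y.
have ms h : h \in s -> min_ideal (h @: I)%VS.
  by move=> hs; apply: aut_min_ideal => //; apply: As.
have line h (u v : A) : h \in s -> u \in (h @: I)%VS -> v \in (h @: I)%VS -> br A u v = 0.
  move=> hs; have : \dim (h @: I) = 1%N by rewrite aut_dim //; apply: As.
  move=> d1; have [_ h0 _] := ms h hs.
  have -> : (h @: I = <[vpick (h @: I)]>)%VS.
    apply/eqP; rewrite eq_sym eqEdim -memvE memv_pick dim_vline vpick0 h0.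
    by rewrite d1.
  by move=> /vlineP[a ->] /vlineP[c ->]; rewrite linearZl_LR linearZr_LR /= brxx !scaler0.
have br0 h (u v : A) : h \in s -> u \in (h @: I)%VS -> br A u v = 0.
  move=> hs uh; have : v \in (\sum_(g <- s) (g @: I))%VS by rewrite sA memvf.
  have : {subset s <= s} by [].
  elim: {1 3}s v => [|g t IH] v ts; first by rewrite big_nil memv0 => /eqP ->; rewrite linear0r.
  rewrite big_cons => /memv_addP[p pg [q qt ->]]; rewrite linearDr (IH q) // ?addr0; last first.
    by move=> l lt; apply: ts; rewrite inE lt orbT.
  have gs := ts g (mem_head _ _).
  have [E|E] := eqVneq (h @: I)%VS (g @: I)%VS; first by apply: (line h) => //; rewrite E.
  have [idh _ _] := ms h hs; have [idg _ _] := ms g gs.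
  exact: (ideal_br0 idh idg (min_ideal_cap (ms h hs) (ms g gs) E)).
have : x \in (\sum_(g <- s) (g @: I))%VS by rewrite sA memvf.
have : {subset s <= s} by [].
elim: {1 3}s (x) => [|g t IH] v ts; first by rewrite big_nil memv0 => /eqP ->; rewrite linear0l.
rewrite big_cons => /memv_addP[p pg [q qt ->]]; rewrite linearDl (IH q) // ?addr0; last first.
  by move=> l lt; apply: ts; rewrite inE lt orbT.
by apply: (br0 g) => //; apply/ts/mem_head.
Qed.

End Jacobian.

(** * Four-dimensional algebras over an algebraically closed field *)

Section Basis4.
Variable K : fieldType.
Notation V := 'rV[K]_4.

Definition rows4 (a b c d : V) : 'M[K]_4 := \matrix_(i < 4) [:: a; b; c; d]`_i.

Definition lin4 (a b c d : V) (x : V) :=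
  x 0 0 *: a + x 0 1 *: b + x 0 2%:R *: c + x 0 3%:R *: d.

Definition basis4 a b c d := rows4 a b c d \in unitmx.

Lemma mul_rows4 a b c d (x : V) : x *m rows4 a b c d = lin4 a b c d x.
Proof.
apply/rowP=> j; rewrite !mxE !big_ord_recl big_ord0 !mxE /= addr0 !addrA.
by congr (x 0 _ * _ + x 0 _ * _ + x 0 _ * _ + x 0 _ * _); apply/val_inj.
Qed.

Definition vec4 (s t u v : K) : V := \row_i [:: s; t; u; v]`_i.

Lemma lin4_vec4 a b c d s t u v :
  lin4 a b c d (vec4 s t u v) = s *: a + t *: b + u *: c + v *: d.
Proof. by rewrite /lin4 !mxE. Qed.

Lemma vec4_eq0 s t u v : vec4 s t u v = 0 -> [/\ s = 0, t = 0, u = 0 & v = 0].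
Proof.
by move/rowP=> E; have := (E 0, E 1, E 2%:R, E 3%:R); rewrite !mxE /= => -[[[]]].
Qed.

Lemma basis4_coord a b c d (x : V) : basis4 a b c d ->
  exists s t u v, x = s *: a + t *: b + u *: c + v *: d.
Proof.
move=> B; pose y := x *m invmx (rows4 a b c d).
exists (y 0 0), (y 0 1), (y 0 2%:R), (y 0 3%:R).
by rewrite -/(lin4 a b c d y) -mul_rows4 mulmxKV.
Qed.

Lemma basis4_free a b c d s t u v : basis4 a b c d ->
  s *: a + t *: b + u *: c + v *: d = 0 -> [/\ s = 0, t = 0, u = 0 & v = 0].
Proof.
move=> B; rewrite -lin4_vec4 -mul_rows4 => E; apply: vec4_eq0.
by rewrite -(mulmxK B (vec4 s t u v)) E mul0mx.
Qed.

Lemma basis4_intro a b c d :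
  (forall s t u v, s *: a + t *: b + u *: c + v *: d = 0 ->
     [/\ s = 0, t = 0, u = 0 & v = 0]) -> basis4 a b c d.
Proof.
move=> H; rewrite /basis4 -row_free_unit; apply/inj_row_free => x.
rewrite mul_rows4 => /H[x0 x1 x2 x3]; apply/rowP=> i; rewrite mxE.
case: i => [[|[|[|[|i]]]] Hi] //.
- by rewrite -[RHS]x0; congr (x _ _); apply/val_inj.
- by rewrite -[RHS]x1; congr (x _ _); apply/val_inj.
- by rewrite -[RHS]x2; congr (x _ _); apply/val_inj.
- by rewrite -[RHS]x3; congr (x _ _); apply/val_inj.
Qed.

Lemma not_basis4 a b c d : ~~ basis4 a b c d ->
  exists2 w : 'cV[K]_4, w != 0 &
   [/\ a *m w = 0, b *m w = 0, c *m w = 0 & d *m w = 0].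
Proof.
rewrite /basis4 -unitmx_tr -row_free_unit -kermx_eq0.
case/rowV0Pn => v /sub_kermxP vE v0; exists v^T; first by rewrite trmx_eq0.
have E : rows4 a b c d *m v^T = 0 by apply: trmx_inj; rewrite trmx_mul trmxK vE trmx0.
have R i : row i (rows4 a b c d) *m v^T = 0 by rewrite -row_mul E row0.
by split; [have := R 0|have := R 1|have := R 2%:R|have := R 3%:R]; rewrite rowK.
Qed.

Lemma rows4_sub a b c d (x : V) :
  ~~ (x <= rows4 a b c d)%MS -> forall s t u v, x != s *: a + t *: b + u *: c + v *: d.
Proof.
move=> nx s t u v; apply: contraNneq nx => ->.
by rewrite -lin4_vec4 -mul_rows4 submxMl.
Qed.

(** Padding with zero rows presents the span of at most three vectors as a proper subspace, the
    input of the spanning principle. *)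
Lemma rows4_0_nfull a b c : ~~ row_full (rows4 a b c 0).
Proof.
apply/negP; rewrite row_full_unit => B.
have := @basis4_free a b c 0 0 0 0 1 B; rewrite !scale0r scaler0 !addr0.
by case=> // _ _ _ /eqP; rewrite oner_eq0.
Qed.

End Basis4.

(** * Spanning sets under irreducible semilinear maps *)

Section SpanPrinciple.
Variables (K : fieldType) (n : nat).
Variable Gam : {rmorphism K -> K} -> 'M[K]_n -> Prop.
Hypothesis irrG : forall U : 'M[K]_n,
  (forall t S, Gam t S -> (map_mx t U *m S <= U)%MS) -> U = 0 \/ row_full U.

(* The span of an orbit-closed set is stable, even under semilinear maps. *)
Lemma span_principle (X : 'rV[K]_n -> Prop) (x0 : 'rV_n) :
  (forall t S x, Gam t S -> X x -> X (map_mx t x *m S)) -> X x0 -> x0 != 0 ->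
  forall U : 'M[K]_n, ~~ row_full U -> exists2 x, X x & ~~ (x <= U)%MS.
Proof.
move=> stX Xx0 x0n U nfU.
pose P k := `[< exists m (M : 'M[K]_(m, n)), (forall i, X (row i M)) /\ \rank M = k >].
have P1 : exists k, P k.
  exists (\rank x0); apply/asboolP; exists 1, x0; split=> // i.
  by rewrite (ord1 i) row_id.
have Pb k : P k -> (k <= n)%N.
  by move/asboolP => [m [M [_ <-]]]; apply: rank_leq_col.
have [k /asboolP[m [M [XM rM]]] kmax] := ex_maxnP P1 Pb.
have XsubM x : X x -> (x <= M)%MS.
  move=> Xx; have : P (\rank (col_mx M x)).
    apply/asboolP; exists (m + 1)%N, (col_mx M x); split=> // i.
    by case: (split_ordP i) => j ->; rewrite ?rowKu ?rowKd // (ord1 j) row_id.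
  move/kmax; rewrite -rM => le_r.
  have sM : (M <= col_mx M x)%MS by rewrite -addsmxE addsmxSl.
  have := mxrank_leqif_sup sM; case=> _; rewrite eqn_leq le_r (mxrankS sM) /=.
  move/esym; apply: submx_trans.
  by rewrite -addsmxE addsmxSr.
case: (irrG (U := <<M>>%MS)).
- move=> t S GtS; rewrite genmxE.
  have tM : (map_mx t <<M>>%MS *m S <= map_mx t M *m S)%MS.
    by apply: submxMr; rewrite map_submx genmxE.
  apply: submx_trans tM _; apply/row_subP => i.
  by rewrite row_mul -map_row; apply: XsubM; apply: stX.
- move=> M0; have := XsubM _ Xx0; rewrite -(genmxE M) M0 submx0.
  by rewrite (negPf x0n).
rewrite -col_leq_rank genmxE => fM.
have nMU : ~~ (M <= U)%MS.
  apply: contra nfU => MU; rewrite -col_leq_rank.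
  by apply: leq_trans fM _; apply: mxrankS.
have [i ni] := row_subPn nMU.
by exists (row i M).
Qed.

End SpanPrinciple.

Section Basis4more.
Variable K : fieldType.
Notation V := 'rV[K]_4.

Lemma basis4_chain (a b c d : V) : a != 0 ->
  (forall s, b != s *: a) -> (forall s t, c != s *: a + t *: b) ->
  (forall s t u, d != s *: a + t *: b + u *: c) -> basis4 a b c d.
Proof.
move=> a0 nb nc nd; apply: basis4_intro => s t u v.
have [->|v0] := eqVneq v 0; last first.
  move/eqP; rewrite addrC addr_eq0 => /eqP E.
  case/negP: (nd (- (v^-1 * s)) (- (v^-1 * t)) (- (v^-1 * u))); apply/eqP.
  rewrite -[d]scale1r -(mulVf v0) -scalerA E scalerN !scalerDr !scalerA !opprD.
  by rewrite !scaleNr.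
rewrite scale0r addr0; have [->|u0] := eqVneq u 0; last first.
  move/eqP; rewrite addrC addr_eq0 => /eqP E.
  case/negP: (nc (- (u^-1 * s)) (- (u^-1 * t))); apply/eqP.
  rewrite -[c]scale1r -(mulVf u0) -scalerA E scalerN !scalerDr !scalerA !opprD.
  by rewrite !scaleNr.
rewrite scale0r addr0; have [->|t0] := eqVneq t 0; last first.
  move/eqP; rewrite addrC addr_eq0 => /eqP E.
  case/negP: (nb (- (t^-1 * s))); apply/eqP.
  by rewrite -[b]scale1r -(mulVf t0) -scalerA E scalerN !scalerA !scaleNr.
rewrite scale0r addr0 => /eqP; rewrite scaler_eq0 (negPf a0) orbF => /eqP ->.
by [].
Qed.

End Basis4more.

Section Perm.
Variable K : fieldType.
Implicit Types a b c d : 'rV[K]_4.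

Lemma basis4_swap01 a b c d : basis4 a b c d -> basis4 b a c d.
Proof.
move=> B; apply: basis4_intro => s t u v E.
have [|-> -> -> ->] := @basis4_free _ a b c d t s u v B; last by [].
by rewrite -E; apply/rowP => i; rewrite !mxE; ring.
Qed.

Lemma basis4_swap12 a b c d : basis4 a b c d -> basis4 a c b d.
Proof.
move=> B; apply: basis4_intro => s t u v E.
have [|-> -> -> ->] := @basis4_free _ a b c d s u t v B; last by [].
by rewrite -E; apply/rowP => i; rewrite !mxE; ring.
Qed.

Lemma basis4_swap23 a b c d : basis4 a b c d -> basis4 a b d c.
Proof.
move=> B; apply: basis4_intro => s t u v E.
have [|-> -> -> ->] := @basis4_free _ a b c d s t v u B; last by [].
by rewrite -E; apply/rowP => i; rewrite !mxE; ring.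
Qed.

Lemma basis4_scale a b c d (s t u v : K) : s != 0 -> t != 0 -> u != 0 -> v != 0 ->
  basis4 a b c d -> basis4 (s *: a) (t *: b) (u *: c) (v *: d).
Proof.
move=> s0 t0 u0 v0 B; apply: basis4_intro => s' t' u' v'.
rewrite !scalerA => /(basis4_free B)[].
by do 4!(move/eqP; rewrite mulf_eq0 ?(negPf s0) ?(negPf t0) ?(negPf u0) ?(negPf v0);
  rewrite orbF => /eqP ->).
Qed.

End Perm.

Section Eigen4.
Variable K : fieldType.
Notation V := 'rV[K]_4.
Variables (a0 a1 a2 a3 : V) (g : 'M[K]_4) (m0 m1 m2 m3 : K).
Hypothesis B : basis4 a0 a1 a2 a3.

Lemma trace_basis4 (v0 v1 v2 v3 : V) :
  a0 *m g = v0 *m rows4 a0 a1 a2 a3 -> a1 *m g = v1 *m rows4 a0 a1 a2 a3 ->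
  a2 *m g = v2 *m rows4 a0 a1 a2 a3 -> a3 *m g = v3 *m rows4 a0 a1 a2 a3 ->
  \tr g = v0 0 0 + v1 0 1 + v2 0 2%:R + v3 0 3%:R.
Proof.
move=> E0 E1 E2 E3; set E := rows4 a0 a1 a2 a3 in E0 E1 E2 E3.
have H : E *m g = rows4 v0 v1 v2 v3 *m E.
  apply/row_matrixP => i; rewrite !row_mul {1}/E !rowK /=.
  by case: i => [[|[|[|[|i]]]] Hi].
rewrite -(mulKmx B g) -/E H mxtrace_mulC mulmxK //.
rewrite /mxtrace !big_ord_recl big_ord0 addr0 !mxE /= !addrA.
by congr (v0 0 _ + v1 0 _ + v2 0 _ + v3 0 _); apply: val_inj.
Qed.

Hypotheses (E0 : a0 *m g = m0 *: a0) (E1 : a1 *m g = m1 *: a1).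
Hypotheses (E2 : a2 *m g = m2 *: a2) (E3 : a3 *m g = m3 *: a3).

Lemma eigen4_coord l s t u v :
  let x := s *: a0 + t *: a1 + u *: a2 + v *: a3 in x *m g = l *: x ->
  [/\ s * (m0 - l) = 0, t * (m1 - l) = 0, u * (m2 - l) = 0 & v * (m3 - l) = 0].
Proof.
move=> x E; apply: (basis4_free B).
have : x *m g - l *: x = 0 by rewrite E subrr.
rewrite /x !mulmxDl -!scalemxAl E0 E1 E2 E3 => <-.
by apply/rowP => i; rewrite !mxE; ring.
Qed.

Lemma eigen4_val l (x : V) : x != 0 -> x *m g = l *: x ->
  [\/ l = m0, l = m1, l = m2 | l = m3].
Proof.
move=> x0 E; have [s [t [u [v xE]]]] := basis4_coord x B.
rewrite xE in E; have := eigen4_coord E.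
have aux p m : p * (m - l) = 0 -> p = 0 \/ l = m.
  by move/eqP; rewrite mulf_eq0 subr_eq0 => /orP[/eqP ->|/eqP ->]; [left|right].
case=> /aux[s0|]; last by constructor 1.
move=> /aux[t0|]; last by constructor 2.
move=> /aux[u0|]; last by constructor 3.
move=> /aux[v0|]; last by constructor 4.
by move: x0; rewrite xE s0 t0 u0 v0 !scale0r !addr0 eqxx.
Qed.

Lemma eigen4_vec (x : V) : x *m g = m3 *: x ->
  m3 != m0 -> m3 != m1 -> m3 != m2 -> exists k, x = k *: a3.
Proof.
move=> E n0 n1 n2; have [s [t [u [v xE]]]] := basis4_coord x B.
rewrite xE in E; have := eigen4_coord E.
have aux p m : m3 != m -> p * (m - m3) = 0 -> p = 0.
  by move=> n /eqP; rewrite mulf_eq0 subr_eq0 (eq_sym m) (negPf n) orbF => /eqP.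
case=> /(aux _ _ n0) s0 /(aux _ _ n1) t0 /(aux _ _ n2) u0 _; exists v.
by rewrite xE s0 t0 u0 !scale0r !add0r.
Qed.

End Eigen4.

Lemma prim5 (K : fieldType) (a : K) : a ^+ 5 = 1 -> a != 1 -> 5.-primitive_root a.
Proof.
move=> a5 a1; have [m pm dm] := prim_order_exists (isT : (0 < 5)%N) a5.
have [_ /(_ m dm)/orP[/eqP m1|/eqP <- //]] := primeP (isT : prime 5).
by move: (prim_expr_order pm) a1; rewrite m1 expr1 => ->; rewrite eqxx.
Qed.

(** For an automorphism fixing the four isotropic lines, [a], [a^-1], [b], [b^-1] are the
    eigenvalues on these lines and [a b], [a / b], [b / a], [(a b)^-1] those on their brackets. Both
    lists are the spectrum of the same map; the hypotheses keep the inclusions that are needed. *)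
Lemma eigenvalues5 (K : fieldType) (a b : K) : a != 0 -> b != 0 ->
  [\/ a = a * b, a = a / b, a = b / a | a = (a * b)^-1] ->
  [\/ b = a * b, b = a / b, b = b / a | b = (a * b)^-1] ->
  [\/ a * b = a, a * b = a^-1, a * b = b | a * b = b^-1] ->
  [\/ a / b = a, a / b = a^-1, a / b = b | a / b = b^-1] ->
  (a = 1 /\ b = 1) \/ a ^+ 5 = 1 /\ a != 1 /\ (b = a ^+ 2 \/ b = a ^- 2).
Proof.
move=> a0 b0 Ha Hb Hab Hadb.
have eqdiv (x y z : K) : y != 0 -> x = z / y -> x * y = z.
  by move=> y0 ->; rewrite divfK.
have eqinv (x y : K) : y != 0 -> x = y^-1 -> x * y = 1.
  by move=> y0 ->; rewrite mulVf.
have ab0 : a * b != 0 by rewrite mulf_neq0.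
have [b1|b1] := eqVneq b 1.
  left; split=> //; rewrite b1 mulr1 divr1 in Hb.
  case: Hb => [//|//|/esym|/esym]; first by rewrite div1r; move/eqP; rewrite invr_eq1 => /eqP.
  by move/eqP; rewrite invr_eq1 => /eqP.
have Hb2 : b = a ^+ 2 \/ b * a ^+ 2 = 1.
  case: Ha => [/eqP|/esym E|/(eqdiv _ _ _ a0)|/(eqinv _ _ ab0)] //.
  - by rewrite -{1}[a]mulr1 (inj_eq (mulfI a0)) eq_sym (negPf b1).
  - have /eqP := eqdiv _ _ _ b0 (esym E); rewrite -[X in _ == X]mulr1 (inj_eq (mulfI a0)).
    by rewrite (negPf b1).
  - by rewrite -expr2 => ->; left.
  - by rewrite mulrA mulrC -expr2 => ->; right.
have [a1|a1] := eqVneq a 1.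
  by exfalso; case: Hb2; rewrite a1 expr1n ?mulr1 => E; move: b1; rewrite E eqxx.
right; case: Hb2 => E.
  subst b; suff a5 : a ^+ 5 = 1 by do !split=> //; left.
  (* The premise is contradictory: [a^3 = 1] would make [a b = 1], which is not in the first list
     because neither [a] nor [b] is 1. *)
  have a3 : a ^+ 3 = 1 -> a ^+ 5 = 1.
    move=> a3; have a21 : a ^+ 3 = a * a ^+ 2 by ring.
    exfalso; case: Hab; rewrite -a21 a3.
    + by move=> E; move: a1; rewrite -E eqxx.
    + by move/esym/eqP; rewrite invr_eq1 (negPf a1).
    + by move=> E; move: b1; rewrite -E eqxx.
    + by move/esym/eqP; rewrite invr_eq1 (negPf b1).
  have n2 : a ^+ 2 != 0 by rewrite expf_neq0.
  case: Hb => [E|/(eqdiv _ _ _ n2) E|/(eqdiv _ _ _ a0) E|/(eqinv _ _ ab0) E].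
  - by case/eqP: a1; apply: (mulIf n2); rewrite -E mul1r.
  - apply: a3; apply: (mulfI a0); rewrite mulr1 -[RHS]E; ring.
  - by case/eqP: a1; apply: (mulfI n2); rewrite E mulr1.
  - by rewrite -E; ring.
have bE : b = a ^- 2.
  by apply: (mulIf (expf_neq0 2 a0)); rewrite E mulVf // expf_neq0.
suff a5 : a ^+ 5 = 1 by do !split=> //; right.
subst b; have n2 : a ^+ 2 != 0 by rewrite expf_neq0.
case: Hb => [E'|E'|E'|E'].
- by case/eqP: a1; apply: (mulIf b0); rewrite -E' mul1r.
- rewrite invrK in E'.
  have : a ^+ 5 = 1 by rewrite -(mulVf n2) E'; ring.
  by [].
- by case/eqP: a1; apply: (mulfI b0); rewrite mulr1 {1}E' divfK.
- have E2 : a ^- 2 = a by rewrite {1}E' invfM invrK expr2 mulKf.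
  have a3 : a ^+ 3 = 1 by rewrite -E E2; ring.
  have d : a / a ^- 2 = a ^+ 3 by rewrite invrK; ring.
  exfalso; case: Hadb; rewrite d a3.
  + by move=> E3; move: a1; rewrite -E3 eqxx.
  + by move/esym/eqP; rewrite invr_eq1 (negPf a1).
  + by move=> E3; move: b1; rewrite -E3 eqxx.
  + by move/esym/eqP; rewrite invr_eq1 (negPf b1).
Qed.

(* The product with h_j h_{j+1} = h_{j+3} and h_j h_{j+2} = 0. Indices are added
   in 'I_4, the ring of integers mod 4; h_j has weight 2^j modulo 5. *)
Definition stp (R : comNzRingType) (x y : 'rV[R]_4) : 'rV[R]_4 :=
  \row_k (x 0 (k + 1) * y 0 (k + 2%:R) - x 0 (k + 2%:R) * y 0 (k + 1)).

Definition frame (R : comUnitRingType) (b : 'rV[R]_4 -> 'rV[R]_4 -> 'rV[R]_4)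
    (P : 'M[R]_4) :=
  P \in unitmx /\ forall u v, b (u *m P) (v *m P) = stp u v *m P.

(** * Abelian planes and isotropic lines *)

Section Classify.
Variable K : closedFieldType.
Notation V := 'rV[K]_4.
Variable b : {bilinear V -> V -> V}.
Hypothesis bxx : forall x, b x x = 0.

Lemma bC x y : b y x = - b x y.
Proof.
apply/eqP; rewrite -addr_eq0 addrC; have := bxx (x + y).
by rewrite linearDl !linearDr !bxx add0r addr0 => ->.
Qed.

(** The pairs 01 and 23 are set apart because their brackets vanish when the basis is adapted to two
    abelian planes. *)
Lemma b_expand e0 e1 e2 e3 s t u v s' t' u' v' :
  b (s *: e0 + t *: e1 + u *: e2 + v *: e3)
    (s' *: e0 + t' *: e1 + u' *: e2 + v' *: e3) =
  (s * t' - t * s') *: b e0 e1 + (u * v' - v * u') *: b e2 e3 +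
  ((s * u' - u * s') *: b e0 e2 + (s * v' - v * s') *: b e0 e3 +
   (t * u' - u * t') *: b e1 e2 + (t * v' - v * t') *: b e1 e3).
Proof.
rewrite !(linearDl, linearDr, linearZl_LR, linearZr_LR) /=.
rewrite !bxx (bC e0 e1) (bC e0 e2) (bC e0 e3) (bC e1 e2) (bC e1 e3) (bC e2 e3).
by apply/rowP => i; rewrite !mxE; ring.
Qed.

Definition act (t : {rmorphism K -> K}) (S : 'M[K]_4) (x : V) : V :=
  map_mx t x *m S.

(** The pair [(t, S)] stands for the [t]-semilinear map [x |-> t(x) S]; the Frobenius map on
    coordinates is of this kind with [S = 1]. *)
Definition semiaut (t : {rmorphism K -> K}) (S : 'M[K]_4) :=
  [/\ bijective t, S \in unitmx &
   forall x y : V, act t S (b x y) = b (act t S x) (act t S y)].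

Lemma semiaut_surj t S : semiaut t S -> forall y : V, exists x : V, y = act t S x.
Proof.
rewrite /act; case=> -[u _ uK] US _ y; exists (map_mx u (y *m invmx S)).
have -> z : map_mx t (map_mx u z) = z :> V by apply/rowP=> i; rewrite !mxE uK.
by rewrite mulmxKV.
Qed.

Lemma semiaut_lin t S (k : K) (x y : V) :
  act t S (k *: x + y) = t k *: act t S x + act t S y.
Proof. by rewrite /act map_mxD map_mxZ mulmxDl scalemxAl. Qed.

Lemma semiaut_inj t S : semiaut t S -> injective (act t S).
Proof.
rewrite /act; case=> _ US _ x y /= E; apply: (map_mx_inj (f := t)).
by rewrite -(mulmxK US (map_mx t x)) E mulmxK.
Qed.

Lemma semiaut0 t S : act t S 0 = 0.
Proof. by rewrite /act map_mx0 mul0mx. Qed.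

Variable Gam : {rmorphism K -> K} -> 'M[K]_4 -> Prop.
Hypothesis autG : forall t S, Gam t S -> semiaut t S.
Hypothesis irrG : forall U : 'M[K]_4,
  (forall t S, Gam t S -> (map_mx t U *m S <= U)%MS) -> U = 0 \/ row_full U.
Hypothesis bn0 : exists x y, b x y != 0.
Hypothesis char2 : (2%:R : K) != 0.

Definition stable (X : V -> Prop) := 
  forall t S (x : V), semiaut t S -> X x -> X (act t S x).

Lemma span_stable (X : V -> Prop) (x0 : V) : stable X -> X x0 -> x0 != 0 ->
  forall U : 'M[K]_4, ~~ row_full U -> exists2 x, X x & ~~ (x <= U)%MS.
Proof.
move=> sX X0 n0; apply: (span_principle irrG) X0 n0 => t S x /autG.
exact: sX.
Qed.

(** The brackets form a stable set with a non-zero element, so they span the space and lie in the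
    kernel of no non-zero functional. *)
Lemma br_kill (w : 'cV[K]_4) : (forall x y, b x y *m w = 0) -> w = 0.
Proof.
move=> bw; apply/eqP/negPn/negP => w0; have [x0 [y0 n0]] := bn0.
have nf : ~~ row_full (kermx w).
  rewrite -col_leq_rank mxrank_ker -ltnNge ltn_subLR ?rank_leq_row //.
  by rewrite -[X in (X < _)%N]add0n ltn_add2r lt0n mxrank_eq0.
pose X := fun z : V => exists x y, z = b x y.
have sX : stable X.
  by move=> t S _ A [x [y ->]]; case: A => _ _ ->; eexists _, _.
have [_ [x [y ->]]] := span_stable sX (ex_intro _ x0 (ex_intro _ y0 erefl)) n0 nf.
by rewrite sub_kermx bw eqxx.
Qed.

Lemma br_kill_basis e0 e1 e2 e3 (w : 'cV[K]_4) : basis4 e0 e1 e2 e3 ->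
  b e0 e1 *m w = 0 -> b e2 e3 *m w = 0 -> b e0 e2 *m w = 0 ->
  b e0 e3 *m w = 0 -> b e1 e2 *m w = 0 -> b e1 e3 *m w = 0 -> w = 0.
Proof.
move=> B w01 w23 w02 w03 w12 w13; apply: br_kill => x y.
have [s [t [u [v ->]]]] := basis4_coord x B.
have [s' [t' [u' [v' ->]]]] := basis4_coord y B.
rewrite b_expand !mulmxDl -!scalemxAl w01 w23 w02 w03 w12 w13.
by rewrite !scaler0 !addr0.
Qed.

Definition adrank1 x := exists c, forall y, exists k, b x y = k *: c.

(** Otherwise such vectors span, and there is a basis [x, x1, x2, x3] of them. Every bracket of two
    distinct basis vectors involves [x], [x1] or [x2], so it is a multiple of one of three fixed
    vectors; the brackets would not span. *)
Lemma adrank1_0 x : adrank1 x -> x = 0.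
Proof.
move=> X0; apply/eqP/negPn/negP => n0.
have sX : stable adrank1.
  move=> t S z A [c cP]; exists (act t S c) => y.
  have [y' ->] := semiaut_surj A y; case: A => _ _ <-.
  by have [k ->] := cP y'; exists (t k); rewrite /act map_mxZ scalemxAl.
have sp := span_stable sX X0 n0.
have [x1 X1 /rows4_sub n1] := sp _ (rows4_0_nfull x 0 0).
have [x2 X2 /rows4_sub n2] := sp _ (rows4_0_nfull x x1 0).
have [x3 X3 /rows4_sub n3] := sp _ (rows4_0_nfull x x1 x2).
have B : basis4 x x1 x2 x3.
  apply: basis4_chain => //.
  - by move=> s; have := n1 s 0 0 0; rewrite !scaler0 !addr0.
  - by move=> s t; have := n2 s t 0 0; rewrite !scaler0 !addr0.
  - by move=> s t u; have := n3 s t u 0; rewrite !scaler0 !addr0.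
have [c0 cP0] := X0; have [c1 cP1] := X1; have [c2 cP2] := X2.
have nb : ~~ basis4 c0 c1 c2 0.
  by have := rows4_0_nfull c0 c1 c2; rewrite row_full_unit.
have [w w0 [w1 w2 w3 _]] := not_basis4 nb.
have k0 y : b x y *m w = 0 by have [k ->] := cP0 y; rewrite -scalemxAl w1 scaler0.
have k1 y : b x1 y *m w = 0 by have [k ->] := cP1 y; rewrite -scalemxAl w2 scaler0.
have k2 y : b x2 y *m w = 0 by have [k ->] := cP2 y; rewrite -scalemxAl w3 scaler0.
by case/eqP: w0; apply: (br_kill_basis B).
Qed.

Definition indep (x y : V) := x != 0 /\ forall k, y != k *: x.

Lemma closed_quad (p q r : K) : exists s t, (s != 0 \/ t != 0) /\
  p * s ^+ 2 + q * s * t + r * t ^+ 2 = 0.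
Proof.
have [->|p0] := eqVneq p 0.
  by exists 1, 0; split; [left; apply: oner_neq0 | ring].
pose P := Poly [:: r; q; p].
have sP : size P != 1.
  by rewrite /P (@PolyK _ 0) //=.
have /closed_rootP[x] := sP.
rewrite /root horner_Poly /= => /eqP E; exists x, 1; split.
  by right; apply: oner_neq0.
by rewrite -E; ring.
Qed.

Definition unit4 (i : nat) : V := \row_j (j == i :> nat)%:R.

(* The quadratic equation says that the Pfaffian vanishes at a vector of
   the kernel of the bracket on bivectors; this bivector is then the product
   of two rows of its alternating matrix. *)
Lemma commuting_pair : exists x y, indep x y /\ b x y = 0.
Proof.
pose e := unit4.
pose B : 'M[K]_(6, 4) := \matrix_(k < 6)
  [:: b (e 0%N) (e 1%N); b (e 0%N) (e 2%N); b (e 0%N) (e 3%N); b (e 1%N) (e 2%N);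
      b (e 1%N) (e 3%N); b (e 2%N) (e 3%N)]`_k.
have [a [pf0 nz rel]] : exists a : 'rV[K]_6, let c k := a 0 (inord k) in
   [/\ c 0%N * c 5%N - c 1%N * c 4%N + c 2%N * c 3%N = 0, a != 0 & a *m B = 0].
  pose M := kermx B.
  have rM : (2 <= \rank M)%N.
    rewrite mxrank_ker -(leq_add2r (\rank B)) subnK ?rank_leq_row //.
    by rewrite (leq_add2l 2 _ 4) rank_leq_col.
  have rf := row_base_free M.
  set f := row_base M in rf.
  have sM i : (row i f <= M)%MS by rewrite (submx_trans (row_sub _ _)) ?eq_row_base.
  pose i0 : 'I_(\rank M) := Ordinal (ltnW rM); pose i1 := Ordinal rM.
  pose s k := row i0 f 0 (inord k); pose t k := row i1 f 0 (inord k).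
  (* The six brackets in dimension 4 satisfy at least two independent relations; these are the
     coefficients of the Pfaffian on the pencil that they span. *)
  have [x [y [xy0 E]]] := closed_quad
    (s 0%N * s 5%N - s 1%N * s 4%N + s 2%N * s 3%N)
    (s 0%N * t 5%N - s 1%N * t 4%N + s 2%N * t 3%N + t 0%N * s 5%N - t 1%N * s 4%N + t 2%N * s 3%N)
    (t 0%N * t 5%N - t 1%N * t 4%N + t 2%N * t 3%N).
  exists (x *: row i0 f + y *: row i1 f); split.
  - rewrite -E /s /t !mxE; ring.
  - have -> : x *: row i0 f + y *: row i1 f =
       (\row_k (x * (k == i0)%:R + y * (k == i1)%:R)) *m f.
      rewrite mulmx_sum_row (bigD1 i0) //= (bigD1 i1) //= big1 ?addr0.
        by rewrite !mxE !eqxx /= !(mulr1, mulr0, addr0, add0r).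
      by move=> k /andP[/negPf k0 /negPf k1]; rewrite !mxE k0 k1 !mulr0 add0r scale0r.
    rewrite -[X in _ != X](mul0mx _ f) (inj_eq (row_free_inj rf)).
    apply/eqP => /rowP E0; have := (E0 i0, E0 i1); rewrite !mxE !eqxx /=.
    rewrite !(mulr1, mulr0, addr0, add0r) => -[x0 y0].
    by case: xy0; rewrite ?x0 ?y0 eqxx.
  - by rewrite mulmxDl -!scalemxAl !(sub_kermxP (sM _)) !scaler0 addr0.
set a01 := a 0 (inord 0) in pf0; set a02 := a 0 (inord 1) in pf0.
set a03 := a 0 (inord 2) in pf0; set a12 := a 0 (inord 3) in pf0.
set a13 := a 0 (inord 4) in pf0; set a23 := a 0 (inord 5) in pf0.
have {}rel : a01 *: b (e 0%N) (e 1%N) + a02 *: b (e 0%N) (e 2%N) + a03 *: b (e 0%N) (e 3%N) +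
   a12 *: b (e 1%N) (e 2%N) + a13 *: b (e 1%N) (e 3%N) + a23 *: b (e 2%N) (e 3%N) = 0 :> V.
  rewrite -[RHS]rel mulmx_sum_row !big_ord_recl big_ord0 addr0 !rowK /= -!addrA.
  by rewrite /a01 /a02 /a03 /a12 /a13 /a23; do !congr (a 0 _ *: _ + _);
    try congr (a 0 _ *: _); apply: val_inj; rewrite /= inordK.
pose S : V := a01 *: b (e 0%N) (e 1%N) + a02 *: b (e 0%N) (e 2%N) + a03 *: b (e 0%N) (e 3%N) +
   a12 *: b (e 1%N) (e 2%N) + a13 *: b (e 1%N) (e 3%N) + a23 *: b (e 2%N) (e 3%N).
pose L s t u v : V := s *: e 0%N + t *: e 1%N + u *: e 2%N + v *: e 3%N.
pose r0 := L 0 a01 a02 a03; pose r1 := L (- a01) 0 a12 a13.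
pose r2 := L (- a02) (- a12) 0 a23; pose r3 := L (- a03) (- a13) (- a23) 0.
pose pf := a01 * a23 - a02 * a13 + a03 * a12.
have Li (s t u v : K) : 
  [/\ L s t u v 0 0 = s, L s t u v 0 1 = t, L s t u v 0 2%:R = u & L s t u v 0 3%:R = v].
  by rewrite /L !mxE /= !(mulr1, mulr0, addr0, add0r).
have fin (x y : V) (p : K) (z : V) i j : x 0 i = 0 -> x 0 j != 0 -> y 0 i != 0 ->
    b x y = p *: S + pf *: z -> exists x y, indep x y /\ b x y = 0.
  move=> xi xj yi E; exists x, y; split; last first.
    by rewrite E /S rel /pf pf0 scaler0 scale0r addr0.
  split; first by apply: contraNneq xj => ->; rewrite mxE.
  by move=> k; apply: contraNneq yi => ->; rewrite mxE xi mulr0.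
(* For an alternating matrix [a], the wedge of rows [i] and [j] is [a_ij] times the bivector [a], up
   to a multiple of the Pfaffian; the bracket sends the bivector [a] to [S], which is 0. *)
have E01 : b r0 r1 = a01 *: S + pf *: (- b (e 2%N) (e 3%N)).
  by rewrite b_expand /S /pf; apply/rowP=> i; rewrite !mxE; ring.
have E02 : b r0 r2 = a02 *: S + pf *: b (e 1%N) (e 3%N).
  by rewrite b_expand /S /pf; apply/rowP=> i; rewrite !mxE; ring.
have E03 : b r0 r3 = a03 *: S + pf *: (- b (e 1%N) (e 2%N)).
  by rewrite b_expand /S /pf; apply/rowP=> i; rewrite !mxE; ring.
have E12 : b r1 r2 = a12 *: S + pf *: (- b (e 0%N) (e 3%N)).
  by rewrite b_expand /S /pf; apply/rowP=> i; rewrite !mxE; ring.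
have E13 : b r1 r3 = a13 *: S + pf *: b (e 0%N) (e 2%N).
  by rewrite b_expand /S /pf; apply/rowP=> i; rewrite !mxE; ring.
have E23 : b r2 r3 = a23 *: S + pf *: (- b (e 0%N) (e 1%N)).
  by rewrite b_expand /S /pf; apply/rowP=> i; rewrite !mxE; ring.
have [L00 L01 L02 L03] := Li 0 a01 a02 a03.
have [L10 L11 L12 L13] := Li (- a01) 0 a12 a13.
have [L20 L21 L22 L23] := Li (- a02) (- a12) 0 a23.
have [L30 L31 L32 L33] := Li (- a03) (- a13) (- a23) 0.
have [z01|n] := eqVneq a01 0; last first.
  by apply: (fin _ _ _ _ 0 1 _ _ _ E01); rewrite /r0 /r1 ?L00 ?L01 ?L10 ?oppr_eq0.
have [z02|n] := eqVneq a02 0; last first.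
  by apply: (fin _ _ _ _ 0 2%:R _ _ _ E02); rewrite /r0 /r2 ?L00 ?L02 ?L20 ?oppr_eq0.
have [z03|n] := eqVneq a03 0; last first.
  by apply: (fin _ _ _ _ 0 3%:R _ _ _ E03); rewrite /r0 /r3 ?L00 ?L03 ?L30 ?oppr_eq0.
have [z12|n] := eqVneq a12 0; last first.
  by apply: (fin _ _ _ _ 1 2%:R _ _ _ E12); rewrite /r1 /r2 ?L11 ?L12 ?L21 ?oppr_eq0.
have [z13|n] := eqVneq a13 0; last first.
  by apply: (fin _ _ _ _ 1 3%:R _ _ _ E13); rewrite /r1 /r3 ?L11 ?L13 ?L31 ?oppr_eq0.
have [z23|n] := eqVneq a23 0; last first.
  by apply: (fin _ _ _ _ 2%:R 3%:R _ _ _ E23); rewrite /r2 /r3 ?L22 ?L23 ?L32 ?oppr_eq0.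
case/eqP: nz; apply/rowP => i; rewrite mxE.
by case: i => [[|[|[|[|[|[|i]]]]]] Hi] //;
   [rewrite -[RHS]z01|rewrite -[RHS]z02|rewrite -[RHS]z03|rewrite -[RHS]z12
   |rewrite -[RHS]z13|rewrite -[RHS]z23]; congr (a 0 _); apply: val_inj; rewrite /= inordK.
Qed.

Definition comm2 (x : V) := exists y, indep x y /\ b x y = 0.

Lemma indep_act t S (x y : V) : semiaut t S -> indep x y ->
  indep (act t S x) (act t S y).
Proof.
move=> A [x0 ny]; split.
  by apply: contra x0 => /eqP E; apply/eqP/(semiaut_inj A); rewrite E semiaut0.
move=> k; apply/eqP => E; have [[u tu ut] _ _] := A.
have := semiaut_lin t S (u k) x 0; rewrite ut semiaut0 !addr0 -E.
by move/(semiaut_inj A)/eqP; rewrite eq_sym (negPf (ny _)).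
Qed.

Lemma comm2_stable : stable comm2.
Proof.
move=> t S x A [y [xy b0]]; exists (act t S y); split; first exact: indep_act.
by case: A => _ _ <-; rewrite b0 semiaut0.
Qed.

Definition planes e0 e1 e2 e3 :=
  [/\ basis4 e0 e1 e2 e3, b e0 e1 = 0 & b e2 e3 = 0].

(** By the spanning principle a vector [x'] of an abelian plane [<x', y'>] lies outside the first
    plane [<x, y>]. If the planes met, some [z = y' - u x'] in the first would commute with [x], [y]
    and [x']; then [ad z] has rank at most 1 and [z = 0]. *)
Lemma exists_planes : exists e0 e1 e2 e3, planes e0 e1 e2 e3.
Proof.
have [x [y [xy bxy]]] := commuting_pair.
have [x0 ny] := xy.
have sp := @span_stable.
have Cx : comm2 x by exists y.
have [x' [y' [xy' bxy']] /rows4_sub nx'] := sp _ _ comm2_stable Cx x0 _ (rows4_0_nfull x y 0).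
exists x, y, x', y'; split => //; apply: basis4_chain => //.
  by move=> s t; have := nx' s t 0 0; rewrite !scaler0 !addr0.
move=> s t u; apply/eqP => E.
have [w _ /rows4_sub nw] := sp (fun=> True) x (fun _ _ _ _ _ => I) I x0 _ (rows4_0_nfull x y x').
have B : basis4 x y x' w.
  apply: basis4_chain => //.
    by move=> p q; have := nx' p q 0 0; rewrite !scaler0 !addr0.
  by move=> p q r; have := nw p q r 0; rewrite !scaler0 !addr0.
pose z := s *: x + t *: y.
have zE : z = y' - u *: x' by rewrite E /z addrK.
have zx : b z x = 0.
  by rewrite /z linearDl !linearZl_LR /= bxx (bC x y) bxy oppr0 !scaler0 addr0.
have zy : b z y = 0.
  by rewrite /z linearDl !linearZl_LR /= bxx bxy !scaler0 addr0.
have zx' : b z x' = 0.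
  rewrite zE linearBl linearZl_LR /= bxx (bC x' y') bxy'.
  by rewrite scaler0 oppr0 addr0.
suff z0 : z = 0 by case: xy' => _ /(_ u); rewrite E -/z z0 add0r eqxx.
apply: (adrank1_0); exists (b z w) => v.
have [p [q [r [k ->]]]] := basis4_coord v B; exists k.
by rewrite !(linearDr, linearZr_LR) /= zx zy zx' !scaler0 !add0r.
Qed.

Lemma planes_sym e0 e1 e2 e3 : planes e0 e1 e2 e3 -> planes e2 e3 e0 e1.
Proof.
case=> B b01 b23; split=> //; apply: basis4_intro => s t u v E.
have := @basis4_free _ e0 e1 e2 e3 u v s t B.
by rewrite -addrA addrC addrA E => -[].
Qed.

(** Since brackets within each plane vanish, the four mixed ones must span: the bracket identifies
    the tensor product of the two planes with the whole space. *)
Lemma planes_br e0 e1 e2 e3 : planes e0 e1 e2 e3 ->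
  basis4 (b e0 e2) (b e0 e3) (b e1 e2) (b e1 e3).
Proof.
case=> B b01 b23; apply/negPn/negP => /not_basis4[w w0 [w1 w2 w3 w4]].
case/eqP: w0; apply: (br_kill_basis B) => //;
  by rewrite ?b01 ?b23 mul0mx.
Qed.

Lemma planes_minors e0 e1 e2 e3 s t u v s' t' u' v' : planes e0 e1 e2 e3 ->
  b (s *: e0 + t *: e1 + u *: e2 + v *: e3)
    (s' *: e0 + t' *: e1 + u' *: e2 + v' *: e3) = 0 ->
  [/\ s * u' = u * s', s * v' = v * s', t * u' = u * t' & t * v' = v * t'].
Proof.
move=> P; have [B b01 b23] := P.
rewrite b_expand // b01 b23 !scaler0 !add0r => /(basis4_free (planes_br P)) [].
by do 4!(move/eqP; rewrite subr_eq0 => /eqP ?).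
Qed.

Lemma minors_prop (s t u v s' t' u' v' : K) :
  s != 0 \/ t != 0 -> u != 0 \/ v != 0 ->
  s * u' = u * s' -> s * v' = v * s' -> t * u' = u * t' -> t * v' = v * t' ->
  exists k, [/\ s' = k * s, t' = k * t, u' = k * u & v' = k * v].
Proof.
have aux p q r w p' q' r' w' : p != 0 -> r != 0 -> p * r' = r * p' ->
    p * w' = w * p' -> q * r' = r * q' -> q * w' = w * q' ->
    exists k : K, [/\ p' = k * p, q' = k * q, r' = k * r & w' = k * w].
  move=> p0 r0 m1 m2 m3 m4; exists (p' / p); rewrite divfK //.
  have r'E : r' = p' / p * r by rewrite -[r'](mulKf p0) m1; ring.
  have w'E : w' = p' / p * w by rewrite -[w'](mulKf p0) m2; ring.
  split=> //; apply: (mulfI r0); rewrite -m3 r'E; ring.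
move=> [s0|t0] [u0|v0] m1 m2 m3 m4.
- exact: aux.
- by have [k [-> -> -> ->]] := aux s t v u s' t' v' u' s0 v0 m2 m1 m4 m3; exists k.
- by have [k [-> -> -> ->]] := aux t s u v t' s' u' v' t0 u0 m3 m4 m1 m2; exists k.
- by have [k [-> -> -> ->]] := aux t s v u t' s' v' u' t0 v0 m4 m3 m2 m1; exists k.
Qed.

(** The mixed 2 by 2 minors of two commuting vectors vanish, which makes them proportional if the
    first has non-zero components in both planes. So there are no other abelian planes. *)
Lemma planes_comm2 e0 e1 e2 e3 x : planes e0 e1 e2 e3 -> comm2 x ->
  (exists s t, x = s *: e0 + t *: e1) \/ (exists u v, x = u *: e2 + v *: e3).
Proof.
move=> P [y [[x0 ny] bxy]]; have [B _ _] := P.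
have [s [t [u [v xE]]]] := basis4_coord x B.
have [s' [t' [u' [v' yE]]]] := basis4_coord y B.
move: bxy; rewrite {1}xE yE => /(planes_minors P)[m1 m2 m3 m4].
have [/orP st0|] := boolP ((s != 0) || (t != 0)); last first.
  rewrite negb_or !negbK => /andP[/eqP s0 /eqP t0]; right; exists u, v.
  by rewrite xE s0 t0 !scale0r !add0r.
have [/orP uv0|] := boolP ((u != 0) || (v != 0)); last first.
  rewrite negb_or !negbK => /andP[/eqP u0 /eqP v0]; left; exists s, t.
  by rewrite xE u0 v0 !scale0r !addr0.
have [k [s'E t'E u'E v'E]] : exists k : K, [/\ s' = k * s, t' = k * t, u' = k * u & v' = k * v].
  apply: minors_prop m1 m2 m3 m4; first by case: st0 => ->; [left|right].
  by case: uv0 => ->; [left|right].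
case/negP: (ny k); rewrite yE xE s'E t'E u'E v'E !scalerDr !scalerA.
by [].
Qed.

Lemma planes_comm_in e0 e1 e2 e3 s t y : planes e0 e1 e2 e3 ->
  s != 0 \/ t != 0 -> b (s *: e0 + t *: e1) y = 0 ->
  exists s' t', y = s' *: e0 + t' *: e1.
Proof.
move=> P st0; have [B _ _] := P.
have [s' [t' [u' [v' ->]]]] := basis4_coord y B.
have -> : s *: e0 + t *: e1 = s *: e0 + t *: e1 + 0 *: e2 + 0 *: e3.
  by rewrite !scale0r !addr0.
move/(planes_minors P); rewrite !mul0r => -[/eqP m1 /eqP m2 /eqP m3 /eqP m4].
exists s', t'; suff [-> ->] : u' = 0 /\ v' = 0 by rewrite !scale0r !addr0.
move: m1 m2 m3 m4; rewrite !mulf_eq0.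
by case: st0 => /negPf -> /= => [/eqP -> /eqP -> _ _|_ _ /eqP -> /eqP ->].
Qed.

Definition adtr (x : V) := \tr (lin1_mx (b x)).

Lemma adtr_lin k x y : adtr (k *: x + y) = k * adtr x + adtr y.
Proof.
rewrite /adtr -mxtraceZ -mxtraceD; congr (\tr _); apply/matrixP => i j.
by rewrite !mxE linearDl linearZl_LR !mxE.
Qed.

Lemma adtr_act t S x : semiaut t S -> adtr (act t S x) = t (adtr x).
Proof.
move=> [_ US E]; rewrite /adtr -trace_map_mx.
have H : map_mx t (lin1_mx (b x)) *m S = S *m lin1_mx (b (act t S x)).
  apply/row_matrixP => i; rewrite !rowE !mulmxA mul_rV_lin1 /=.
  rewrite -{1}(map_delta_mx t) -map_mxM mul_rV_lin1 -/(act t S _) E.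
  by rewrite /act map_delta_mx.
by rewrite -(mulmxK US (map_mx t _)) H mxtrace_mulC mulmxA mulVmx // mul1mx.
Qed.

(** The kernel of the linear form [adtr] is stable, and in dimension 4 it contains a non-zero
    vector; so it spans the space and the form is 0. *)
Lemma adtr0 x : adtr x = 0.
Proof.
pose w : 'cV[K]_4 := \col_i adtr (delta_mx 0 i).
have wE (y : V) : y *m w = (adtr y)%:M.
  rewrite [y in RHS]row_sum_delta; apply/rowP => j; rewrite !ord1 !mxE mulr1n.
  have -> I : adtr (\sum_(i <- I) y 0 i *: delta_mx 0 i) =
              \sum_(i <- I) y 0 i * adtr (delta_mx 0 i).
    elim: I => [|i I IH]; last by rewrite !big_cons adtr_lin IH.
    rewrite !big_nil; have := adtr_lin (-1) 0 0.
    by rewrite scaler0 addr0 mulN1r addNr.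
  by apply: eq_bigr => i _; rewrite mxE.
suff w0 : w = 0 by have /rowP/(_ 0) := wE x; rewrite w0 mulmx0 !mxE mulr1n.
apply/eqP/negPn/negP => w0.
have nf : ~~ row_full (kermx w).
  rewrite -col_leq_rank mxrank_ker -ltnNge ltn_subLR ?rank_leq_row //.
  by rewrite -[X in (X < _)%N]add0n ltn_add2r lt0n mxrank_eq0.
have sX : stable (fun y => adtr y = 0).
  by move=> t S y A y0; rewrite adtr_act // y0 rmorph0.
have [e0 [e1 [e2 [e3 [B _ _]]]]] := exists_planes.
have [z [z0 Xz]] : exists z, z != 0 /\ adtr z = 0.
  exists (if adtr e0 == 0 then e0 else - (adtr e1 / adtr e0) *: e0 + e1).
  case: (eqVneq (adtr e0) 0) => [E|n0]; split=> //.
  - apply/eqP => z0; have := @basis4_free _ e0 e1 e2 e3 1 0 0 0 B.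
    by rewrite !scale0r z0 scaler0 !addr0 => -[] // /eqP; rewrite oner_eq0.
  - apply/eqP => z0; have := @basis4_free _ e0 e1 e2 e3 (- (adtr e1 / adtr e0)) 1 0 0 B.
    by rewrite scale1r z0 !scale0r !addr0 => -[] // _ /eqP; rewrite oner_eq0.
  - by rewrite adtr_lin; field.
have [y Xy] := span_stable sX Xz z0 nf.
by rewrite sub_kermx wE Xy raddf0 eqxx.
Qed.

(** [u + v'] is the trace of [ad e0], which kills the first plane. The operator induced on the
    two-dimensional quotient is thus traceless, so that its square is a scalar. *)
Lemma planes_trace e0 e1 e2 e3 s t u v s' t' u' v' : planes e0 e1 e2 e3 ->
  b e0 e2 = s *: e0 + t *: e1 + u *: e2 + v *: e3 ->
  b e0 e3 = s' *: e0 + t' *: e1 + u' *: e2 + v' *: e3 -> u + v' = 0.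
Proof.
case=> B b01 b23 E2 E3; rewrite -[RHS](adtr0 e0) /adtr.
pose M := rows4 0 0 (vec4 s t u v) (vec4 s' t' u' v').
pose E := rows4 e0 e1 e2 e3.
have H : E *m lin1_mx (b e0) = M *m E.
  apply/row_matrixP => i; rewrite !row_mul mul_rV_lin1 /E /M !rowK /=.
  case: i => [[|[|[|[|i]]]] Hi] //=; rewrite ?bxx ?b01 ?mul0mx //.
    by rewrite mul_rows4 lin4_vec4.
  by rewrite mul_rows4 lin4_vec4.
rewrite -(mulKmx B (lin1_mx _)) -/E H mxtrace_mulC mulmxK //.
rewrite /mxtrace !big_ord_recl big_ord0 addr0 /M !mxE /= !add0r.
by [].
Qed.

(** The traceless matrices with rows [(A, B)], [(C, -A)] and [(A', B')], [(C', -A')] span a space of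
    nilpotent matrices. Such a space has dimension at most 1, whence a common kernel vector. *)
Lemma quad_rank (A B C A' B' C' : K) :
  A ^+ 2 + B * C = 0 -> 2%:R * A * A' + B * C' + B' * C = 0 ->
  A' ^+ 2 + B' * C' = 0 -> exists x y, (x != 0 \/ y != 0) /\
  [/\ A * x + B * y = 0, C * x - A * y = 0, A' * x + B' * y = 0 & C' * x - A' * y = 0].
Proof.
move=> q0 q01 q1.
(* The square of each expression [m13] to [m24] below lies in the ideal of the three hypotheses; the
   cofactors are given explicitly. *)
have sq0 (z k k1 k2 : K) : z ^+ 2 = k * (A ^+ 2 + B * C) +
    k1 * (2%:R * A * A' + B * C' + B' * C) + k2 * (A' ^+ 2 + B' * C') -> z = 0.
  by rewrite q0 q01 q1 !mulr0 !addr0 => /eqP; rewrite expf_eq0 => /eqP.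
have m12 : C * B + A * A = 0 by rewrite -q0; ring.
have m34 : C' * B' + A' * A' = 0 by rewrite -q1; ring.
have m13 : A * B' - B * A' = 0.
  by apply: (sq0 _ (B' ^+ 2) (- (B * B')) (B ^+ 2)); ring.
have m14 : A * A' + B * C' = 0.
  by apply: (sq0 _ (A' ^+ 2) (B * C') (- (B * C))); ring.
have m23 : C * B' + A * A' = 0.
  by apply: (sq0 _ (A' ^+ 2) (B' * C) (- (B * C))); ring.
have m24 : C * A' - A * C' = 0.
  by apply: (sq0 _ (C' ^+ 2) (- (C * C')) (C ^+ 2)); ring.
have [/orP n|] := boolP ((B != 0) || (A != 0)).
  exists B, (- A); rewrite oppr_eq0; split=> //; split.
  - ring.
  - by rewrite -m12; ring.
  - by apply/eqP; rewrite -oppr_eq0; apply/eqP; rewrite -m13; ring.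
  - by rewrite -m14; ring.
rewrite negb_or !negbK => /andP[/eqP B0 /eqP A0].
have [C0|C0] := eqVneq C 0; last first.
  exists 0, 1; rewrite oner_eq0; split; first by right.
  rewrite A0 B0 !mulr1 !mulr0 !add0r oppr0; split=> //.
    by apply: (mulfI C0); rewrite mulr0 -m23 A0; ring.
  apply/eqP; rewrite oppr_eq0; apply/eqP.
  by apply: (mulfI C0); rewrite mulr0 -m24 A0; ring.
have [/orP n|] := boolP ((B' != 0) || (A' != 0)).
  exists B', (- A'); rewrite oppr_eq0; split=> //.
  rewrite A0 B0 C0; split; [ring | ring | ring | by rewrite -m34; ring].
rewrite negb_or !negbK => /andP[/eqP B'0 /eqP A'0].
exists 0, 1; rewrite oner_eq0 A0 A'0 B0 B'0; split; first by right.
by split; ring.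
Qed.

Definition in2 (e0 e1 x : V) := exists s t, x = s *: e0 + t *: e1.

Lemma dual4 e0 e1 e2 e3 (u v : K) : basis4 e0 e1 e2 e3 -> exists w : 'cV[K]_4,
  [/\ e0 *m w = 0, e1 *m w = 0, e2 *m w = u%:M & e3 *m w = v%:M].
Proof.
move=> B; pose c := (vec4 0 0 u v)^T; exists (invmx (rows4 e0 e1 e2 e3) *m c).
have H i : row i (rows4 e0 e1 e2 e3) *m (invmx (rows4 e0 e1 e2 e3) *m c) = (c i 0)%:M.
  rewrite -row_mul mulKVmx //; apply/rowP => j; rewrite !ord1 !mxE mulr1n.
  by [].
split; [have := H 0|have := H 1|have := H 2%:R|have := H 3%:R];
  by rewrite rowK /c !mxE /= => ->; rewrite ?raddf0.
Qed.

(** By tracelessness the square of [ad x] modulo the first plane is a scalar, quadratic in [x]. If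
    this form were zero, [quad_rank] would yield a non-zero functional on the quotient that kills
    every bracket, against [br_kill]. *)
Lemma planes_quad e0 e1 e2 e3 : planes e0 e1 e2 e3 -> exists c0 c01 c1,
  (forall s t y, in2 e2 e3 y -> exists2 w, in2 e0 e1 w &
     b (s *: e0 + t *: e1) (b (s *: e0 + t *: e1) y) =
     w + (c0 * s ^+ 2 + c01 * s * t + c1 * t ^+ 2) *: y) /\
  ~ [/\ c0 = 0, c01 = 0 & c1 = 0].
Proof.
move=> P; have [B b01 b23] := P.
have [p0 [q0 [A [B0 E02]]]] := basis4_coord (b e0 e2) B.
have [r0 [s0 [C [D E03]]]] := basis4_coord (b e0 e3) B.
have [p1 [q1 [A' [B1 E12]]]] := basis4_coord (b e1 e2) B.
have [r1 [s1 [C' [D' E13]]]] := basis4_coord (b e1 e3) B.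
have DE : D = - A.
  by apply/eqP; rewrite -addr_eq0 addrC; apply/eqP/(planes_trace P E02 E03).
have D'E : D' = - A'.
  have P' : planes e1 e0 e2 e3.
    split=> //; last by rewrite (bC e0 e1) b01 oppr0.
    apply: basis4_intro => s t u v; rewrite (addrC (s *: _)).
    by case/(basis4_free B).
  apply/eqP; rewrite -addr_eq0 addrC; apply/eqP.
  by apply: (planes_trace P' (s := q1) (t := p1) (s' := s1) (t' := r1));
    rewrite ?(addrC (q1 *: _)) ?(addrC (s1 *: _)); [exact: E12|exact: E13].
rewrite {}DE in E03; rewrite {}D'E in E13.
exists (A ^+ 2 + B0 * C), (2%:R * A * A' + B0 * C' + B1 * C), (A' ^+ 2 + B1 * C').
split; last first.
  case=> c0 c01 c1; have [x [y [xy0 [k0 k1 k2 k3]]]] := quad_rank c0 c01 c1.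
  have [w [w0 w1 w2 w3]] := dual4 x y B.
  have : w = 0.
    apply: (br_kill_basis B); rewrite ?b01 ?b23 ?mul0mx //;
      rewrite ?E02 ?E03 ?E12 ?E13 !mulmxDl -!scalemxAl w0 w1 w2 w3 !scaler0 !add0r;
      rewrite !scale_scalar_mx -raddfD /=.
    - by rewrite k0 raddf0.
    - by rewrite mulNr k1 raddf0.
    - by rewrite k2 raddf0.
    - by rewrite mulNr k3 raddf0.
  move=> wz; move: w2 w3; rewrite wz !mulmx0 => /esym/rowP/(_ 0) + /esym/rowP/(_ 0).
  rewrite !mxE !mulr1n => x0 y0.
  by case: xy0; rewrite ?x0 ?y0 eqxx.
move=> s t _ [u [v ->]].
set x := s *: e0 + t *: e1.
have bx u' v' : exists2 w, in2 e0 e1 w & b x (u' *: e2 + v' *: e3) = w +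
   ((u' * (s * A + t * A') + v' * (s * C + t * C')) *: e2 +
    (u' * (s * B0 + t * B1) - v' * (s * A + t * A')) *: e3).
  exists ((u' * s * p0 + u' * t * p1 + v' * s * r0 + v' * t * r1) *: e0 +
          (u' * s * q0 + u' * t * q1 + v' * s * s0 + v' * t * s1) *: e1).
    by eexists _, _.
  rewrite /x !(linearDl, linearDr, linearZl_LR, linearZr_LR) /= E02 E03 E12 E13.
  by apply/rowP => i; rewrite !mxE; ring.
have bw w : in2 e0 e1 w -> b x w = 0.
  move=> [p [q ->]]; rewrite /x !(linearDl, linearDr, linearZl_LR, linearZr_LR) /=.
  by rewrite !bxx (bC e0 e1) b01 oppr0 !scaler0 !addr0.
have [w1 W1 ->] := bx u v; rewrite linearDr (bw _ W1) add0r.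
have [w2 W2 ->] := bx (u * (s * A + t * A') + v * (s * C + t * C'))
  (u * (s * B0 + t * B1) - v * (s * A + t * A')).
exists w2 => //; congr (_ + _).
by apply/rowP => i; rewrite !mxE; ring.
Qed.

(** For [x] in one of the planes, [(ad x)^2] is a scalar [q(x)] modulo the plane, which [ad x]
    kills; so [(ad x)^3 = 0] says [q(x) = 0]. This form of isotropy mentions the product only and is
    therefore stable. *)
Definition singular x := comm2 x /\ forall y, b x (b x (b x y)) = 0.

Lemma singular_stable : stable singular.
Proof.
move=> t S x A [X N]; split; first exact: comm2_stable.
move=> y; have [z ->] := semiaut_surj A y.
by case: A => _ _ E; rewrite -!E N semiaut0.
Qed.

Lemma in2_comm2 e0 e1 e2 e3 s t : planes e0 e1 e2 e3 -> s != 0 \/ t != 0 ->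
  comm2 (s *: e0 + t *: e1).
Proof.
case=> B b01 _ st0.
have b10 : b e1 e0 = 0 by rewrite (bC e0 e1) b01 oppr0.
have n0 : s *: e0 + t *: e1 != 0.
  apply/eqP => E; have := @basis4_free _ e0 e1 e2 e3 s t 0 0 B.
  by rewrite E !scale0r !addr0 => -[] // s0 t0; case: st0; rewrite ?s0 ?t0 eqxx.
have [s0|s0] := eqVneq s 0; last first.
  exists e1; rewrite linearDl !linearZl_LR /= b01 bxx !scaler0 addr0; split=> //; split=> // k.
  apply/eqP => E; have := @basis4_free _ e0 e1 e2 e3 (k * s) (k * t - 1) 0 0 B.
  rewrite !scale0r !addr0 scalerBl scale1r {2}E scalerDr !scalerA addrA subrr => -[] //.
  move/eqP; rewrite mulf_eq0 (negPf s0) orbF => /eqP ->.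
  by rewrite mul0r sub0r => /eqP; rewrite oppr_eq0 oner_eq0.
have t0 : t != 0 by case: st0; rewrite ?s0 ?eqxx.
exists e0; rewrite linearDl !linearZl_LR /= b10 bxx !scaler0 addr0; split=> //; split=> // k.
apply/eqP => E; have := @basis4_free _ e0 e1 e2 e3 (k * s - 1) (k * t) 0 0 B.
rewrite !scale0r !addr0 scalerBl scale1r {2}E scalerDr !scalerA.
rewrite addrAC subrr => -[] // + /eqP; rewrite mulf_eq0 (negPf t0) orbF => + /eqP k0.
by rewrite k0 mul0r sub0r => /eqP; rewrite oppr_eq0 oner_eq0.
Qed.

Lemma in2_abelian e0 e1 e2 e3 x y : planes e0 e1 e2 e3 -> in2 e0 e1 x ->
  in2 e0 e1 y -> b x y = 0.
Proof.
case=> B b01 _ [s [t ->]] [s' [t' ->]].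
rewrite !(linearDl, linearDr, linearZl_LR, linearZr_LR) /= !bxx.
by rewrite (bC e0 e1) b01 oppr0 !scaler0 !addr0.
Qed.

Lemma planes_cube e0 e1 e2 e3 s t : planes e0 e1 e2 e3 ->
  (forall y, in2 e2 e3 y -> in2 e0 e1
     (b (s *: e0 + t *: e1) (b (s *: e0 + t *: e1) y))) ->
  forall y, b (s *: e0 + t *: e1) (b (s *: e0 + t *: e1) (b (s *: e0 + t *: e1) y)) = 0.
Proof.
move=> P H y; have [B b01 _] := P; set x := s *: e0 + t *: e1.
have X : in2 e0 e1 x by exists s, t.
have [p [q [r [k ->]]]] := basis4_coord y B.
rewrite -(addrA (_ + _)) (linearDr b x (p *: e0 + q *: e1)).
rewrite (in2_abelian (y := p *: e0 + q *: e1) P X) ?add0r; last by exists p, q.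
by apply: (in2_abelian P X); apply: H; exists r, k.
Qed.

Lemma singular_in e0 e1 e2 e3 s t : planes e0 e1 e2 e3 -> s != 0 \/ t != 0 ->
  (forall y, in2 e2 e3 y -> in2 e0 e1
     (b (s *: e0 + t *: e1) (b (s *: e0 + t *: e1) y))) ->
  singular (s *: e0 + t *: e1).
Proof.
by move=> P st0 H; split; [exact: in2_comm2 P st0 | exact: planes_cube P H].
Qed.

(** A binary quadratic form over a closed field has a zero, so isotropic vectors exist and span. As
    they lie in the union of the two planes, each plane has a basis of them. *)
Lemma exists_singular_planes : exists e0 e1 e2 e3, planes e0 e1 e2 e3 /\
  [/\ singular e0, singular e1, singular e2 & singular e3].
Proof.
have [e0 [e1 [e2 [e3 P]]]] := exists_planes.
have [B _ _] := P.
have [c0 [c01 [c1 [H _]]]] := planes_quad P.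
have [s [t [st0 E]]] := closed_quad c0 c01 c1.
have Sx : singular (s *: e0 + t *: e1).
  apply: singular_in P st0 _ => y /(H s t)[w W ->].
  by rewrite E scale0r addr0.
set x := s *: e0 + t *: e1 in Sx.
have x0 : x != 0 by case: Sx => -[y [[]]].
have sp := span_stable singular_stable Sx x0.
have in01 u : singular u -> (forall p q, u != p *: e2 + q *: e3) -> in2 e0 e1 u.
  move=> [Cu _] nu; case: (planes_comm2 P Cu) => // -[p [q /eqP]].
  by rewrite (negPf (nu _ _)).
have in23 u : singular u -> (forall p q, u != p *: e0 + q *: e1) -> in2 e2 e3 u.
  move=> [Cu _] nu; case: (planes_comm2 P Cu) => // -[p [q /eqP]].
  by rewrite (negPf (nu _ _)).
have [f0 S0 /rows4_sub n0] := sp _ (rows4_0_nfull e2 e3 0).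
have [f1 S1 /rows4_sub n1] := sp _ (rows4_0_nfull e2 e3 f0).
have [f2 S2 /rows4_sub n2] := sp _ (rows4_0_nfull e0 e1 0).
have [f3 S3 /rows4_sub n3] := sp _ (rows4_0_nfull e0 e1 f2).
have I0 : in2 e0 e1 f0.
  by apply: in01 => // p q; have := n0 p q 0 0; rewrite !scaler0 !addr0.
have I1 : in2 e0 e1 f1.
  by apply: in01 => // p q; have := n1 p q 0 0; rewrite !scale0r !addr0.
have I2 : in2 e2 e3 f2.
  by apply: in23 => // p q; have := n2 p q 0 0; rewrite !scaler0 !addr0.
have I3 : in2 e2 e3 f3.
  by apply: in23 => // p q; have := n3 p q 0 0; rewrite !scale0r !addr0.
exists f0, f1, f2, f3; split=> //; split.
- have d p q r v : in2 e0 e1 (p *: f0 + q *: f1).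
    move: I0 I1 => [s0 [t0 ->]] [s1 [t1 ->]].
    exists (p * s0 + q * s1), (p * t0 + q * t1).
    by apply/rowP => i; rewrite !mxE; ring.
  apply: basis4_intro => p q r v E4.
  have : in2 e0 e1 (p *: f0 + q *: f1) /\ in2 e2 e3 (r *: f2 + v *: f3).
    move: I0 I1 I2 I3 => [s0 [t0 ->]] [s1 [t1 ->]] [s2 [t2 ->]] [s3 [t3 ->]].
    split; [exists (p * s0 + q * s1), (p * t0 + q * t1)|
            exists (r * s2 + v * s3), (r * t2 + v * t3)];
    by apply/rowP => i; rewrite !mxE; ring.
  case=> -[a0 [a1 E01]] [a2 [a3 E23]].
  have [a00 a10 a20 a30] : [/\ a0 = 0, a1 = 0, a2 = 0 & a3 = 0].
    by apply: (basis4_free B); rewrite -addrA -E23 -E01 addrA.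
  rewrite a00 a10 !scale0r addr0 in E01; rewrite a20 a30 !scale0r addr0 in E23.
  have [q0|q0] := eqVneq q 0; last first.
    case/negP: (n1 0 0 (- (p / q)) 0); rewrite !scale0r !add0r addr0; apply/eqP.
    apply: (scalerI q0); rewrite scalerA mulrN mulrCA divff // mulr1 scaleNr.
    by move/eqP: E01; rewrite addrC addr_eq0 => /eqP.
  have [v0|v0] := eqVneq v 0; last first.
    case/negP: (n3 0 0 (- (r / v)) 0); rewrite !scale0r !add0r addr0; apply/eqP.
    apply: (scalerI v0); rewrite scalerA mulrN mulrCA divff // mulr1 scaleNr.
    by move/eqP: E23; rewrite addrC addr_eq0 => /eqP.
  move: E01 E23; rewrite q0 v0 !scale0r !addr0.
  have [[[y [[f00 _] _]] _] [[z [[f20 _] _]] _]] := (S0, S2).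
  by move=> /eqP; rewrite scaler_eq0 (negPf f00) orbF => /eqP -> /eqP;
    rewrite scaler_eq0 (negPf f20) orbF => /eqP ->.
- exact: in2_abelian P I0 I1.
- exact: in2_abelian (planes_sym P) I2 I3.
Qed.

Section Lines.
Variables e0 e1 e2 e3 : V.
Hypothesis P : planes e0 e1 e2 e3.
Hypotheses (S0 : singular e0) (S1 : singular e1).

(** In an isotropic basis the quadratic form of the plane is [c s t], and [c] is non-zero because
    the form is. The condition on cubes does give isotropy, since [ad x] does not kill [e2]. *)
Lemma anticomm : exists2 c, c != 0 &
  forall s t y, in2 e2 e3 y -> exists2 w, in2 e0 e1 w &
    b (s *: e0 + t *: e1) (b (s *: e0 + t *: e1) y) = w + (c * s * t) *: y.
Proof.
have [c0 [c01 [c1 [H n0]]]] := planes_quad P.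
have [B _ _] := P.
have key s t : (forall y,
      b (s *: e0 + t *: e1) (b (s *: e0 + t *: e1) (b (s *: e0 + t *: e1) y)) = 0) ->
    s != 0 \/ t != 0 -> c0 * s ^+ 2 + c01 * s * t + c1 * t ^+ 2 = 0.
  move=> N st0; set x := s *: e0 + t *: e1 in N *; set k := _ + _.
  have X : in2 e0 e1 x by exists s, t.
  have := N e2; have [w W ->] : exists2 w, in2 e0 e1 w & b x (b x e2) = w + k *: e2.
    by apply: H; exists 1, 0; rewrite scale1r scale0r addr0.
  rewrite linearDr (in2_abelian P X W) add0r linearZr_LR /= => /eqP.
  rewrite scaler_eq0 => /orP[/eqP //|/eqP bx].
  have [s' [t' E]] := planes_comm_in P st0 bx.
  have := @basis4_free _ e0 e1 e2 e3 s' t' (-1) 0 B.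
  rewrite -E scaleN1r subrr scale0r addr0 => -[] // _ _ /eqP.
  by rewrite oppr_eq0 oner_eq0.
have c00 : c0 = 0.
  have := key 1 0; rewrite scale1r scale0r addr0 => /(_ (proj2 S0)) <-.
    by ring.
  by left; apply: oner_neq0.
have c10 : c1 = 0.
  have := key 0 1; rewrite scale1r scale0r add0r => /(_ (proj2 S1)) <-.
    by ring.
  by right; apply: oner_neq0.
exists c01; first by apply/eqP => c010; apply: n0.
move=> s t y /(H s t)[w W E]; exists w => //; rewrite E c00 c10.
by congr (_ + _ *: _); ring.
Qed.

Lemma singular_line x : singular x -> in2 e0 e1 x -> exists2 k, k != 0 &
  x = k *: e0 \/ x = k *: e1.
Proof.
move=> Sx [s [t xE]]; have [B _ _] := P.
have x0 : x != 0 by case: Sx => -[y [[]]].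
have [c c0 H] := anticomm.
have [s0|s0] := eqVneq s 0.
  move: xE; rewrite s0 scale0r add0r => xE; exists t; last by right.
  by apply: contra x0 => /eqP t0; rewrite xE t0 scale0r.
have [t0|t0] := eqVneq t 0.
  by exists s => //; left; rewrite xE t0 scale0r addr0.
have [_ N] := Sx; have := N e2.
have X : in2 e0 e1 x by exists s, t.
have [w W E] : exists2 w, in2 e0 e1 w & b x (b x e2) = w + (c * s * t) *: e2.
  by rewrite xE; apply: H; exists 1, 0; rewrite scale1r scale0r addr0.
rewrite E linearDr (in2_abelian P X W) add0r linearZr_LR /= => /eqP.
rewrite scaler_eq0 !mulf_eq0 (negPf c0) (negPf s0) (negPf t0) /= => /eqP bx.
have st0 : s != 0 \/ t != 0 by left.
rewrite xE in bx; have [s' [t' E2]] := planes_comm_in P st0 bx.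
have := @basis4_free _ e0 e1 e2 e3 s' t' (-1) 0 B.
rewrite -E2 scaleN1r subrr scale0r addr0 => -[] // _ _ /eqP.
by rewrite oppr_eq0 oner_eq0.
Qed.

End Lines.

Lemma act_id (g : 'M[K]_4) (x : V) : act idfun g x = x *m g.
Proof. by rewrite /act map_mx_id. Qed.

Lemma isaut_semi g : isaut b g -> semiaut idfun g.
Proof.
case=> U E; split=> //; first by exists idfun.
by move=> x y; rewrite !act_id.
Qed.

Section Lines.
Variables e0 e1 e2 e3 : V.
Hypothesis P : planes e0 e1 e2 e3.
Hypotheses (S0 : singular e0) (S1 : singular e1).
Hypotheses (S2 : singular e2) (S3 : singular e3).

Lemma singular_cases x : singular x -> exists2 k, k != 0 &
  [\/ x = k *: e0, x = k *: e1, x = k *: e2 | x = k *: e3].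
Proof.
move=> Sx; case: (planes_comm2 P (proj1 Sx)) => X.
  have [k k0 [->|->]] := singular_line P S0 S1 Sx X; exists k => //.
    by constructor 1.
  by constructor 2.
have [k k0 [->|->]] := singular_line (planes_sym P) S2 S3 Sx X; exists k => //.
  by constructor 3.
by constructor 4.
Qed.

Lemma isaut_singular g x : isaut b g -> singular x -> singular (x *m g).
Proof. by move=> /isaut_semi A Sx; rewrite -act_id; apply: singular_stable. Qed.

Lemma in2_disj x : in2 e0 e1 x -> in2 e2 e3 x -> x = 0.
Proof.
case=> s [t ->] [u [v E]]; have [B _ _] := P.
have := @basis4_free _ e0 e1 e2 e3 s t (- u) (- v) B.
rewrite -addrA !scaleNr -opprD -E subrr => -[] // -> -> _ _.
by rewrite !scale0r addr0.
Qed.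

(* The square of ad (s e0 + t e1) modulo the plane <e0, e1> is a scalar,
   proportional to s t, and invariant under automorphisms. *)
Lemma aut_det1 g s t : isaut b g -> (e0 + e1) *m g = s *: e0 + t *: e1 ->
  (forall w, in2 e0 e1 w -> in2 e0 e1 (w *m g)) -> in2 e2 e3 (e2 *m g) ->
  s * t = 1.
Proof.
move=> [Ug ag] E st01 I2; have [B _ _] := P.
have [c c0 H] := anticomm P S0 S1.
have I : in2 e2 e3 e2 by exists 1, 0; rewrite scale1r scale0r addr0.
have [w W] := H 1 1 e2 I; rewrite !scale1r => /(congr1 (mulmx^~ g)).
have [w' W' E'] := H s t _ I2.
rewrite !ag E E' mulmxDl -scalemxAl mulr1 mulr1 => /esym E2.
have : in2 e0 e1 ((c * s * t - c) *: (e2 *m g)).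
  have [p [q Wp]] := st01 _ W; have [p' [q' Wp']] := W'.
  have E3 : (c * s * t - c) *: (e2 *m g) = w *m g - w'.
    rewrite scalerBl; apply/eqP; rewrite subr_eq addrAC E2.
    by rewrite addrC addKr.
  exists (p - p'), (q - q').
  rewrite E3 Wp Wp'.
  by apply/rowP => i; rewrite !mxE; ring.
move=> /in2_disj.
have : in2 e2 e3 ((c * s * t - c) *: (e2 *m g)).
  have [p [q ->]] := I2; exists ((c * s * t - c) * p), ((c * s * t - c) * q).
  by rewrite scalerDr !scalerA.
move=> I3 /(_ I3) /eqP; rewrite scaler_eq0 => /orP[|/eqP e20].
  rewrite subr_eq0 -mulrA -[X in _ == X]mulr1 (inj_eq (mulfI c0)) => /eqP //.
have e2z : e2 = 0 by rewrite -(mulmxK Ug e2) e20 mul0mx.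
by case: S2 => -[y [[]]]; rewrite e2z eqxx.
Qed.

End Lines.

(** * Automorphisms fixing an isotropic line *)

Section Fixing.
Variables e0 e1 e2 e3 : V.
Hypothesis P : planes e0 e1 e2 e3.
Hypotheses (S0 : singular e0) (S1 : singular e1).
Hypotheses (S2 : singular e2) (S3 : singular e3).
Variables (g : 'M[K]_4) (l0 : K).
Hypotheses (Ag : isaut b g) (E0 : e0 *m g = l0 *: e0).

Lemma basis4_neq0 : [/\ e0 != 0, e1 != 0, e2 != 0 & e3 != 0].
Proof.
by split; [case: S0|case: S1|case: S2|case: S3] => -[y [[]]].
Qed.

(** The centralizer of [e0] is the plane [<e0, e1>], so [g] keeps that plane and its other isotropic
    line. A swap of the lines of [e2] and [e3] remains to be excluded: the two computations of the
    traces give [l0 + l1 = 0] and [l0^2 + l1^2 = 2], which contradicts [l0 l1 = 1] in characteristic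
    not 2. *)
Lemma aut_fix_line : exists l1 l2 l3,
  [/\ e1 *m g = l1 *: e1, e2 *m g = l2 *: e2, e3 *m g = l3 *: e3,
      l0 * l1 = 1 & l2 * l3 = 1].
Proof.
have [Ug ag] := Ag; have [B b01 b23] := P.
have [n0 n1 n2 n3] := basis4_neq0.
have inj (x : V) : x *m g = 0 -> x = 0 by move=> E; rewrite -(mulmxK Ug x) E mul0mx.
have l00 : l0 != 0.
  by apply: contra n0 => /eqP E; apply/eqP/inj; rewrite E0 E scale0r.
have dep (x y z : V) k k' : x *m g = k *: z -> y *m g = k' *: z -> k' *: x - k *: y = 0.
  move=> Ex Ey; apply: inj; rewrite mulmxBl -!scalemxAl Ex Ey !scalerA mulrC.
  exact: subrr.
have f01 p q : p *: e0 - q *: e1 = 0 -> p = 0 /\ q = 0.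
  move=> E; have := @basis4_free _ e0 e1 e2 e3 p (- q) 0 0 B.
  by rewrite !scale0r !addr0 scaleNr => /(_ E)[-> /eqP]; rewrite oppr_eq0 => /eqP ->.
have f02 p q : p *: e0 - q *: e2 = 0 -> p = 0 /\ q = 0.
  move=> E; have := @basis4_free _ e0 e1 e2 e3 p 0 (- q) 0 B.
  by rewrite !scale0r !addr0 scaleNr => /(_ E)[-> _ /eqP]; rewrite oppr_eq0 => /eqP ->.
have f03 p q : p *: e0 - q *: e3 = 0 -> p = 0 /\ q = 0.
  move=> E; have := @basis4_free _ e0 e1 e2 e3 p 0 0 (- q) B.
  by rewrite !scale0r !addr0 scaleNr => /(_ E)[-> _ _ /eqP]; rewrite oppr_eq0 => /eqP ->.
have f12 p q : p *: e1 - q *: e2 = 0 -> p = 0 /\ q = 0.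
  move=> E; have := @basis4_free _ e0 e1 e2 e3 0 p (- q) 0 B.
  by rewrite !scale0r !addr0 add0r scaleNr => /(_ E)[_ -> /eqP]; rewrite oppr_eq0 => /eqP ->.
have f13 p q : p *: e1 - q *: e3 = 0 -> p = 0 /\ q = 0.
  move=> E; have := @basis4_free _ e0 e1 e2 e3 0 p 0 (- q) B.
  by rewrite !scale0r !addr0 add0r scaleNr => /(_ E)[_ -> _ /eqP]; rewrite oppr_eq0 => /eqP ->.
have f23 p q : p *: e2 - q *: e3 = 0 -> p = 0 /\ q = 0.
  move=> E; have := @basis4_free _ e0 e1 e2 e3 0 0 p (- q) B.
  by rewrite !scale0r !add0r scaleNr => /(_ E)[_ _ -> /eqP]; rewrite oppr_eq0 => /eqP ->.
have [l1 l10 E1] : exists2 l1, l1 != 0 & e1 *m g = l1 *: e1.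
  have I1 : in2 e0 e1 (e1 *m g).
    have E : b (l0 *: e0 + 0 *: e1) (e1 *m g) = 0.
      by rewrite scale0r addr0 -E0 -ag b01 mul0mx.
    by apply: (planes_comm_in P _ E); left.
  have [k k0 [E|E]] := singular_line P S0 S1 (isaut_singular Ag S1) I1.
    by have [k00 _] := f01 _ _ (dep _ _ _ _ _ E0 E); rewrite k00 eqxx in k0.
  by exists k.
have st01 w : in2 e0 e1 w -> in2 e0 e1 (w *m g).
  case=> s [t ->]; exists (s * l0), (t * l1).
  by rewrite mulmxDl -!scalemxAl E0 E1 !scalerA.
have E01 : (e0 + e1) *m g = l0 *: e0 + l1 *: e1 by rewrite mulmxDl E0 E1.
have [k2 k20 C2] := singular_cases P S0 S1 S2 S3 (isaut_singular Ag S2).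
have [k3 k30 C3] := singular_cases P S0 S1 S2 S3 (isaut_singular Ag S3).
have C2' : e2 *m g = k2 *: e2 \/ e2 *m g = k2 *: e3.
  case: C2 => E; [| | by left | by right].
    by have [k00 _] := f02 _ _ (dep _ _ _ _ _ E0 E); rewrite k00 eqxx in k20.
  by have [k00 _] := f12 _ _ (dep _ _ _ _ _ E1 E); rewrite k00 eqxx in k20.
have C3' : e3 *m g = k3 *: e2 \/ e3 *m g = k3 *: e3.
  case: C3 => E; [| | by left | by right].
    by have [k00 _] := f03 _ _ (dep _ _ _ _ _ E0 E); rewrite k00 eqxx in k30.
  by have [k00 _] := f13 _ _ (dep _ _ _ _ _ E1 E); rewrite k00 eqxx in k30.
have I2 : in2 e2 e3 (e2 *m g).
  by case: C2' => ->; [exists k2, 0|exists 0, k2]; rewrite scale0r ?addr0 ?add0r.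
have I3 : in2 e2 e3 (e3 *m g).
  by case: C3' => ->; [exists k3, 0|exists 0, k3]; rewrite scale0r ?addr0 ?add0r.
have l01 : l0 * l1 = 1 := aut_det1 P S0 S1 S2 Ag E01 st01 I2.
have st23 w : in2 e2 e3 w -> in2 e2 e3 (w *m g).
  case=> s [t ->]; move: I2 I3 => [p [q E]] [p' [q' E']].
  exists (s * p + t * p'), (s * q + t * q').
  rewrite mulmxDl -!scalemxAl E E'.
  by apply/rowP => i; rewrite !mxE; ring.
have I0 : in2 e0 e1 (e0 *m g) by apply: st01; exists 1, 0; rewrite scale1r scale0r addr0.
case: C2' C3' => E2 [] E3.
- have [k00 _] := f23 _ _ (dep _ _ _ _ _ E2 E3).
  by rewrite k00 eqxx in k30.
- exists l1, k2, k3; split=> //.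
  by apply: (aut_det1 (planes_sym P) S2 S3 S0 Ag _ st23 I0); rewrite mulmxDl E2 E3.
- have k23 : k3 * k2 = 1.
    apply: (aut_det1 (planes_sym P) S2 S3 S0 Ag _ st23 I0).
    by rewrite mulmxDl E2 E3 addrC.
  exfalso; have PB := planes_br P.
  (* compare the traces of g and g^2 in the bases e_i and [e_i, e_j] *)
  have t1 : \tr g = l0 + l1.
    rewrite (trace_basis4 (v0 := vec4 l0 0 0 0) (v1 := vec4 0 l1 0 0)
       (v2 := vec4 0 0 0 k2) (v3 := vec4 0 0 k3 0) B) ?mul_rows4 ?lin4_vec4
       ?scale0r ?addr0 ?add0r //.
    by rewrite !mxE /= !addr0.
  have t1' : \tr g = 0.
    rewrite (trace_basis4 (v0 := vec4 0 (l0 * k2) 0 0) (v1 := vec4 (l0 * k3) 0 0 0)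
       (v2 := vec4 0 0 0 (l1 * k2)) (v3 := vec4 0 0 (l1 * k3) 0) PB) ?mul_rows4 ?lin4_vec4
       ?scale0r ?addr0 ?add0r //; rewrite ?ag ?E0 ?E1 ?E2 ?E3;
      rewrite ?(linearZl_LR, linearZr_LR) /= ?scalerA //.
    by rewrite !mxE /= !addr0.
  have E22 : e2 *m (g *m g) = e2.
    by rewrite mulmxA E2 -scalemxAl E3 scalerA mulrC k23 scale1r.
  have E33 : e3 *m (g *m g) = e3.
    by rewrite mulmxA E3 -scalemxAl E2 scalerA k23 scale1r.
  have E00 : e0 *m (g *m g) = l0 ^+ 2 *: e0.
    by rewrite mulmxA E0 -scalemxAl E0 scalerA.
  have E11 : e1 *m (g *m g) = l1 ^+ 2 *: e1.
    by rewrite mulmxA E1 -scalemxAl E1 scalerA.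
  have ag2 x y : b x y *m (g *m g) = b (x *m (g *m g)) (y *m (g *m g)).
    by rewrite !mulmxA !ag.
  have t2 : \tr (g *m g) = l0 ^+ 2 + l1 ^+ 2 + 1 + 1.
    rewrite (trace_basis4 (v0 := vec4 (l0 ^+ 2) 0 0 0) (v1 := vec4 0 (l1 ^+ 2) 0 0)
       (v2 := vec4 0 0 1 0) (v3 := vec4 0 0 0 1) B) ?mul_rows4 ?lin4_vec4
       ?scale0r ?addr0 ?add0r ?scale1r //.
    by rewrite !mxE /=.
  have t2' : \tr (g *m g) = l0 ^+ 2 + l0 ^+ 2 + l1 ^+ 2 + l1 ^+ 2.
    rewrite (trace_basis4 (v0 := vec4 (l0 ^+ 2) 0 0 0) (v1 := vec4 0 (l0 ^+ 2) 0 0)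
       (v2 := vec4 0 0 (l1 ^+ 2) 0) (v3 := vec4 0 0 0 (l1 ^+ 2)) PB) ?mul_rows4 ?lin4_vec4
       ?scale0r ?addr0 ?add0r //; rewrite ?ag2 ?E00 ?E11 ?E22 ?E33;
      rewrite ?(linearZl_LR, linearZr_LR) /= ?scalerA //.
    by rewrite !mxE /=.
  have s0 : l0 + l1 = 0 by rewrite -t1.
  have q : l0 ^+ 2 + l1 ^+ 2 = - 2%:R.
    have -> : l0 ^+ 2 + l1 ^+ 2 = (l0 + l1) ^+ 2 - 2%:R * (l0 * l1) by ring.
    by rewrite s0 l01; ring.
  have : 2%:R * 2%:R = 0 :> K.
    have tt : l0 ^+ 2 + l1 ^+ 2 + 1 + 1 = l0 ^+ 2 + l0 ^+ 2 + l1 ^+ 2 + l1 ^+ 2.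
      by rewrite -t2 t2'.
    have -> : 2%:R * 2%:R = (l0 ^+ 2 + l1 ^+ 2 + 1 + 1) -
        (l0 ^+ 2 + l0 ^+ 2 + l1 ^+ 2 + l1 ^+ 2) :> K.
      have -> : l0 ^+ 2 + l1 ^+ 2 + 1 + 1 - (l0 ^+ 2 + l0 ^+ 2 + l1 ^+ 2 + l1 ^+ 2) =
         2%:R - (l0 ^+ 2 + l1 ^+ 2) by ring.
      by rewrite q; ring.
    by rewrite tt subrr.
  by move/eqP; rewrite mulf_eq0 (negPf char2).
- have [k00 _] := f23 _ _ (dep _ _ _ _ _ E2 E3).
  by rewrite k00 eqxx in k30.
Qed.

End Fixing.

Lemma frame_intro h0 h1 h2 h3 : basis4 h0 h1 h2 h3 ->
  b h0 h1 = h3 -> b h1 h2 = h0 -> b h2 h3 = h1 -> b h3 h0 = h2 ->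
  b h0 h2 = 0 -> b h1 h3 = 0 -> frame b (rows4 h0 h1 h2 h3).
Proof.
move=> B b01 b12 b23 b30 b02 b13; split=> // u v.
have b03 : b h0 h3 = - h2 by rewrite -b30 (bC h3 h0).
rewrite !mul_rows4 /lin4 b_expand // b01 b02 b03 b12 b13 b23 !mxE.
have [i01 i02 i11 i12] : [/\ 0 + 1 = 1 :> 'I_4, 0 + 2%:R = 2%:R :> 'I_4,
  1 + 1 = 2%:R :> 'I_4 & 1 + 2%:R = 3%:R :> 'I_4] by split; apply: val_inj.
have [i21 i22 i31 i32] : [/\ 2%:R + 1 = 3%:R :> 'I_4, 2%:R + 2%:R = 0 :> 'I_4,
  3%:R + 1 = 0 :> 'I_4 & 3%:R + 2%:R = 1 :> 'I_4] by split; apply: val_inj.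
rewrite i01 i02 i11 i12 i21 i22 i31 i32.
by apply/rowP => i; rewrite !mxE; ring.
Qed.

Section Fixing.
Variables (e0 e1 e2 e3 : V) (g : 'M[K]_4) (a : K).
Hypothesis P : planes e0 e1 e2 e3.
Hypotheses (S0 : singular e0) (S1 : singular e1).
Hypotheses (S2 : singular e2) (S3 : singular e3).
Hypotheses (Ag : isaut b g) (pa : 5.-primitive_root a).
Hypotheses (E0 : e0 *m g = a *: e0) (E1 : e1 *m g = a ^+ 4 *: e1).
Hypotheses (E2 : e2 *m g = a ^+ 2 *: e2) (E3 : e3 *m g = a ^+ 3 *: e3).

Lemma singularZ k x : k != 0 -> singular x -> singular (k *: x).
Proof.
move=> k0 [[y [[x0 ny] bxy]] N]; split; last first.
  by move=> z; rewrite !(linearZl_LR, linearZr_LR) /= N !scaler0.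
exists y; split; last by rewrite linearZl_LR /= bxy scaler0.
split; first by rewrite scaler_eq0 negb_or k0.
by move=> k'; rewrite scalerA.
Qed.

Lemma closed_root5 (x : K) : exists y, y ^+ 5 = x.
Proof.
have := @solve_monicpoly K 5 (fun i => if i == 0%N then x else 0) isT.
case=> y E; exists y; rewrite E !big_ord_recl big_ord0 /= expr0 mulr1.
by rewrite !mul0r !addr0.
Qed.

(** A bracket of eigenvectors is an eigenvector for the product of the eigenvalues, and the four
    eigenvalues are distinct; so each mixed bracket is a multiple of a basis vector. The frame is
    [e0, e2, e1, e3], of weights 1, 2, 4, 3. *)
Lemma frame_of_eigen : exists Q, [/\ frame b Q, forall i, singular (row i Q)
  & forall i : 'I_4, row i Q *m g = a ^+ (2 ^ i) *: row i Q].
Proof.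
have [B b01 b23] := P; have PB := planes_br P.
have [Ug ag] := Ag; have a5 := prim_expr_order pa.
have nij i j : (i < 5)%N -> (j < 5)%N -> i != j -> a ^+ i != a ^+ j.
  move=> i5 j5; apply: contra; rewrite (eq_prim_root_expr pa).
  by rewrite !modn_small.
have red i : a ^+ (5 + i) = a ^+ i by rewrite exprD a5 mul1r.
have Br x y m n : x *m g = a ^+ m *: x -> y *m g = a ^+ n *: y ->
    b x y *m g = a ^+ (m + n) *: b x y.
  move=> Ex Ey; rewrite ag Ex Ey !(linearZl_LR, linearZr_LR) /= scalerA exprD.
  by [].
have E0' : e0 *m g = a ^+ 1 *: e0 by rewrite expr1.
have B0 := basis4_swap23 (basis4_swap12 (basis4_swap01 B)).
have B1 := basis4_swap23 (basis4_swap12 B).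
have B2 := basis4_swap23 B.
have nz : [/\ b e0 e2 != 0, b e0 e3 != 0, b e1 e2 != 0 & b e1 e3 != 0].
  have f s t u v := basis4_free (s := s) (t := t) (u := u) (v := v) PB.
  split; apply/eqP => E.
  - have := f 1 0 0 0; rewrite E !scale0r scaler0 !addr0 => -[] // /eqP.
    by rewrite oner_eq0.
  - have := f 0 1 0 0; rewrite E !scale0r scaler0 !addr0 => -[] // _ /eqP.
    by rewrite oner_eq0.
  - have := f 0 0 1 0; rewrite E !scale0r scaler0 !addr0 => -[] // _ _ /eqP.
    by rewrite oner_eq0.
  - have := f 0 0 0 1; rewrite E !scale0r scaler0 !addr0 => -[] // _ _ _ /eqP.
    by rewrite oner_eq0.
have [n02 n03 n12 n13] := nz.
have [A cA] : exists k, b e0 e2 = k *: e3.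
  apply: (eigen4_vec B E0' E1 E2 E3); rewrite ?nij //.
  exact: (Br _ _ 1%N 2%N).
have [B' cB] : exists k, b e2 e1 = k *: e0.
  apply: (eigen4_vec B0 E1 E2 E3 E0'); rewrite ?nij //.
  by rewrite -(red 1%N); apply: (Br _ _ 2%N 4%N).
have [C cC] : exists k, b e1 e3 = k *: e2.
  apply: (eigen4_vec B2 E0' E1 E3 E2); rewrite ?nij //.
  by rewrite -(red 2%N); apply: (Br _ _ 4%N 3%N).
have [D cD] : exists k, b e3 e0 = k *: e1.
  apply: (eigen4_vec B1 E0' E2 E3 E1); rewrite ?nij //.
  exact: (Br _ _ 3%N 1%N).
have A0 : A != 0 by apply: contra n02 => /eqP E; rewrite cA E scale0r.
have B'0 : B' != 0.
  by apply: contra n12 => /eqP E; rewrite (bC e2 e1) cB E scale0r oppr0.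
have C0 : C != 0 by apply: contra n13 => /eqP E; rewrite cC E scale0r.
have D0 : D != 0.
  by apply: contra n03 => /eqP E; rewrite (bC e3 e0) cD E scale0r oppr0.
(* Rescaling by [t0, T, t2, t3] should turn the constants [A, B', C, D] into 1. Three of the four
   equations express [t0, t2, t3] through [T]; the fourth becomes this equation for [T^5]. *)
have [T T5] := closed_root5 (C / (A * B' ^+ 3 * D ^+ 2)).
have T0 : T != 0.
  have : T ^+ 5 != 0 by rewrite T5 mulf_neq0 // invr_neq0 // !mulf_neq0 // expf_neq0.
  by rewrite expf_eq0.
have TC : T ^+ 5 * (A * B' ^+ 3 * D ^+ 2) = C.
  by rewrite T5 divfK // !mulf_neq0 // expf_neq0.
pose t0 := (A * B' * D * T ^+ 2)^-1.
pose t3 := A * t0 * T; pose t2 := D * t3 * t0.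
have t00 : t0 != 0 by rewrite invr_neq0 // !mulf_neq0 // expf_neq0.
have t30 : t3 != 0 by rewrite !mulf_neq0.
have t20 : t2 != 0 by rewrite !mulf_neq0.
exists (rows4 (t0 *: e0) (T *: e2) (t2 *: e1) (t3 *: e3)); split.
- have BB : basis4 (t0 *: e0) (T *: e2) (t2 *: e1) (t3 *: e3).
    by apply: basis4_scale => //; apply: basis4_swap12.
  apply: frame_intro => //; rewrite !(linearZl_LR, linearZr_LR) /=.
  + by rewrite cA !scalerA; congr (_ *: _); rewrite /t3; ring.
  + rewrite cB !scalerA; congr (_ *: _); rewrite /t2 /t3 /t0; field.
    by rewrite A0 B'0 D0 T0.
  + rewrite cC !scalerA; congr (_ *: _); rewrite -TC /t2 /t3 /t0; field.
    by rewrite A0 B'0 D0 T0.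
  + by rewrite cD !scalerA; congr (_ *: _); rewrite /t2; ring.
  + by rewrite b01 !scaler0.
  + by rewrite b23 !scaler0.
- move=> i; rewrite rowK; case: i => [[|[|[|[|i]]]] Hi] //=; exact: singularZ.
- move=> i; rewrite rowK; case: i => [[|[|[|[|i]]]] Hi] //=; rewrite -scalemxAl.
  + by rewrite E0' !scalerA mulrC.
  + by rewrite E2 !scalerA mulrC.
  + by rewrite E1 !scalerA mulrC.
  + by rewrite E3 !scalerA mulrC -(red 3%N).
Qed.
End Fixing.

(** Expanding [e0] and [e2] in the eigenbasis of brackets, and two brackets in the eigenbasis [e_i],
    yields the hypotheses of [eigenvalues5]. *)
Theorem frame_of_fix e0 e1 e2 e3 g l0 : planes e0 e1 e2 e3 ->
  singular e0 -> singular e1 -> singular e2 -> singular e3 ->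
  isaut b g -> g != 1%:M -> e0 *m g = l0 *: e0 ->
  exists Q a, [/\ frame b Q, 5.-primitive_root a, forall i, singular (row i Q)
  & forall i : 'I_4, row i Q *m g = a ^+ (2 ^ i) *: row i Q].
Proof.
move=> P S0 S1 S2 S3 Ag g1 E0; have [B b01 b23] := P.
have PB := planes_br P.
have [Ug ag] := Ag.
have [l1 [l2 [l3 [E1 E2 E3 l01 l23]]]] :=
  aut_fix_line P S0 S1 S2 S3 Ag E0.
have [n0 n1 n2 n3] := basis4_neq0 S0 S1 S2 S3.
have unitV (x y : K) : x * y = 1 -> x != 0 /\ y = x^-1.
  move=> xy; have x0 : x != 0.
    by apply/eqP => x0; move/eqP: xy; rewrite x0 mul0r eq_sym oner_eq0.
  by split=> //; apply: (mulfI x0); rewrite mulfV.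
have [l00 l1E] := unitV _ _ l01; have [l20 l3E] := unitV _ _ l23.
have Br x y k l : x *m g = k *: x -> y *m g = l *: y ->
    b x y *m g = (k * l) *: b x y.
  by move=> Ex Ey; rewrite ag Ex Ey !(linearZl_LR, linearZr_LR) /= scalerA.
have b02 := Br _ _ _ _ E0 E2; have b03 := Br _ _ _ _ E0 E3.
have b12 := Br _ _ _ _ E1 E2; have b13 := Br _ _ _ _ E1 E3.
have V0 := eigen4_val PB b02 b03 b12 b13 n0 E0.
have V2 := eigen4_val PB b02 b03 b12 b13 n2 E2.
have [m02 m03 _ _] : [/\ b e0 e2 != 0, b e0 e3 != 0, True & True].
  have f s t u v := basis4_free (s := s) (t := t) (u := u) (v := v) PB.
  split=> //; apply/eqP => E.
  - have := f 1 0 0 0; rewrite E !scale0r scaler0 !addr0 => -[] // /eqP.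
    by rewrite oner_eq0.
  - have := f 0 1 0 0; rewrite E !scale0r scaler0 !addr0 => -[] // _ /eqP.
    by rewrite oner_eq0.
have W2 := eigen4_val B E0 E1 E2 E3 m02 b02.
have W3 := eigen4_val B E0 E1 E2 E3 m03 b03.
rewrite l1E l3E in V0 V2 W2 W3 *.
have [] := @eigenvalues5 K l0 l2 l00 l20.
- case: V0 => E; [constructor 1|constructor 2|constructor 3|constructor 4] => //.
    by rewrite {1}E mulrC.
  by rewrite {1}E invfM.
- case: V2 => E; [constructor 1|constructor 2|constructor 3|constructor 4] => //.
    by rewrite {1}E mulrC.
  by rewrite {1}E invfM.
- exact: W2.
- exact: W3.
- case=> a1 c1; case/eqP: g1; apply: (can_inj (mulKmx B)).
  rewrite mulmx1; apply/row_matrixP => i; rewrite row_mul rowK.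
  case: i => [[|[|[|[|i]]]] Hi] //=; rewrite ?E0 ?E1 ?E2 ?E3 ?l1E ?l3E ?a1 ?c1;
    by rewrite ?invr1 scale1r.
case=> a5 [a1 cE]; have pa := prim5 a5 a1.
have l1E4 : l1 = l0 ^+ 4.
  by rewrite l1E; apply: (mulfI l00); rewrite mulfV // -exprS a5.
have inv2 : l0 ^- 2 = l0 ^+ 3.
  apply: (mulfI (expf_neq0 2 l00)); rewrite mulfV ?expf_neq0 //.
  by rewrite -exprD a5.
have inv3 : l0 ^- 3 = l0 ^+ 2.
  apply: (mulfI (expf_neq0 3 l00)); rewrite mulfV ?expf_neq0 //.
  by rewrite -exprD a5.
case: cE => cE.
- have [Q QP] := frame_of_eigen P S0 S1 S2 S3 Ag pa E0
    (etrans E1 (congr1 (fun x => x *: e1) l1E4)) (etrans E2 (congr1 (fun x => x *: e2) cE))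
    (etrans E3 (congr1 (fun x => x *: e3) (etrans l3E (etrans (congr1 GRing.inv cE) inv2)))).
  by exists Q, l0; case: QP => Q1 Q2 Q3; split.
(* Here [e2] has eigenvalue [l0^3], so [e2] and [e3] exchange roles. *)
- have P' : planes e0 e1 e3 e2.
    by split=> //; [exact: basis4_swap23|rewrite (bC e2 e3) b23 oppr0].
  have l2E : l2 = l0 ^+ 3 by rewrite cE inv2.
  have l3E' : l3 = l0 ^+ 2 by rewrite l3E l2E inv3.
  have [Q QP] := frame_of_eigen P' S0 S1 S3 S2 Ag pa E0
    (etrans E1 (congr1 (fun x => x *: e1) l1E4)) (etrans E3 (congr1 (fun x => x *: e3) l3E'))
    (etrans E2 (congr1 (fun x => x *: e2) l2E)).
  by exists Q, l0; case: QP => Q1 Q2 Q3; split.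
Qed.

End Classify.

(** * Descent to a finite field *)

Lemma frob_exists (K : closedFieldType) p f : p \in [pchar K] ->
  exists phi : {rmorphism K -> K}, bijective phi /\ forall x, phi x = x ^+ (p ^ f).
Proof.
move=> chK; have [phi E] : exists phi : {rmorphism K -> K}, forall x, phi x = x ^+ (p ^ f).
  elim: f => [|f [phi IH]]; first by exists idfun => x; rewrite expn0 expr1.
  exists (pFrobenius_aut chK \o phi)%FUN => x.
  by rewrite /= pFrobenius_autE IH -exprM expnSr.
exists phi; split=> //.
have sur y : exists x, phi x == y.
  have q0 : (0 < p ^ f)%N by rewrite expn_gt0 prime_gt0 // (pcharf_prime chK).
  have [x Ex] := @solve_monicpoly K _ (fun i => if i == 0%N then y else 0) q0.
  exists x; apply/eqP; rewrite E Ex -(prednK q0) big_ord_recl big1 ?addr0 /=.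
    by rewrite expr0 mulr1.
  by move=> i _; rewrite mul0r.
exists (fun y => xchoose (sur y)) => x; last exact/eqP/(xchooseP (sur x)).
by apply: (fmorph_inj phi); apply/eqP/(xchooseP (sur _)).
Qed.

(** A vector over [S] need not come from [R], but both sides are bilinear and the standard basis
    does come from [R]. *)
Lemma map_tbr_hom (R : fieldType) (S : fieldType) (iota : {rmorphism R -> S}) n
    (C C' : 'I_n -> 'I_n -> 'rV[R]_n) (T : 'M[R]_n) :
  (forall x y, tbr C x y *m T = tbr C' (x *m T) (y *m T)) ->
  forall x y, tbr (fun i j => map_mx iota (C i j)) x y *m map_mx iota T =
    tbr (fun i j => map_mx iota (C' i j)) (x *m map_mx iota T) (y *m map_mx iota T).
Proof.
move=> mT x y; rewrite {1}/tbr mulmx_suml.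
rewrite {2}(row_sum_delta x) {2}(row_sum_delta y) !mulmx_suml linear_sumlz.
apply: eq_bigr => i _; rewrite mulmx_suml linear_sumr; apply: eq_bigr => j _.
rewrite -!scalemxAl linearZl_LR linearZr_LR /= scalerA; congr (_ *: _).
rewrite -!(map_delta_mx iota) -!map_mxM -map_tbr -mT tbr_delta.
by rewrite map_mxM.
Qed.

Section FiniteBase.
Variables (F : finFieldType) (K : closedFieldType) (iota : {rmorphism F -> K}).
Variable phi : {rmorphism K -> K}.
Hypothesis phi_bij : bijective phi.
Hypothesis phiE : forall x, phi x = x ^+ #|F|.

Lemma phi_iota a : phi (iota a) = iota a.
Proof. by rewrite phiE -rmorphXn /= expf_card. Qed.

Lemma phi_fixed x : phi x = x -> exists a, x = iota a.
Proof.
rewrite phiE => E; have : root (map_poly iota ('X^#|F| - 'X)) x.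
  by rewrite rmorphB /= map_polyXn map_polyX rootE !hornerE E subrr.
rewrite finField_genPoly rmorph_prod rootE horner_prod => /prodf_eq0[a _].
rewrite rmorphB /= map_polyX map_polyC !hornerE subr_eq0 => /eqP ->.
by exists a.
Qed.

Lemma phi_fixed_mx m n (M : 'M[K]_(m, n)) : map_mx phi M = M ->
  exists M0, M = map_mx iota M0.
Proof.
move=> E; have H i j : exists a, M i j == iota a.
  have [|a ->] := @phi_fixed (M i j); last by exists a.
  by rewrite -[RHS](congr1 (fun N : 'M_(m, n) => N i j) E) mxE.
exists (\matrix_(i, j) xchoose (H i j)); apply/matrixP => i j; rewrite !mxE.
exact/eqP/(xchooseP (H i j)).
Qed.

Lemma map_phi_iota m n (M : 'M[F]_(m, n)) : map_mx phi (map_mx iota M) = map_mx iota M.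
Proof. by apply/matrixP => i j; rewrite !mxE phi_iota. Qed.

(* The reduced echelon basis of a stable subspace is fixed by [phi]. *)
Lemma descent n (U : 'M[K]_n) : (map_mx phi U <= U)%MS ->
  exists U0 : 'M[F]_n, (map_mx iota U0 :=: U)%MS.
Proof.
move=> sU; pose R := row_base U.
have fR : row_full R^T by rewrite /row_full mxrank_tr; apply: row_base_free.
pose f := fullrankfun fR; have Uf := fullrowsub_unit fR.
have UD : colsub f R \in unitmx 
  by rewrite -unitmx_tr (_ : _^T = rowsub f R^T) //; apply/matrixP => i j; rewrite !mxE.
pose R1 := invmx (colsub f R) *m R.
have colM k l (A : 'M[K]_(k, \rank U)) (B : 'M[K]_(\rank U, n)) (h : 'I_l -> 'I_n) :
    colsub h (A *m B) = A *m colsub h B.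
  by apply/matrixP => i j; rewrite !mxE; apply: eq_bigr => r _; rewrite !mxE.
have R1f : colsub f R1 = 1%:M by rewrite colM mulVmx.
have eqR : (R1 :=: U)%MS.
  apply: eqmx_trans (eq_row_base U); apply: eqmxMfull.
  by rewrite row_full_unit unitmx_inv.
have : (map_mx phi R1 <= R1)%MS.
  by rewrite eqR; apply: submx_trans sU; rewrite map_submx eqR.
case/submxP => D ED.
have D1 : D = 1%:M.
  rewrite -[D]mulmx1 -R1f -colM -ED.
  have -> : colsub f (map_mx phi R1) = map_mx phi (colsub f R1).
    by apply/matrixP => i j; rewrite !mxE.
  by rewrite R1f map_mx1.
rewrite D1 mul1mx in ED; have [R0 ER0] := phi_fixed_mx ED.
exists <<R0>>%MS; apply: eqmx_trans (map_genmx _ _) _.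
by apply: eqmx_trans (genmxE _) _; rewrite -ER0.
Qed.

Section Algebra.
Variable C : 'I_4 -> 'I_4 -> 'rV[F]_4.
Hypothesis Cxx : forall x, tbr C x x = 0.
Hypothesis Cirr : irrmx (isaut (tbr C)).
Hypothesis Cn0 : exists x y, tbr C x y != 0.
Hypothesis char2 : (2%:R : K) != 0.

Let CK i j := map_mx iota (C i j).

Lemma CK_anti x y : tbr CK x y = - tbr CK y x.
Proof.
have anti i j : C i j = - C j i.
  have := Cxx (delta_mx 0 i + delta_mx 0 j).
  rewrite linearDl !linearDr /= !Cxx add0r addr0 !tbr_delta => /eqP.
  by rewrite addr_eq0 => /eqP.
rewrite /tbr exchange_big -sumrN; apply: eq_bigr => i _; rewrite -sumrN; apply: eq_bigr => j _ /=.
by rewrite /CK anti map_mxN scalerN mulrC.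
Qed.

Lemma CKxx x : tbr CK x x = 0.
Proof.
apply/eqP; have /eqP := CK_anti x x; rewrite -addr_eq0 -mulr2n -scaler_nat.
by rewrite scaler_eq0 (negPf char2).
Qed.

Lemma isaut_iota g : isaut (tbr C) g -> isaut (tbr CK) (map_mx iota g).
Proof.
by move=> [Ug ag]; split; [rewrite map_unitmx | apply: map_tbr_hom].
Qed.

Lemma phi_tbr x y : map_mx phi (tbr CK x y) = tbr CK (map_mx phi x) (map_mx phi y).
Proof.
rewrite map_tbr /tbr; apply: eq_bigr => i _; apply: eq_bigr => j _.
by rewrite /CK map_phi_iota.
Qed.

(** Frobenius on coordinates and the rational automorphisms. A subspace stable under the former
    descends to [F], where irreducibility applies. *)
Definition Gam (t : {rmorphism K -> K}) (S : 'M[K]_4) :=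
  (t = phi /\ S = 1%:M) \/
  (t = idfun :> {rmorphism K -> K} /\ exists2 g, isaut (tbr C) g & S = map_mx iota g).

Lemma Gam_semiaut t S : Gam t S -> semiaut (tbr CK) t S.
Proof.
case=> -[-> ]; last by case=> g /isaut_iota/isaut_semi Ag ->.
move->; split=> //; first exact: unitmx1.
by move=> x y; rewrite /act !mulmx1; apply: phi_tbr.
Qed.

Lemma irrK (U : 'M[K]_4) : (map_mx phi U <= U)%MS ->
  (forall g, isaut (tbr C) g -> (U *m map_mx iota g <= U)%MS) -> U = 0 \/ row_full U.
Proof.
move=> sU aU; have [U0 EU] := descent sU.
case: (Cirr (U := U0)).
- move=> g Ag; rewrite -(map_submx iota) EU map_mxM.
  by apply: submx_trans (aU _ Ag); rewrite submxMr // EU.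
- move=> U00; left; apply/eqP; rewrite -mxrank_eq0 -EU U00 map_mx0 mxrank0.
  by [].
- by rewrite /row_full -EU mxrank_map => ->; right.
Qed.

Lemma Gam_irr (U : 'M[K]_4) :
  (forall t S, Gam t S -> (map_mx t U *m S <= U)%MS) -> U = 0 \/ row_full U.
Proof.
move=> sU; apply: irrK.
  by have := sU phi 1%:M (or_introl (conj erefl erefl)); rewrite mulmx1.
move=> g Ag; have H : Gam idfun (map_mx iota g) by right; split=> //; exists g.
by have := sU _ _ H; rewrite map_mx_id.
Qed.

Lemma CKn0 : exists x y, tbr CK x y != 0.
Proof.
have [x [y n0]] := Cn0; exists (map_mx iota x), (map_mx iota y).
by rewrite -map_tbr map_mx_eq0.
Qed.

End Algebra.
End FiniteBase.

(** * Size of an irreducible automorphism group *)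

Section Isaut.
Variables (F : fieldType) (n : nat) (b : 'rV[F]_n -> 'rV[F]_n -> 'rV[F]_n).

Lemma isaut1 : isaut b 1%:M.
Proof. by split=> [|x y]; rewrite ?unitmx1 ?mulmx1. Qed.

Lemma isautM g h : isaut b g -> isaut b h -> isaut b (g *m h).
Proof.
move=> [Ug ag] [Uh ah]; split; first by rewrite unitmx_mul Ug.
by move=> x y; rewrite !mulmxA ag ah.
Qed.

Lemma isautV g : isaut b g -> isaut b (invmx g).
Proof.
move=> [Ug ag]; split; first by rewrite unitmx_inv.
move=> x y; apply: (can_inj (mulmxK Ug)); rewrite mulmxKV // ag.
by rewrite !mulmxKV.
Qed.

End Isaut.

(* The sum over the group annihilates every vector (its image consists of fixed
   vectors), so that an orbit of k vectors spans a space of dimension < k. *)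
Lemma irr_card (F : finFieldType) n (b : 'rV[F]_n -> 'rV[F]_n -> 'rV[F]_n) :
  (1 < n)%N -> irrmx (isaut b) -> (n < #|[set g | `[< isaut b g >]]|)%N.
Proof.
move=> n1 irr; set G := [set g | _].
have GP g : reflect (isaut b g) (g \in G) by rewrite inE; apply: asboolP.
have G1 : 1%:M \in G by apply/GP/isaut1.
pose N := \sum_(g in G) g.
have NE h : h \in G -> N *m h = N.
  move=> /GP Ah; have [Uh _] := Ah; rewrite /N mulmx_suml.
  rewrite [RHS](reindex (fun g => g *m h)) /=; last first.
    exists (fun g => g *m invmx h) => g _; [exact: mulmxK|exact: mulmxKV].
  apply: eq_bigl => g; apply/GP/GP => Ag; first exact: isautM.
  by rewrite -(mulmxK Uh g); apply: isautM => //; apply: isautV.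
have N0 (v : 'rV_n) : v *m N = 0.
  apply/eqP/negPn/negP => vN.
  have [|E|] := irr <<v *m N>>%MS.
  - move=> g /GP Gg; have E : (<<v *m N>> *m g <= v *m N *m g)%MS.
      by rewrite submxMr // genmxE.
    by apply: submx_trans E _; rewrite -mulmxA NE // genmxE.
  - by move: vN; rewrite -mxrank_eq0 -(genmxE (v *m N)) E mxrank0 eqxx.
  - rewrite /row_full genmxE rank_rV vN => /eqP nE.
    by move: n1; rewrite -nE.
pose v : 'rV[F]_n := delta_mx 0 (Ordinal (ltnW n1)).
have v0 : v != 0.
  by apply/eqP => /matrixP/(_ 0 (Ordinal (ltnW n1))); rewrite !mxE !eqxx => /eqP; rewrite oner_eq0.
pose U := (\sum_(g in G) <<v *m g>>)%MS.
have [|U0|fU] := irr U.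
- move=> h /GP Gh; rewrite sumsmxMr; apply/sumsmx_subP => g Gg.
  rewrite (sumsmx_sup (g *m h)) //; first by apply/GP/isautM; apply/GP.
  have E : (<<v *m g>> *m h <= v *m g *m h)%MS by rewrite submxMr // genmxE.
  by apply: submx_trans E _; rewrite genmxE mulmxA.
- have : (v <= U)%MS by rewrite (sumsmx_sup 1%:M) // mulmx1 genmxE.
  by rewrite U0 submx0 (negPf v0).
rewrite (cardsD1 1%:M) G1 add1n ltnS -{1}(eqP fU).
have sU : (U <= \sum_(g in G :\ 1%:M) <<v *m g>>)%MS.
  apply/sumsmx_subP => g Gg; have [->|g1] := eqVneq g 1%:M; last first.
    by rewrite (sumsmx_sup g) // in_setD1 g1.
  have : v = - \sum_(h in G :\ 1%:M) v *m h.
    have := N0 v; rewrite /N mulmx_sumr (bigD1 1%:M) //= mulmx1 => /eqP.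
    rewrite addr_eq0 => /eqP {1}->; congr (- _).
    by apply: eq_bigl => h; rewrite in_setD1 andbC.
  rewrite mulmx1 genmxE => {1}->; rewrite -scaleN1r; apply: scalemx_sub.
  by apply: summx_sub => h Gh; rewrite (sumsmx_sup h) // genmxE.
apply: leq_trans (mxrankS sU) _; apply: leq_trans (mxrank_sum_leqif _) _ => /=.
rewrite -sum1_card; apply: leq_sum => g _; rewrite genmxE rank_rV.
by case: (_ != 0).
Qed.

(** * Monomial automorphisms of the standard product *)

Definition mono (R : comNzRingType) (s : 'I_4) (w : R) : 'M[R]_4 :=
  \matrix_(i, j) (w ^+ (2 ^ i) *+ (j == i + s)).

Section Mono.
Variable R : comNzRingType.
Implicit Types (s r : 'I_4) (w e : R).

Lemma row_mono s w i : row i (mono s w) = w ^+ (2 ^ i) *: delta_mx 0 (i + s).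
Proof.
apply/rowP => j; rewrite !mxE eqxx /=.
by case: eqP => _; rewrite ?mulr1 ?mulr0.
Qed.

(** 2 has order 4 modulo 5; this is what allows the indices to live in ['I_4]. *)
Lemma expr_pow2 w (m n : nat) : w ^+ 5 = 1 -> m = n %[mod 4] ->
  w ^+ (2 ^ m) = w ^+ (2 ^ n).
Proof.
move=> w5 mn; rewrite -(expr_mod (2 ^ m) w5) -(expr_mod (2 ^ n) w5); congr (_ ^+ _).
have aux k : (2 ^ k = 2 ^ (k %% 4) %[mod 5])%N.
  have e1 : ((2 ^ 4) ^ (k %/ 4) = 1 %[mod 5])%N.
    by rewrite -modnXm (_ : 2 ^ 4 %% 5 = 1)%N // exp1n.
  by rewrite {1}(divn_eq k 4) expnD (mulnC _ 4%N) expnM -modnMml e1 modnMml mul1n.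
by rewrite aux mn -aux.
Qed.

Lemma expr_pow2D w (i s : 'I_4) : w ^+ 5 = 1 ->
  w ^+ (2 ^ (i + s)%R) = (w ^+ (2 ^ i)) ^+ (2 ^ s).
Proof.
move=> w5; rewrite -exprM -expnD; apply: expr_pow2 => //.
by rewrite /= modn_mod.
Qed.

(** The composition law of affine maps modulo 5: for [e = z^k] with [z^5 = 1], [mono r e] behaves as
    [x |-> 2^r x + k]. *)
Lemma monoM r e s w : w ^+ 5 = 1 ->
  mono r e *m mono s w = mono (r + s) (e * w ^+ (2 ^ r)).
Proof.
move=> w5; apply/row_matrixP => i; rewrite row_mul !row_mono -scalemxAl -rowE row_mono.
by rewrite scalerA addrA exprMn addrC (addrC i) expr_pow2D // addrC (addrC i).
Qed.

(** The factor 4 stands for -1 modulo 5. *)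
Lemma mono_unit r e : e ^+ 5 = 1 -> mono r e *m mono (- r) (e ^+ (4 * 2 ^ (- r)%R)) = 1%:M.
Proof.
move=> e5; rewrite monoM; last by rewrite -exprM mulnC exprM e5 expr1n.
rewrite subrr; have -> : e * (e ^+ (4 * 2 ^ (- r)%R)) ^+ (2 ^ r) = 1.
  rewrite exprAC (mulnC 4%N) exprM -expr_pow2D // subrr /= expn0 expr1.
  by rewrite -exprS.
by apply/matrixP => i j; rewrite !mxE expr1n addr0 eq_sym.
Qed.

Lemma stp_bilinear : bilinear_for *:%R *:%R (@stp R).
Proof. by split=> z a x y; apply/rowP => k; rewrite /applyr !mxE; ring. Qed.

HB.instance Definition _ := bilinear_isBilinear.Build R
  'rV[R]_4 'rV[R]_4 'rV[R]_4 *:%R *:%R (@stp R) stp_bilinear.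

Lemma stp_delta (i j : 'I_4) : stp (delta_mx 0 i : 'rV[R]_4) (delta_mx 0 j) =
  (j == i + 1)%:R *: delta_mx 0 (i + 3%:R) - (i == j + 1)%:R *: delta_mx 0 (j + 3%:R).
Proof.
apply/rowP => k; rewrite !mxE !eqxx /=.
have aux (a c : 'I_4) : (k + 1 == a)%:R * (k + 2%:R == c)%:R =
    (c == a + 1)%:R * (k == a + 3%:R)%:R :> R.
  have i3 : 3%:R = - 1 :> 'I_4 by apply: val_inj.
  rewrite [k + 1 == a]eq_sym -subr_eq -i3 (eq_sym _ k).
  case: (eqVneq k (a + 3%:R)) => [->|_]; rewrite ?mulr0 ?mul0r //.
  have i32 : 3%:R + 2%:R = 1 :> 'I_4 by apply: val_inj.
  by rewrite mul1r mulr1 -addrA i32 eq_sym.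
by rewrite aux [X in _ - X]mulrC aux.
Qed.

(** The weights are compatible because [1 + 2 = 2^3] modulo 5: [h_i] and [h_(i+1)] have weights
    [2^i] and [2^(i+1)], their product [h_(i+3)] has weight [2^(i+3)]. *)
Lemma mono_stp r e : e ^+ 5 = 1 -> forall u v,
  stp u v *m mono r e = stp (u *m mono r e) (v *m mono r e).
Proof.
move=> e5 u v; rewrite (row_sum_delta u) (row_sum_delta v).
rewrite linear_sumlz !mulmx_suml linear_sumlz; apply: eq_bigr => i _.
rewrite linear_sumr mulmx_suml linear_sumr; apply: eq_bigr => j _.
rewrite -!scalemxAl !linearZl_LR !linearZr_LR /= -!scalemxAl; congr (_ *: (_ *: _)).
rewrite -!rowE !row_mono linearZl_LR linearZr_LR /= !stp_delta mulmxBl -!scalemxAl -!rowE.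
rewrite !row_mono.
have ee (a c : 'I_4) : (c + r == a + r + 1) = (c == a + 1).
  by rewrite addrAC (inj_eq (addIr r)).
rewrite !ee (addrAC i) (addrAC j) scalerBr !scalerA scalerBr !scalerA.
have key (a c : 'I_4) : (c == a + 1)%:R * e ^+ (2 ^ (a + 3%:R)%R) =
    e ^+ (2 ^ a) * e ^+ (2 ^ c) * (c == a + 1)%:R.
  case: eqP => [->|_]; rewrite ?mul0r ?mulr0 // mul1r mulr1.
  rewrite (expr_pow2D a 3%:R e5) (expr_pow2D a 1 e5).
  rewrite /= -!exprM -exprD -[LHS](expr_mod _ e5) -[RHS](expr_mod _ e5); congr (_ ^+ _).
  set t := (2 ^ a)%N; rewrite -modnMmr (_ : t + t * 2 ^ _ = t * 3)%N //.
  by rewrite -{1}(muln1 t) -mulnDr.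
by rewrite !key; congr (_ *: _ - _ *: _); ring.
Qed.

End Mono.

Lemma map_mono (R S : comNzRingType) (f : {rmorphism R -> S}) r e :
  map_mx f (mono r e) = mono r (f e).
Proof. by apply/matrixP => i j; rewrite !mxE rmorphMn rmorphXn. Qed.

Section MonoStp.
Variable K : fieldType.

Lemma stp_delta2 i : stp (delta_mx 0 i : 'rV[K]_4) (delta_mx 0 (i + 2%:R)) = 0.
Proof.
rewrite stp_delta; have -> : (i + 2%:R == i + 1) = false by rewrite (inj_eq (addrI i)).
by rewrite -addrA -subr_eq0 opprD addNKr oppr_eq0 /= !scale0r subrr.
Qed.

Lemma stp_delta1 i : stp (delta_mx 0 i : 'rV[K]_4) (delta_mx 0 (i + 1)) = delta_mx 0 (i + 3%:R).
Proof.
rewrite stp_delta eqxx -addrA -subr_eq0 opprD addNKr oppr_eq0 /= scale0r subr0.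
exact: scale1r.
Qed.

Lemma stp_delta_cube i (v : 'rV[K]_4) :
  stp (delta_mx 0 i) (stp (delta_mx 0 i) (stp (delta_mx 0 i) v)) = 0.
Proof.
apply/rowP => k; rewrite !mxE /=.
by case: i => [[|[|[|[|i]]]] Hi] //; case: k => [[|[|[|[|k]]]] Hk] //=; ring.
Qed.

(* If the image of two consecutive lines were traversed backwards, two further
   lines would coincide. *)
Lemma mono_of_stp (M : 'M[K]_4) : M \in unitmx ->
  (forall u v, stp u v *m M = stp (u *m M) (v *m M)) ->
  (forall i, exists k j, row i M = k *: delta_mx 0 j) ->
  exists r e, e ^+ 5 = 1 /\ M = mono r e.
Proof.
move=> UM aM /choice[k /choice[p rowM]].
have k0 i : k i != 0.
  apply/eqP => ki; have : row i M = 0 by rewrite rowM ki scale0r.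
  rewrite rowE => E; have : delta_mx 0 i = 0 :> 'rV[K]_4.
    by rewrite -(mulmxK UM (delta_mx 0 i)) E mul0mx.
  by move/rowP/(_ i); rewrite !mxE !eqxx => /eqP; rewrite oner_eq0.
have p_inj i j : p i = p j -> i = j.
  move=> pij; have : row i M = (k i / k j) *: row j M.
    by rewrite !rowM pij scalerA divfK.
  rewrite !rowE scalemxAl => /(can_inj (mulmxK UM))/rowP/(_ i).
  rewrite !mxE !eqxx /=; case: eqP => // _; rewrite mulr0 => /eqP.
  by rewrite oner_eq0.
have E1 i : (k i * k (i + 1)) *: stp (delta_mx 0 (p i)) (delta_mx 0 (p (i + 1))) =
    k (i + 3%:R) *: delta_mx 0 (p (i + 3%:R)).
  rewrite -rowM rowE -stp_delta1 aM -!rowE !rowM.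
  by rewrite linearZl_LR linearZr_LR /= scalerA.
have E2 i : stp (delta_mx 0 (p i) : 'rV[K]_4) (delta_mx 0 (p (i + 2%:R))) = 0.
  have := aM (delta_mx 0 i) (delta_mx 0 (i + 2%:R)).
  rewrite stp_delta2 mul0mx -!rowE !rowM linearZl_LR linearZr_LR /= scalerA => /esym/eqP.
  by rewrite scaler_eq0 mulf_eq0 (negPf (k0 _)) (negPf (k0 _)) => /eqP.
have deltaI (i j : 'I_4) c d : c != 0 ->
    c *: (delta_mx 0 i : 'rV[K]_4) = d *: delta_mx 0 j -> i = j.
  move=> c0 /rowP/(_ i); rewrite !mxE !eqxx mulr1 /=; case: eqP => // _.
  by rewrite mulr0 => c00; rewrite c00 eqxx in c0.
have delta0 (i : 'I_4) : delta_mx 0 i != 0 :> 'rV[K]_4.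
  apply/eqP => /rowP/(_ i); rewrite !mxE !eqxx => /eqP; by rewrite oner_eq0.
have i2P (i j : 'I_4) : stp (delta_mx 0 i : 'rV[K]_4) (delta_mx 0 j) = 0 -> j != i -> j = i + 2%:R.
  move=> E ji; have [E1'|n1] := eqVneq j (i + 1).
    by have := delta0 (i + 3%:R); rewrite -stp_delta1 -E1' E eqxx.
  have [E3|n3] := eqVneq i (j + 1).
    have := delta0 (j + 3%:R); rewrite -stp_delta1 -E3.
    have -> : stp (delta_mx 0 j : 'rV[K]_4) (delta_mx 0 i) = - stp (delta_mx 0 i) (delta_mx 0 j).
      by apply/rowP => l; rewrite !mxE; ring.
    by rewrite E oppr0 eqxx.
  have N : (j - i) \notin [:: 0; 1; 3%:R].
    rewrite !inE subr_eq0 (negPf ji) subr_eq addrC (negPf n1) /=.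
    apply: contra n3 => /eqP E3.
    by rewrite -[i](subrK j) -opprB E3 addrC; apply/eqP; congr (_ + _); apply: val_inj.
  suff E3 : j - i = 2%:R by rewrite -(subrK i j) E3 addrC.
  by apply: val_inj; move: (j - i) N => [[|[|[|[|l]]]] Hl].
have pS i : p (i + 1) = p i + 1.
  apply/eqP/negPn/negP => n1.
  have := E1 i; rewrite stp_delta (negPf n1) scale0r sub0r.
  case: eqP => [E3|_]; last first.
    rewrite scale0r oppr0 scaler0 => /esym/eqP; rewrite scaler_eq0 (negPf (k0 _)).
    by rewrite (negPf (delta0 _)).
  rewrite scale1r scalerN -scaleNr => /deltaI E4.
  have {}E4 : p (i + 3%:R) = p i + 2%:R.
    rewrite -E4 ?oppr_eq0 ?mulf_neq0 // E3 -addrA; congr (_ + _); exact: val_inj.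
  have E5 : p (i + 2%:R) = p i + 2%:R.
    apply: i2P (E2 i) _; apply/eqP => /p_inj/eqP.
    by rewrite -{2}(addr0 i) (inj_eq (addrI i)).
  have := p_inj (i + 2%:R) (i + 3%:R); rewrite E4 E5 => /(_ erefl)/addrI.
  by move/(congr1 val).
have [i01 i03 i11 i13] : [/\ 0 + 1 = 1 :> 'I_4, 0 + 3%:R = 3%:R :> 'I_4,
  1 + 1 = 2%:R :> 'I_4 & 1 + 3%:R = 0 :> 'I_4] by split; apply: val_inj.
have [i21 i23 i31 i33] : [/\ 2%:R + 1 = 3%:R :> 'I_4, 2%:R + 3%:R = 1 :> 'I_4,
  3%:R + 1 = 0 :> 'I_4 & 3%:R + 3%:R = 2%:R :> 'I_4] by split; apply: val_inj.
have pE i : p i = i + p 0.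
  have p1 : p 1 = 1 + p 0 by have := pS 0; rewrite i01 addrC.
  have p2 : p 2%:R = 2%:R + p 0 by have := pS 1; rewrite p1 i11 addrAC i11.
  have p3 : p 3%:R = 3%:R + p 0 by have := pS 2%:R; rewrite p2 i21 addrAC i21.
  case: i => [[|[|[|[|i]]]] Hi] //.
  - by rewrite (_ : Ordinal Hi = 0) ?add0r //; apply: val_inj.
  - by rewrite (_ : Ordinal Hi = 1) //; apply: val_inj.
  - by rewrite (_ : Ordinal Hi = 2%:R) //; apply: val_inj.
  - by rewrite (_ : Ordinal Hi = 3%:R) //; apply: val_inj.
have kE i : k i * k (i + 1) = k (i + 3%:R).
  have := E1 i; rewrite pS stp_delta1 => E.
  have := deltaI _ _ _ _ _ E; rewrite mulf_neq0 // => /(_ isT) p3.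
  move/rowP/(_ (p i + 3%:R)): E; rewrite -p3 !mxE !eqxx !mulr1.
  by [].
(* In terms of [a = k 0] and [c = k 1] the four relations reduce to [a c^2 = 1] and [a^3 c = 1],
   hence [a^5 = 1] and [c = a^2]. *)
have K0 := kE 0; have K1 := kE 1; have K2 := kE 2%:R; have K3 := kE 3%:R.
rewrite i01 i03 in K0; rewrite i11 i13 in K1; rewrite i21 i23 in K2; rewrite i31 i33 in K3.
set a := k 0 in K0 K1 K3; set c := k 1 in K0 K1 K2.
have a0 : a != 0 by apply: k0.
have c0 : c != 0 by apply: k0.
have K3' : k 2%:R = a ^+ 2 * c by rewrite -K3 -K0; ring.
have ac2 : a * c ^+ 2 = 1.
  by apply: (mulfI a0); rewrite mulr1 -[RHS]K1 K3'; ring.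
have a3c : a ^+ 3 * c = 1.
  by apply: (mulfI c0); rewrite mulr1 -[RHS]K2 K3' -K0; ring.
have a5 : a ^+ 5 = 1.
  have e : a ^+ 6 * c ^+ 2 = 1 by rewrite -[RHS](expr1n _ 2) -a3c; ring.
  have e' : a ^+ 6 * c ^+ 2 = a ^+ 5 by rewrite -[RHS]mulr1 -ac2; ring.
  by rewrite -e' e.
have cE : c = a ^+ 2.
  by apply: (mulfI (expf_neq0 3 a0)); rewrite a3c -exprD a5.
exists (p 0), a; split=> //; apply/row_matrixP => i.
rewrite rowM row_mono pE; congr (_ *: _).
case: i => [[|[|[|[|i]]]] Hi] //=.
- by rewrite expr1 /a; congr k; apply: val_inj.
- by rewrite -cE /c; congr k; apply: val_inj.
- rewrite (_ : Ordinal Hi = 2%:R) ?K3' ?cE; last exact: val_inj.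
  by rewrite -exprD.
- rewrite (_ : Ordinal Hi = 3%:R) -?K0 ?cE; last exact: val_inj.
  by rewrite -exprS [RHS](_ : _ = a ^+ (5 + 3)) // exprD a5 mul1r.
Qed.

End MonoStp.

(** * Uniqueness of frames and the action of Frobenius *)

Section Frames.
Variables (K : fieldType) (b : 'rV[K]_4 -> 'rV[K]_4 -> 'rV[K]_4).

Lemma frame_change (Q Q' : 'M[K]_4) : frame b Q -> frame b Q' ->
  forall u v, stp u v *m (Q' *m invmx Q) = stp (u *m (Q' *m invmx Q)) (v *m (Q' *m invmx Q)).
Proof.
move=> [UQ fQ] [UQ' fQ'] u v; apply: (can_inj (mulmxK UQ)).
by rewrite -fQ !mulmxA !mulmxKV // fQ'.
Qed.

Lemma frame_mono (Q : 'M[K]_4) r e : e ^+ 5 = 1 -> frame b Q -> frame b (mono r e *m Q).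
Proof.
move=> e5 [UQ fQ]; split.
  rewrite unitmx_mul UQ andbT; have := mono_unit r e5.
  by case/mulmx1_unit.
by move=> u v; rewrite !mulmxA fQ -mono_stp // mulmxA.
Qed.

Lemma frame_aut (Q g : 'M[K]_4) : isaut b g -> frame b Q -> frame b (Q *m g).
Proof.
move=> [Ug ag] [UQ fQ]; split; first by rewrite unitmx_mul UQ.
by move=> u v; rewrite !mulmxA -ag fQ.
Qed.

Lemma frame_isaut (Q M : 'M[K]_4) : frame b Q -> M \in unitmx ->
  (forall u v, stp u v *m M = stp (u *m M) (v *m M)) -> isaut b (invmx Q *m M *m Q).
Proof.
move=> [UQ fQ] UM aM; split; first by rewrite !unitmx_mul unitmx_inv UQ UM.
move=> x y; rewrite -{1}(mulmxKV UQ x) -{1}(mulmxKV UQ y) fQ !mulmxA mulmxK //.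
by rewrite fQ aM.
Qed.

End Frames.

Section SingularFrames.
Variable K : closedFieldType.
Variable b : {bilinear 'rV[K]_4 -> 'rV[K]_4 -> 'rV[K]_4}.
Hypothesis bxx : forall x, b x x = 0.

Lemma frame_singular (Q : 'M[K]_4) i : frame b Q -> singular b (row i Q).
Proof.
move=> [UQ fQ]; rewrite rowE.
have inj (x y : 'rV[K]_4) : x *m Q = y *m Q -> x = y by move/(can_inj (mulmxK UQ)).
split; last first.
  by move=> y; rewrite -(mulmxKV UQ y) !fQ stp_delta_cube mul0mx.
exists (delta_mx 0 (i + 2%:R) *m Q); rewrite fQ stp_delta2 mul0mx; split=> //; split.
  apply/eqP; rewrite -(mul0mx _ Q) => /inj/rowP/(_ i); rewrite !mxE !eqxx => /eqP.
  by rewrite oner_eq0.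
have n2 : (i + 2%:R == i) = false by rewrite -{2}(addr0 i) (inj_eq (addrI i)).
move=> k; apply/eqP; rewrite scalemxAl => /inj/rowP/(_ (i + 2%:R)).
by rewrite !mxE !eqxx n2 mulr0 => /eqP; rewrite oner_eq0.
Qed.

Variable Gam : {rmorphism K -> K} -> 'M[K]_4 -> Prop.
Hypothesis autG : forall t S, Gam t S -> semiaut b t S.
Hypothesis irrG : forall U : 'M[K]_4,
  (forall t S, Gam t S -> (map_mx t U *m S <= U)%MS) -> U = 0 \/ row_full U.
Hypothesis bn0 : exists x y, b x y != 0.

(** The rows of any frame are singular vectors, so they lie on the four lines of the other frame:
    the change of frame is a monomial automorphism of [stp]. *)
Lemma frames_mono (Q Q' : 'M[K]_4) : frame b Q -> frame b Q' ->
  exists r e, e ^+ 5 = 1 /\ Q' = mono r e *m Q.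
Proof.
move=> fQ fQ'; have [UQ bQ] := fQ; have [UQ' _] := fQ'.
have QE : Q = rows4 (row 0 Q) (row 1 Q) (row 2%:R Q) (row 3%:R Q).
  apply/row_matrixP => i; rewrite rowK.
  by case: i => [[|[|[|[|i]]]] Hi] //=; congr (row _ Q); apply: val_inj.
have P : planes b (row 0 Q) (row 2%:R Q) (row 1 Q) (row 3%:R Q).
  split; first by apply: basis4_swap12; rewrite /basis4 -QE.
    by rewrite !rowE bQ -(add0r 2%:R) stp_delta2 mul0mx.
  rewrite !rowE bQ (_ : 3%:R = 1 + 2%:R :> 'I_4); last exact: val_inj.
  by rewrite stp_delta2 mul0mx.
have [r [e [e5 E]]] : exists r e, e ^+ 5 = 1 /\ Q' *m invmx Q = mono r e.
  apply: mono_of_stp.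
  - by rewrite unitmx_mul UQ' unitmx_inv.
  - exact: frame_change fQ fQ'.
  - move=> i; have [k k0 H] := singular_cases bxx autG irrG bn0 P
      (frame_singular _ fQ) (frame_singular _ fQ) (frame_singular _ fQ)
      (frame_singular _ fQ) (frame_singular i fQ').
    exists k; rewrite row_mul; case: H => ->.
    + by exists 0; rewrite -scalemxAl -row_mul mulmxV // row1.
    + by exists 2%:R; rewrite -scalemxAl -row_mul mulmxV // row1.
    + by exists 1; rewrite -scalemxAl -row_mul mulmxV // row1.
    + by exists 3%:R; rewrite -scalemxAl -row_mul mulmxV // row1.
by exists r, e; rewrite -E mulmxKV.
Qed.

End SingularFrames.

Lemma mono_eq (K : fieldType) r s (e w : K) (Q : 'M[K]_4) : Q \in unitmx ->
  w != 0 -> mono r e *m Q = mono s w *m Q -> r = s /\ e = w.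
Proof.
move=> UQ w0 /(can_inj (mulmxK UQ)) E.
have E0 : row 0 (mono s w) = row 0 (mono r e) by rewrite E.
have : s = r.
  move: E0; rewrite !row_mono !add0r /= !expr1 => /rowP/(_ s).
  rewrite !mxE !eqxx /=; case: eqP => // _ /eqP; rewrite mulr1 mulr0.
  by rewrite (negPf w0).
move=> sr; split=> //; move: E0; rewrite sr !row_mono !add0r /= !expr1.
by move/rowP/(_ r); rewrite !mxE !eqxx !mulr1.
Qed.

Section FiniteBase.
Variables (F : finFieldType) (K : closedFieldType) (iota : {rmorphism F -> K}).
Variable phi : {rmorphism K -> K}.
Hypothesis phi_bij : bijective phi.
Hypothesis phiE : forall x, phi x = x ^+ #|F|.
Hypothesis char2 : (2%:R : K) != 0.

(** [mono s w] is the value at Frobenius of the Galois cocycle that describes the [F]-form. *)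
Definition twisted (C : 'I_4 -> 'I_4 -> 'rV[F]_4) s w (Q : 'M[K]_4) :=
  [/\ frame (tbr (fun i j => map_mx iota (C i j))) Q, w ^+ 5 = 1 &
      map_mx phi Q = mono s w *m Q].

Section Algebra.
Variable C : 'I_4 -> 'I_4 -> 'rV[F]_4.
Hypothesis Cxx : forall x, tbr C x x = 0.
Hypothesis Cirr : irrmx (isaut (tbr C)).
Hypothesis Cn0 : exists x y, tbr C x y != 0.
Let bK := tbr (fun i j => map_mx iota (C i j)).

Lemma frames_monoF (Q Q' : 'M[K]_4) : frame bK Q -> frame bK Q' ->
  exists r e, e ^+ 5 = 1 /\ Q' = mono r e *m Q.
Proof.
apply: (@frames_mono K bK (CKxx iota Cxx char2) (Gam iota phi C)).
- exact: Gam_semiaut.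
- exact: (Gam_irr phiE).
- exact: CKn0.
Qed.

Lemma exists_frame : exists Q a (g : 'M[F]_4), [/\ frame bK Q, 5.-primitive_root a,
   isaut (tbr C) g & forall i : 'I_4, row i Q *m map_mx iota g = a ^+ (2 ^ i) *: row i Q].
Proof.
have bxx := CKxx iota Cxx char2.
have autG := @Gam_semiaut F K iota phi phi_bij phiE C.
have irrG := @Gam_irr F K iota phi phiE C Cirr.
have bn0 := @CKn0 F K iota C Cn0.
have [e0 [e1 [e2 [e3 [P [S0 S1 S2 S3]]]]]] := exists_singular_planes bxx autG irrG bn0.
have line g : exists j : 'I_4, isaut (tbr C) g -> exists2 k, k != 0 &
    e0 *m map_mx iota g = k *: [:: e0; e1; e2; e3]`_j.
  have [Ag|nA] := EM (isaut (tbr C) g); last by exists 0.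
  have Sg := isaut_singular (isaut_iota iota Ag) S0.
  have [k k0 [E|E|E|E]] := singular_cases bxx autG irrG bn0 P S0 S1 S2 S3 Sg.
  - by exists 0 => _; exists k.
  - by exists 1 => _; exists k.
  - by exists 2%:R => _; exists k.
  - by exists 3%:R => _; exists k.
have [j jP] := choice line.
have card := irr_card (isT : 1 < 4)%N Cirr.
(* Pigeonhole: more than four automorphisms, four lines for the image of [e0]. Then [g h^-1] fixes
   the line of [e0]. *)
have [g [h [Ag Ah gh jgh]]] : exists g h, [/\ isaut (tbr C) g, isaut (tbr C) h, g != h & j g = j h].
  apply/not_existsP => H; move: card; apply/negP; rewrite -leqNgt.
  rewrite -[X in (_ <= X)%N](card_ord 4) -(card_in_imset (f := j)) ?max_card //.
  move=> g h; rewrite !inE => /asboolP Ag /asboolP Ah jgh; apply/eqP/negPn/negP => gh.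
  by case: (H g); exists h.
have [k k0 Ek] := jP g Ag; have [l l0 El] := jP h Ah.
pose x := g *m invmx h; have Ax : isaut (tbr C) x by apply: isautM => //; apply: isautV.
have [Uh _] := Ah.
have E0 : e0 *m map_mx iota x = (k / l) *: e0.
  have Uh' : map_mx iota h \in unitmx by rewrite map_unitmx.
  rewrite /x map_mxM mulmxA Ek jgh map_invmx; apply: (can_inj (mulmxK Uh')).
  by rewrite mulmxKV // -[in RHS]scalemxAl El scalerA divfK.
have x1 : map_mx iota x != 1%:M.
  apply: contra gh => /eqP; rewrite -(map_mx1 iota) => /map_mx_inj x1.
  by rewrite -(mulmxKV Uh g) -/x x1 mul1mx.
have [Q [a [fQ pa _ eQ]]] := frame_of_fix bxx autG irrG bn0 char2 P S0 S1 S2 S3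
  (isaut_iota iota Ax) x1 E0.
by exists Q, a, x; split.
Qed.

Lemma frame_phi Q : frame bK Q -> frame bK (map_mx phi Q).
Proof.
move=> [UQ fQ]; split; first by rewrite map_unitmx.
have [psi psiK phiK] := phi_bij.
move=> u v; have pK (x : 'rV[K]_4) : map_mx phi (map_mx psi x) = x.
  by apply/rowP => i; rewrite !mxE phiK.
have pt x y : map_mx phi (bK x y) = bK (map_mx phi x) (map_mx phi y) by exact: phi_tbr.
rewrite -(pK u) -(pK v) -!map_mxM -pt fQ map_mxM; congr (_ *m _).
by apply/rowP => i; rewrite !mxE rmorphB !rmorphM.
Qed.

Lemma exists_twisted : exists Q s w (a : K), [/\ twisted C s w Q, 5.-primitive_root a,
  #|F| = 2 ^ s %[mod 5] & ~~ odd s -> w = 1].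
Proof.
have [Q [a [g [fQ pa Ag eQ]]]] := exists_frame.
have [s [w [w5 E]]] := frames_monoF fQ (frame_phi fQ).
have [UQ _] := fQ; have a0 : a != 0.
  apply/eqP => a0; move: (prim_expr_order pa).
  by rewrite a0 expr0n => /eqP; rewrite eq_sym oner_eq0.
have w0 : w != 0.
  by apply/eqP => w0; move: w5; rewrite w0 expr0n => /eqP; rewrite eq_sym oner_eq0.
(* [phi] sends [h_0], with eigenvalue [a], to [w h_s], with eigenvalue [a^(2^s)]. As [g] is rational
   it commutes with [phi], so [a^q = a^(2^s)]. *)
have qs : #|F| = 2 ^ s %[mod 5].
  have rphi : row 0 (map_mx phi Q) = w *: row s Q.
    by rewrite E row_mul row_mono add0r expn0 expr1 -scalemxAl -rowE.
  have := congr1 (map_mx phi) (eQ 0); rewrite map_mxM map_mxZ map_phi_iota //.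
  rewrite map_row rphi -scalemxAl eQ expn0 expr1 phiE !scalerA => /eqP.
  rewrite -subr_eq0 -scalerBl scaler_eq0 [w * _]mulrC -mulrBl mulf_eq0 (negPf w0) orbF.
  have rs0 : row s Q != 0.
    apply/eqP; rewrite rowE -(mul0mx _ Q) => /(can_inj (mulmxK UQ))/rowP/(_ s).
    by rewrite !mxE !eqxx => /eqP; rewrite oner_eq0.
  by rewrite (negPf rs0) orbF subr_eq0 (eq_prim_root_expr pa) eq_sym => /eqP ->.
exists Q, s, w, a; split=> //.
(* For [w <> 1], an automorphism [mono r e] commutes with Frobenius only if [w^(2^r) = w], that is
   [r = 0]. With [s] even the plane of [h_0] and [h_2], selected by [E02], would then be stable. *)
move=> even_s; apply/eqP/negPn/negP => w1; have pw := prim5 w5 w1.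
pose E02 : 'M[K]_4 := diag_mx (\row_i (~~ odd i)%:R).
have rE02 i : row i E02 = (~~ odd i)%:R *: delta_mx 0 i.
  by rewrite row_diag_mx mxE.
pose U := E02 *m Q.
have stab r e (s0 : ~~ odd (r : 'I_4)) : (E02 *m (mono r e *m Q) <= U)%MS.
  apply/row_subP => i; rewrite row_mul rE02 -scalemxAl mulmxA -rowE row_mono.
  case oi: (odd i); first by rewrite scale0r sub0mx.
  rewrite scale1r -scalemxAl scalemx_sub // /U.
  have -> : delta_mx 0 (i + r) = row (i + r) E02.
    by rewrite rE02 /= odd_mod // oddD oi (negPf s0) scale1r.
  by rewrite -row_mul row_sub.
have [U0|fU] : U = 0 \/ row_full U.
- apply: (@irrK F K iota phi phiE C Cirr).
    rewrite /U map_mxM E; have -> : map_mx phi E02 = E02.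
      by rewrite map_diag_mx; congr diag_mx; apply/rowP => i; rewrite !mxE rmorph_nat.
    exact: stab.
  move=> h Ah; have [r [e [e5 Er]]] := frames_monoF fQ (frame_aut (isaut_iota iota Ah) fQ).
  rewrite /U -mulmxA Er; apply: stab.
  suff -> : r = 0 by [].
  have e0 : e != 0.
    by apply/eqP => e0; move: e5; rewrite e0 expr0n => /eqP; rewrite eq_sym oner_eq0.
  have := congr1 (map_mx phi) Er; rewrite !map_mxM E map_phi_iota // -mulmxA Er.
  rewrite map_mono !mulmxA !monoM // => /(mono_eq UQ)[].
    by rewrite mulf_neq0 ?expf_neq0 // fmorph_eq0.
  have -> : phi e = e ^+ (2 ^ s).
    by rewrite phiE -(expr_mod #|F| e5) qs expr_mod.
  move=> _; rewrite mulrC => /(mulfI (expf_neq0 _ e0)) => w2.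
  have : w ^+ 1 == w ^+ (2 ^ r) by rewrite -w2.
  rewrite (eq_prim_root_expr pw) => /eqP r0; apply: val_inj => /=.
  by move: r0; case: (r) => [[|[|[|[|l]]]] Hl].
- have : row 0 U = 0 by rewrite U0 row0.
  rewrite row_mul rE02 scale1r -(mul0mx _ Q) => /(can_inj (mulmxK UQ))/rowP/(_ 0).
  by rewrite !mxE !eqxx => /eqP; rewrite oner_eq0.
- move: fU; rewrite row_full_unit => UU.
  have : row 1 U = 0 by rewrite row_mul rE02 scale0r mul0mx.
  rewrite rowE -(mul0mx _ U) => /(can_inj (mulmxK UU))/rowP/(_ 1).
  by rewrite !mxE !eqxx => /eqP; rewrite oner_eq0.
Qed.

End Algebra.
End FiniteBase.

(** * The twisted forms *)

Lemma invmx_mul (R : comUnitRingType) n (A B : 'M[R]_n) :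
  A \in unitmx -> B \in unitmx -> invmx (A *m B) = invmx B *m invmx A.
Proof.
move=> UA UB; have U : A *m B \in unitmx by rewrite unitmx_mul UA.
by apply: (can_inj (mulmxK U)); rewrite mulVmx // mulmxA mulmxKV // mulVmx.
Qed.

Lemma exists_prim5 (K : closedFieldType) : 5%:R != 0 :> K -> exists a : K, 5.-primitive_root a.
Proof.
move=> n5; have [x E] := @solve_monicpoly K 4 (fun => -1) isT.
exists x; move: E; rewrite !big_ord_recl big_ord0 /= => E.
have E' : x ^+ 4 + x ^+ 3 + x ^+ 2 + x + 1 = 0 by rewrite E; ring.
apply: prim5.
  apply/eqP; rewrite -subr_eq0; apply/eqP.
  have -> : x ^+ 5 - 1 = (x - 1) * (x ^+ 4 + x ^+ 3 + x ^+ 2 + x + 1) by ring.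
  by rewrite E' mulr0.
apply: contra n5 => /eqP x1; rewrite -E' x1; apply/eqP; ring.
Qed.

(** 2 generates the units modulo 5, so repeated squaring of [w] reaches every primitive fifth
    root. *)
Lemma prim5_pow (K : fieldType) (a w : K) : 5.-primitive_root a -> w ^+ 5 = 1 -> w != 1 ->
  exists r : 'I_4, w ^+ (2 ^ r) = a.
Proof.
move=> pa w5 w1; have pw := prim5 w5 w1.
have [[k Hk] ak] := prim_rootP pw (prim_expr_order pa).
case: k Hk ak => [|[|[|[|[|k]]]]] Hk //= ak.
- by have := prim_order_dvd pa 1; rewrite expr1 ak expr0 eqxx.
- by exists 0; rewrite ak.
- by exists 1; rewrite ak.
- by exists 3%:R; rewrite ak /= -[LHS](expr_mod _ w5).
- by exists 2%:R; rewrite ak.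
Qed.

Section FiniteBase.
Variables (F : finFieldType) (K : closedFieldType) (iota : {rmorphism F -> K}).
Variable phi : {rmorphism K -> K}.
Hypothesis phi_bij : bijective phi.
Hypothesis phiE : forall x, phi x = x ^+ #|F|.
Hypothesis char2 : (2%:R : K) != 0.
Notation twisted := (twisted iota phi).
Notation ext C := (tbr (fun i j => map_mx iota (C i j))).

Lemma root5_neq0 (w : K) : w ^+ 5 = 1 -> w != 0.
Proof.
by move=> w5; apply/eqP => w0; move/eqP: w5; rewrite w0 expr0n eq_sym oner_eq0.
Qed.

Lemma mono_unitmx s (w : K) : w ^+ 5 = 1 -> mono s w \in unitmx.
Proof. by move/(mono_unit s)/mulmx1_unit => []. Qed.

Lemma mono0_root (w : K) : (mono 0 w : 'M[K]_4) = diag_mx (\row_i w ^+ (2 ^ i)).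
Proof. by apply/matrixP => i j; rewrite !mxE addr0 eq_sym. Qed.

(** With equal cocycles, the isomorphism [Q^-1 Q'] is fixed by [phi] and hence rational. *)
Lemma twisted_iso C C' s w Q Q' : twisted C s w Q -> twisted C' s w Q' ->
  exists2 T : 'M[F]_4, T \in unitmx &
    forall x y, tbr C x y *m T = tbr C' (x *m T) (y *m T).
Proof.
move=> [[UQ fQ] w5 EQ] [[UQ' fQ'] _ EQ'].
have [T ET] : exists T : 'M[F]_4, invmx Q *m Q' = map_mx iota T.
  apply: (phi_fixed_mx iota phiE); rewrite map_mxM map_invmx EQ EQ'.
  by rewrite invmx_mul ?mono_unitmx // -mulmxA mulKmx ?mono_unitmx.
exists T; first by rewrite -(map_unitmx iota) -ET unitmx_mul unitmx_inv UQ.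
move=> x y; apply: (map_mx_inj (f := iota)); rewrite map_mxM !map_tbr !map_mxM -ET.
set x' := map_mx iota x; set y' := map_mx iota y.
rewrite -{1}(mulmxKV UQ x') -{1}(mulmxKV UQ y') fQ mulmxA mulmxK // !mulmxA fQ'.
by [].
Qed.

(** Rotating the frame conjugates the cocycle; this identifies all the forms with [w <> 1] for a
    given [s]. *)
Lemma twisted_rot C s w Q (r : 'I_4) : twisted C s w Q ->
  twisted C s (w ^+ (2 ^ r)) (mono r 1 *m Q).
Proof.
move=> [fQ w5 EQ]; have o5 : (1 : K) ^+ 5 = 1 by rewrite expr1n.
split; [exact: frame_mono | by rewrite exprAC w5 expr1n |].
rewrite map_mxM map_mono rmorph1 EQ !mulmxA !monoM //.
by rewrite expr1n mulr1 mul1r addrC.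
Qed.

(** An isomorphism carries one frame to another frame of the same algebra, so the two differ by some
    [mono r e]. Since [phi(e) = e^q = e^(2^s)], the factor [e] cancels in the comparison of cocycles
    and 1 cannot become another [w]. *)
Lemma twisted_noniso C C' (s : 'I_4) w Q Q' (T : 'M[F]_4) :
  (forall x, tbr C x x = 0) -> irrmx (isaut (tbr C)) -> (exists x y, tbr C x y != 0) ->
  #|F| = 2 ^ s %[mod 5] -> twisted C s 1 Q -> twisted C' s w Q' -> T \in unitmx ->
  (forall x y, tbr C x y *m T = tbr C' (x *m T) (y *m T)) -> w = 1.
Proof.
move=> Cxx Cirr Cn0 qs [fQ _ EQ] [[UQ' fQ'] w5 EQ'] UT mT.
have UT' : map_mx iota T \in unitmx by rewrite map_unitmx.
pose Q'' := Q' *m invmx (map_mx iota T).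
have EQ'' : map_mx phi Q'' = mono s w *m Q''.
  by rewrite map_mxM map_invmx map_phi_iota // EQ' mulmxA.
have fQ'' : frame (ext C) Q''.
  split; first by rewrite unitmx_mul UQ' unitmx_inv.
  move=> u v; apply: (can_inj (mulmxK UT')).
  by rewrite (map_tbr_hom iota mT) !mulmxA !mulmxKV.
have [r [e [e5 E]]] := frames_monoF phi_bij phiE char2 Cxx Cirr Cn0 fQ fQ''.
have [UQ _] := fQ.
move: EQ''; rewrite E map_mxM map_mono EQ !mulmxA !monoM ?expr1n //.
have w0 := root5_neq0 w5; have e0 := root5_neq0 e5.
case/(mono_eq UQ); first by rewrite mulf_neq0 ?expf_neq0.
move=> _; rewrite ?expr1n ?mulr1 phiE -(expr_mod #|F| e5) qs expr_mod //.
by rewrite -{1}[e ^+ _]mul1r => /(mulIf (expf_neq0 _ e0)).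
Qed.

(** Because [mono s w] is an automorphism of [stp], the product carried over by [P] commutes with
    [phi]; its structure constants are fixed by [phi] and lie in [F]. *)
Lemma twisted_exists (s : 'I_4) w (P : 'M[K]_4) : P \in unitmx -> w ^+ 5 = 1 ->
  map_mx phi P = mono s w *m P ->
  exists C, (forall x, tbr C x x = 0) /\ twisted C s w P.
Proof.
move=> UP w5 EP.
pose v i j := stp (row i (invmx P)) (row j (invmx P)) *m P.
have Um := mono_unitmx s w5.
have fixv i j : map_mx phi (v i j) = v i j.
  have st_phi (x y : 'rV[K]_4) : map_mx phi (stp x y) = stp (map_mx phi x) (map_mx phi y).
    by apply/rowP => k; rewrite !mxE rmorphB !rmorphM.
  rewrite /v map_mxM st_phi !map_row map_invmx EP mulmxA mono_stp // !rowE -!mulmxA.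
  have -> : invmx (mono s w *m P) *m mono s w = invmx P.
    by rewrite invmx_mul // mulmxKV.
  by [].
have /choice[C1 /= EC1] : forall i, exists Ci : 'I_4 -> 'rV[F]_4,
    forall j, v i j = map_mx iota (Ci j).
  move=> i; have /choice[Ci ECi] : forall j, exists c, v i j = map_mx iota c.
    by move=> j; apply: (phi_fixed_mx iota phiE).
  by exists Ci.
have fE x y : ext C1 (x *m P) (y *m P) = stp x y *m P.
  rewrite -{2}(mulmxK UP x) -{2}(mulmxK UP y).
  set x' := x *m P; set y' := y *m P.
  rewrite {2}(row_sum_delta x') {2}(row_sum_delta y') /tbr !mulmx_suml linear_sumlz mulmx_suml.
  apply: eq_bigr => i _; rewrite linear_sumr mulmx_suml; apply: eq_bigr => j _.
  rewrite -!scalemxAl linearZl_LR linearZr_LR /= -!scalemxAl scalerA -EC1.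
  by rewrite /v !rowE.
exists C1; split; last by split.
move=> x; apply: (map_mx_inj (f := iota)); rewrite map_tbr map_mx0.
rewrite -(mulmxKV UP (map_mx iota x)) fE -[RHS](mul0mx _ P); congr (_ *m _).
by apply/rowP => k; rewrite !mxE; ring.
Qed.

Lemma twisted_aut C s w Q (X : 'M[K]_4) : twisted C s w Q -> X \in unitmx ->
  (forall u v, stp u v *m X = stp (u *m X) (v *m X)) ->
  map_mx phi X *m mono s w = mono s w *m X ->
  exists2 g, isaut (tbr C) g & map_mx iota g = invmx Q *m X *m Q.
Proof.
move=> [fQ w5 EQ] UX aX comm; have [UQ _] := fQ; have Um := mono_unitmx s w5.
have [g Eg] : exists g : 'M[F]_4, invmx Q *m X *m Q = map_mx iota g.
  apply: (phi_fixed_mx iota phiE); rewrite !map_mxM map_invmx EQ invmx_mul //.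
  by rewrite -mulmxA (mulmxA (map_mx phi X)) comm !mulmxA mulmxKV.
exists g => //; have [Ug ag] := frame_isaut fQ UX aX; rewrite Eg in Ug ag.
split; first by rewrite -(map_unitmx iota).
move=> x y; apply: (map_mx_inj (f := iota)).
by rewrite map_mxM !map_tbr ag !map_mxM.
Qed.

(** In frame coordinates a non-zero stable subspace is invariant under the rational diagonal
    automorphism [mono 0 a], so it contains a basis vector. It is also invariant under an odd
    rotation of the four lines, namely [mono 1 1] if [w = 1] and Frobenius if [s] is odd, and odd
    rotations are transitive. *)
Lemma twisted_irr C (s : 'I_4) w Q (a : K) : twisted C s w Q -> 5.-primitive_root a ->
  #|F| = 2 ^ s %[mod 5] -> w = 1 \/ odd s -> irrmx (isaut (tbr C)).
Proof.
move=> TQ pa qs Hw U0 stU; have [fQ w5 EQ] := TQ; have [UQ _] := fQ.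
have a5 := prim_expr_order pa.
have [->|nU0] := eqVneq U0 0; [by left | right].
pose W := map_mx iota U0 *m invmx Q.
have stW X : (exists2 g, isaut (tbr C) g & map_mx iota g = invmx Q *m X *m Q) ->
    (W *m X <= W)%MS.
  case=> g Ag Eg; have := stU _ Ag; rewrite -(map_submx iota) map_mxM Eg !mulmxA.
  by move/(submxMr (invmx Q)); rewrite mulmxK.
have stD : (W *m mono 0 a <= W)%MS.
  apply: stW; apply: (twisted_aut TQ); [exact: mono_unitmx | exact: mono_stp |].
  rewrite map_mono !monoM // add0r addr0 expn0 expr1 mulrC; congr (mono _ (_ * _)).
  by rewrite phiE -(expr_mod #|F| a5) qs expr_mod.
have [s' os' stS] : exists2 s' : 'I_4, odd s' &
    forall j : 'I_4, ((delta_mx 0 j : 'rV[K]_4)%R <= W)%MS ->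
      ((delta_mx 0 (j + s') : 'rV[K]_4)%R <= W)%MS.
  case: Hw => [w1|os].
  - exists 1 => // j jW; have o5 : (1 : K) ^+ 5 = 1 by rewrite expr1n.
    have : (W *m mono 1 1 <= W)%MS.
      apply: stW; apply: (twisted_aut TQ); [exact: mono_unitmx | exact: mono_stp |].
      by rewrite map_mono rmorph1 w1 !monoM // !expr1n addrC.
    apply: submx_trans; have := submxMr (mono 1 1) jW; rewrite -rowE row_mono.
    by rewrite expr1n scale1r.
  - exists s => // j /submxP[D ED].
    have : (map_mx phi ((delta_mx 0 j : 'rV[K]_4) *m Q)%R <= map_mx iota U0)%MS.
      rewrite ED -mulmxA mulmxKV // map_mxM map_phi_iota //; exact: submxMl.
    rewrite map_mxM map_delta_mx EQ mulmxA -rowE row_mono -scalemxAl.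
    move/(submxMr (invmx Q)); rewrite -scalemxAl mulmxK //.
    by rewrite eqmx_scale // expf_neq0 // root5_neq0.
have [j jW] : exists j : 'I_4, ((delta_mx 0 j : 'rV[K]_4)%R <= W)%MS.
  have W0 : W != 0.
    apply: contra nU0 => /eqP W0; rewrite -(map_mx_eq0 iota).
    by rewrite -(mulmxKV UQ (map_mx iota U0)) -/W W0 mul0mx.
  have [i ri] : exists i, row i W != 0.
    apply/existsP; apply: contraNT W0; rewrite negb_exists => /forallP H.
    by apply/eqP/row_matrixP => i; rewrite row0; apply/eqP; rewrite -[_ == _]negbK H.
  set v := row i W in ri; have vW : (v <= W)%MS by apply: row_sub.
  have [j vj] : exists j, v 0 j != 0.
    apply/existsP; apply: contraNT ri; rewrite negb_exists => /forallP H.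
    by apply/eqP/rowP => k; rewrite [RHS]mxE; apply/eqP; rewrite -[_ == _]negbK H.
  have step (x : 'rV[K]_4) c : (x <= W)%MS -> (x *m (mono 0 a - c%:M) <= W)%MS.
    move=> xW; rewrite mulmxBr mul_mx_scalar addmx_sub //.
      by apply: submx_trans stD; apply: submxMr.
    by rewrite eqmx_opp scalemx_sub.
  have stepE (x : 'rV[K]_4) c k : (x *m (mono 0 a - c%:M)) 0 k = x 0 k * (a ^+ (2 ^ k) - c).
    by rewrite mono0_root mulmxBr mul_mx_scalar mul_mx_diag !mxE; ring.
  (* The eigenvalues of [mono 0 a] are distinct; applying to [v] the factors for the three
     eigenvalues other than the [j]-th leaves a non-zero multiple of the [j]-th basis vector. *)
  exists j; pose d i := a ^+ (2 ^ (j + i)%R).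
  have := step _ (d 3%:R) (step _ (d 2%:R) (step _ (d 1) vW)).
  have -> : v *m (mono 0 a - (d 1)%:M) *m (mono 0 a - (d 2%:R)%:M) *m (mono 0 a - (d 3%:R)%:M) =
      (v 0 j * (a ^+ (2 ^ j) - d 1) * (a ^+ (2 ^ j) - d 2%:R) *
       (a ^+ (2 ^ j) - d 3%:R)) *: delta_mx 0 j.
    apply/rowP => k; rewrite !stepE !mxE eqxx /=.
    case: eqVneq => [->|kj]; first by rewrite mulr1.
    have [/eqP H|/eqP H|/eqP H] : [\/ k = j + 1, k = j + 2%:R | k = j + 3%:R].
      rewrite -[k](subrK j) addrC; have : k - j != 0 by rewrite subr_eq0.
      case: (k - j) => [[|[|[|[|l]]]] Hl] //= _.
      - by constructor 1; congr (_ + _); apply: val_inj.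
      - by constructor 2; congr (_ + _); apply: val_inj.
      - by constructor 3; congr (_ + _); apply: val_inj.
    - by rewrite /d -(eqP H) subrr !(mulr0, mul0r).
    - by rewrite /d -(eqP H) subrr !(mulr0, mul0r).
    - by rewrite /d -(eqP H) subrr !(mulr0, mul0r).
  rewrite eqmx_scale //.
  have dn (i0 : 'I_4) : i0 != 0 -> a ^+ (2 ^ j) - d i0 != 0.
    move=> i00; rewrite subr_eq0 /d (eq_prim_root_expr pa).
    have : j != j + i0 by rewrite -{1}(addr0 j) (inj_eq (addrI j)) eq_sym.
    by move: (j + i0); move: (j) => [[|[|[|[|?]]]] ?] // [[|[|[|[|?]]]] ?].
  by rewrite !mulf_neq0 // dn.
have all_n n : ((delta_mx 0 (j + s' *+ n) : 'rV[K]_4)%R <= W)%MS.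
  elim: n => [|n IH]; first by rewrite mulr0n addr0.
  by rewrite mulrSr addrA; apply: stS.
have fW : row_full W.
  rewrite -sub1mx; apply/row_subP => k; rewrite row1.
  (* An odd [s'] satisfies [s' * s' = 1] modulo 4, so [s' * (k - j)] rotations lead from [j] to
     [k]. *)
  have := all_n (s' * (k - j) : 'I_4); rewrite -mulr_natr natr_Zp mulrA.
  have -> : s' * s' = 1 by apply: val_inj; move: (s') os' => [[|[|[|[|?]]]] ?].
  by rewrite mul1r subrKC.
move: fW; rewrite /W /row_full mxrankMfree ?row_free_unit ?unitmx_inv //.
by rewrite mxrank_map.
Qed.

End FiniteBase.

(** * Frames with prescribed Frobenius action *)

Section FiniteBase.
Variables (F : finFieldType) (K : closedFieldType).
Variable phi : {rmorphism K -> K}.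
Hypothesis phiE : forall x, phi x = x ^+ #|F|.
Variables (a : K) (s : 'I_4).
Hypothesis pa : 5.-primitive_root a.
Hypothesis qs : #|F| = 2 ^ s %[mod 5].

(* The algebra with w = 1 has rational spanning vectors v_0, ..., v_4 of sum 0,
   permuted by g, and h_j = \sum_i a^(2^j i) v_i. *)
Definition vander5 : 'M[K]_4 := \matrix_(j, i) (a ^+ (2 ^ j * i.+1) - 1).

(** The [- 1] in the entries comes from eliminating [v_0] by the zero sum. A relation among the
    columns gives a polynomial of degree at most 4 that vanishes at all five fifth roots of unity, 1
    included. *)
Lemma vander5_unit : vander5 \in unitmx.
Proof.
rewrite -unitmx_tr -row_free_unit; apply/inj_row_free => v E.
pose p : {poly K} := 'X * rVpoly v - (\sum_i v 0 i)%:P.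
have hp x : p.[x] = \sum_i v 0 i * (x ^+ i.+1 - 1).
  rewrite /p hornerD hornerN hornerM hornerX hornerC (horner_coef_wide _ (size_poly _ _)).
  rewrite mulr_sumr -sumrN -big_split; apply: eq_bigr => i _ /=.
  by rewrite coef_rVpoly_ord exprS; ring.
have sp : (size p <= 5)%N.
  rewrite (leq_trans (size_polyD _ _)) // geq_max size_polyN.
  rewrite (leq_trans (size_polyC_leq1 _)) // andbT.
  by rewrite mulrC (leq_trans (size_polyMleq _ _)) // size_polyX addn2 ltnS size_poly.
have rp k : (k < 5)%N -> root p (a ^+ k).
  move=> k5; rewrite rootE hp; have [->|k0] := eqVneq k 0%N.
    by rewrite expr0 big1 // => i _; rewrite expr1n subrr mulr0.
  have [j kj] : exists j : 'I_4, a ^+ k = a ^+ (2 ^ j).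
    case: k k5 k0 => [|[|[|[|[|k]]]]] // _ _; [exists 0|exists 1|exists 3%:R|exists 2%:R] => //.
    by rewrite -[RHS](expr_mod _ (prim_expr_order pa)).
  have := congr1 (fun w : 'rV_4 => w 0 j) E; rewrite !mxE => /eqP; congr (_ == 0).
  by apply: eq_bigr => i _; rewrite !mxE kj -exprM.
have p0 : p = 0.
  apply: (@roots_geq_poly_eq0 _ _ [seq a ^+ k | k <- iota 0 5]).
  - by apply/allP => x /mapP[k]; rewrite mem_iota => /rp rk ->.
  - rewrite map_inj_in_uniq ?iota_uniq // => k l; rewrite !mem_iota => Hk Hl /eqP.
    by rewrite (eq_prim_root_expr pa) !modn_small // => /eqP.
  - by rewrite size_map size_iota.
apply/rowP => i; rewrite mxE -coef_rVpoly_ord.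
have := congr1 (fun r : {poly K} => r`_i.+1) p0.
by rewrite coef0 coefB coefXM coefC /= subr0.
Qed.

Lemma vander5_phi : map_mx phi vander5 = mono s 1 *m vander5.
Proof.
apply/row_matrixP => i; rewrite row_mul row_mono expr1n scale1r -rowE.
apply/rowP => j; rewrite !mxE rmorphB rmorph1 phiE; congr (_ - _).
have a5 := prim_expr_order pa.
rewrite !exprM expr_pow2D // [in LHS]exprAC; congr (_ ^+ _).
rewrite -!exprM -[LHS](expr_mod _ a5) -[RHS](expr_mod _ a5); congr (_ ^+ _).
by rewrite -modnMmr qs modnMmr.
Qed.

(** The [t i] rescale a frame with trivial [w] into one with the given [w], an explicit case of
    Hilbert 90. For odd [s] the indices form one cycle of length 4 under addition of [s], so one
    value of [t] determines the others. *)
Lemma exists_twisting w : w ^+ 5 = 1 -> w = 1 \/ odd s ->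
  exists2 t : 'I_4 -> K, forall i, t i != 0 &
    forall i, t i ^+ #|F| = w ^+ (2 ^ i) * t (i + s).
Proof.
move=> w5 [->|os].
  by exists (fun=> 1) => i; rewrite ?oner_neq0 // !expr1n mul1r.
have w0 := root5_neq0 w5.
pose u (k : nat) := w ^+ (2 ^ (s *+ k)%R).
have u0 k : u k != 0 by rewrite expf_neq0.
pose fix T (m : K) k := if k is k'.+1 then T m k' ^+ #|F| / u k' else m.
have TE k : exists2 c, c != 0 & forall m, T m k = c * m ^+ (#|F| ^ k).
  elim: k => [|k [c c0 IH]].
    by exists 1; rewrite ?oner_neq0 // => m; rewrite /= mul1r expn0 expr1.
  exists (c ^+ #|F| / u k); first by rewrite mulf_neq0 ?invr_neq0 ?expf_neq0.
  by move=> m /=; rewrite IH exprMn -exprM -expnSr mulrAC.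
have [c c0 T4] := TE 4%N.
have q1 : (1 < #|F|)%N by apply: finNzRing_gt1.
have q4 : (0 < #|F| ^ 4 - 1)%N by rewrite subn_gt0 -(exp1n 4) ltn_exp2r.
(* Going once round the cycle must return the starting value: [c m^(q^4) = m]. *)
have [m Em] := @solve_monicpoly K _ (fun i => if i == 0%N then c^-1 else 0) q4.
have mn : m ^+ (#|F| ^ 4 - 1) = c^-1.
  rewrite Em -(prednK q4) big_ord_recl big1 ?addr0 /=; first by rewrite expr0 mulr1.
  by move=> i _; rewrite mul0r.
have m0 : m != 0.
  by apply/eqP => m0; have := invr_neq0 c0; rewrite -mn m0 expr0n eqn0Ngt q4 eqxx.
have Tm4 : T m 4%N = m.
  rewrite T4; have -> : (#|F| ^ 4 = (#|F| ^ 4 - 1).+1)%N.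
    by rewrite subn1 prednK // expn_gt0 ltnW.
  by rewrite exprSr mulrA mn mulfV // mul1r.
have Tn0 k : T m k != 0.
  by have [d d0 ->] := TE k; rewrite mulf_neq0 // expf_neq0.
have ss : s * s = 1 by apply: val_inj; move: (s) os => [[|[|[|[|?]]]] ?].
(* As [s * s = 1], the index [i] is reached from 0 after [s * i] steps. *)
exists (fun i => T m ((s * i)%R : 'I_4)) => // i.
have -> : T m ((s * (i + s))%R : 'I_4) = T m ((s * i)%R : 'I_4).+1.
  rewrite mulrDr ss; case: ((s * i)%R : 'I_4) => [[|[|[|[|k]]]] Hk] //.
have -> : w ^+ (2 ^ i) = u ((s * i)%R : 'I_4).
  by rewrite /u -mulr_natr natr_Zp mulrA ss mul1r.
by rewrite /= mulrC divfK.
Qed.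

Lemma exists_twisted_frame w : w ^+ 5 = 1 -> w = 1 \/ odd s ->
  exists2 P : 'M[K]_4, P \in unitmx & map_mx phi P = mono s w *m P.
Proof.
move=> w5 Hw; have [t t0 tE] := exists_twisting w5 Hw.
exists (diag_mx (\row_i t i) *m vander5).
  rewrite unitmx_mul vander5_unit andbT unitmxE det_diag unitfE.
  by apply/prodf_neq0 => i _; rewrite mxE.
rewrite map_mxM vander5_phi; apply/row_matrixP => i.
rewrite map_diag_mx !row_mul !row_diag_mx !mxE row_mono phiE tE.
rewrite -!scalemxAl -!rowE !row_mul row_mono row_diag_mx !mxE expr1n scale1r.
by rewrite -!scalemxAl scalerA.
Qed.

End FiniteBase.

(** * Counting isomorphism types *)

Definition dim4_type (F : fieldType) (A : acAlg F) :=
  [/\ \dim {:A} = 4%N, IAC A & ~ abelian_alg A].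

Section PartC.
Variables (F : finFieldType) (p f : nat).
Hypotheses (p_pr : prime p) (p_odd : odd p) (cardF : #|F| = (p ^ f)%N).

Lemma closure_setup : exists (K : closedFieldType) (iota : {rmorphism F -> K})
    (phi : {rmorphism K -> K}),
  [/\ p \in [pchar K], bijective phi, forall x, phi x = x ^+ #|F| & (2%:R : K) != 0].
Proof.
have [K [iota _]] := countable_algebraic_closure F.
have chF := card_finPcharP cardF p_pr.
have chK : p \in [pchar K] by apply: rmorph_pchar iota _ chF.
have [phi [bphi phiE]] := frob_exists f chK.
exists K, iota, phi; split=> //; first by move=> x; rewrite phiE cardF.
rewrite -(dvdn_pcharf chK); apply/negP => p2.
by move: p_odd; rewrite (eqP (_ : p == 2%N)) // -(dvdn_prime2 p_pr).
Qed.

Lemma exists_pow2 (n : nat) : (n %% 5 != 0)%N -> exists s : 'I_4, n = 2 ^ s %[mod 5].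
Proof.
move: (ltn_pmod n (isT : 0 < 5)%N); case: (n %% 5)%N => [|[|[|[|[|k]]]]] // _ _.
- by exists 0.
- by exists 1.
- by exists 3%:R.
- by exists 2%:R.
Qed.

(** [2^2] is -1 modulo 5, so the square of [q] detects the parity of [s], which decides between one
    and two types. *)
Lemma pow2_sqr (n : nat) (s : 'I_4) : n = 2 ^ s %[mod 5] ->
  (n ^ 2 = if odd s then 4 else 1 %[mod 5])%N.
Proof.
by move=> ns; rewrite -modnXm ns; case: s {ns} => [[|[|[|[|?]]]] ?].
Qed.

Lemma pow2_inj (s s' : 'I_4) : 2 ^ s = 2 ^ s' %[mod 5] -> s = s'.
Proof.
by move=> E; apply: val_inj; case: s s' E => [[|[|[|[|?]]]] ?] [[|[|[|[|?]]]] ?].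
Qed.

Lemma card_sqr_even : (p %% 5 != 0)%N -> ~~ odd f \/ p = 1 %[mod 5] \/ p = 4 %[mod 5] ->
  (#|F| ^ 2 = 1 %[mod 5])%N.
Proof.
rewrite cardF => p5 [ev|H].
  have -> : ((p ^ f) ^ 2 = (p ^ 4) ^ f./2)%N.
    by rewrite -!expnM -{1}[f]odd_double_half (negPf ev) add0n -muln2 -mulnA mulnC.
  have p4 : (p ^ 4 = 1 %[mod 5])%N.
    rewrite -modnXm; move: (ltn_pmod p (isT : 0 < 5)%N) p5.
    by case: (p %% 5)%N => [|[|[|[|[|k]]]]].
  by rewrite -modnXm p4 modnXm exp1n.
have p2 : (p ^ 2 = 1 %[mod 5])%N by rewrite -modnXm; case: H => ->.
by rewrite -expnM mulnC expnM -modnXm p2 modnXm exp1n.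
Qed.

Lemma card_sqr_odd : odd f -> p = 2 %[mod 5] \/ p = 3 %[mod 5] ->
  (#|F| ^ 2 = 4 %[mod 5])%N.
Proof.
rewrite cardF => odd_f H.
have p2 : (p ^ 2 = 4 %[mod 5])%N by rewrite -modnXm; case: H => ->.
rewrite -expnM mulnC expnM -modnXm p2 modnXm -[f]odd_double_half odd_f expnS.
by rewrite -muln2 mulnC [(_ * 2)%N]mulnC expnM -modnMml -modnXm exp1n modnMml mul1n.
Qed.

Section Setup.
Variables (K : closedFieldType) (iota : {rmorphism F -> K}) (phi : {rmorphism K -> K}).
Hypotheses (chK : p \in [pchar K]) (phi_bij : bijective phi).
Hypotheses (phiE : forall x, phi x = x ^+ #|F|) (char2 : (2%:R : K) != 0).

Lemma dim4_classify A : dim4_type A -> exists C Cxx Q (s : 'I_4) w (a : K),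
  [/\ isomorphic A (@model F 4 C Cxx), twisted iota phi C s w Q,
      5.-primitive_root a, #|F| = 2 ^ s %[mod 5] & ~~ odd s -> w = 1].
Proof.
case=> dA iacA nabA; have [C [Cxx isoA]] := to_model dA.
have Cirr := IAC_irr (isomorphic_IAC isoA iacA).
have Cn0 : exists x y, tbr C x y != 0.
  have [//|n0] := EM (exists x y, tbr C x y != 0).
  case: nabA; apply: (isomorphic_abelian (isomorphic_sym isoA)) => x y.
  by apply/eqP/negPn/negP => xy; apply: n0; exists x, y.
have [Q [s [w [a [TQ pa qs ws]]]]] := exists_twisted iota phi_bij phiE char2 Cxx Cirr Cn0.
by exists C, Cxx, Q, s, w, a; split.
Qed.

Lemma twisted_n0 C s w Q : twisted iota phi C s w Q -> exists x y, tbr C x y != 0.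
Proof.
move=> [[UQ fQ] _ _]; have [//|n0] := EM (exists x y, tbr C x y != 0).
have C0 i j : C i j = 0.
  rewrite -tbr_delta; apply/eqP/negPn/negP => xy; apply: n0.
  by exists (delta_mx 0 i), (delta_mx 0 j).
have := fQ (delta_mx 0 0) (delta_mx 0 1).
rewrite -{2}(add0r 1) stp_delta1 /tbr big1; last first.
  by move=> i _; rewrite big1 // => j _; rewrite C0 map_mx0 scaler0.
rewrite -(mul0mx _ Q) => /(can_inj (mulmxK UQ))/rowP/(_ (0 + 3%:R)).
by rewrite !mxE !eqxx => /eqP; rewrite eq_sym oner_eq0.
Qed.

Lemma dim4_exists (a w : K) (s : 'I_4) : 5.-primitive_root a -> #|F| = 2 ^ s %[mod 5] ->
  w ^+ 5 = 1 -> w = 1 \/ odd s ->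
  exists C Cxx Q, twisted iota phi C s w Q /\ dim4_type (@model F 4 C Cxx).
Proof.
move=> pa qs w5 Hw; have [P UP EP] := exists_twisted_frame phiE pa qs w5 Hw.
have [C [Cxx TC]] := twisted_exists iota phiE UP w5 EP.
exists C, Cxx, P; split=> //; split; first exact: dim_model.
  by apply: irr_IAC => //; apply: (twisted_irr phiE TC pa).
move=> /model_abelian ab; have [x [y]] := twisted_n0 TC.
by rewrite ab eqxx.
Qed.

End Setup.

Theorem num_dim4_types :
  [/\ p = 5%N -> num_iso_types (@dim4_type F) 0,
      p <> 5%N -> ~~ odd f \/ (p = 1 %[mod 5])%N \/ (p = 4 %[mod 5])%N ->
        num_iso_types (@dim4_type F) 1
    & odd f -> (p = 2 %[mod 5])%N \/ (p = 3 %[mod 5])%N ->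
        num_iso_types (@dim4_type F) 2].
Proof.
have [K [iota [phi [chK bphi phiE char2]]]] := closure_setup.
have cl := dim4_classify iota bphi phiE char2.
have p5n : p <> 5%N -> (p %% 5 != 0)%N.
  by move=> p5; rewrite -/(5 %| p)%N dvdn_prime2 //; apply/eqP => E; apply: p5.
have setup : (p %% 5 != 0)%N -> (exists a : K, 5.-primitive_root a) /\
    (exists s : 'I_4, #|F| = 2 ^ s %[mod 5]).
  move=> p5; split; last first.
    apply: exists_pow2; rewrite cardF; apply: contra p5.
    by rewrite -/(5 %| _)%N Euclid_dvdX // => /andP[].
  apply: exists_prim5; rewrite -(dvdn_pcharf chK) dvdn_prime2 //.
  by apply: contra p5 => /eqP ->.
have triv5 : (1 : K) ^+ 5 = 1 by rewrite expr1n.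
split.
- move=> p5; have B (i : 'I_0) : acAlg F by case: i.
  exists B; split; [by case | by case |] => A /cl[C [_ [_ [_ [_ [a [_ _ pa _ _]]]]]]].
  (* In characteristic 5 raising to the fifth power is injective, so 1 is the only fifth root of
     unity. *)
  rewrite p5 in chK; have := prim_expr_order pa.
  rewrite -[1](expr1n _ 5) -!(pFrobenius_autE chK) => /fmorph_inj a1.
  by have := prim_order_dvd pa 1; rewrite expr1 a1 eqxx.
- move=> /p5n p5 H; have [[a pa] [s qs]] := setup p5.
  have even_s : ~~ odd s.
    by have := pow2_sqr qs; rewrite (card_sqr_even p5 H); case: (odd s).
  have [C1 [C1xx [Q1 [T1 P1]]]] :=
    dim4_exists iota phiE pa qs triv5 (or_introl erefl).
  exists (fun=> @model F 4 C1 C1xx); split=> [//|i j _|A PA].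
    by rewrite (ord1 i) (ord1 j).
  exists 0; have [C [Cxx [Q [s' [w [a' [isoA TQ _ qs' ws']]]]]]] := cl A PA.
  have ss : s' = s by apply: pow2_inj; rewrite -qs' qs.
  rewrite ss in TQ ws'; rewrite (ws' even_s) in TQ.
  apply: isomorphic_trans isoA _.
  by have [T UT mT] := twisted_iso phiE TQ T1; apply: (model_iso _ _ UT mT).
- move=> odd_f H; have p5 : (p %% 5 != 0)%N by case: H => ->.
  have [[a pa] [s qs]] := setup p5; have a5 := prim_expr_order pa.
  have odd_s : odd s.
    by have := pow2_sqr qs; rewrite (card_sqr_odd odd_f H); case: (odd s).
  have [C1 [C1xx [Q1 [T1 P1]]]] :=
    dim4_exists iota phiE pa qs triv5 (or_introl erefl).
  have [C2 [C2xx [Q2 [T2 P2]]]] :=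
    dim4_exists iota phiE pa qs a5 (or_intror odd_s).
  pose B (i : 'I_2) := if i == 0 then @model F 4 C1 C1xx else @model F 4 C2 C2xx.
  have B12 : ~ isomorphic (@model F 4 C1 C1xx) (@model F 4 C2 C2xx).
    case/iso_model => T UT mT; have [_ irr1 _] := P1.
    have a1 := twisted_noniso bphi phiE char2 C1xx (IAC_irr irr1) (twisted_n0 T1)
      qs T1 T2 UT mT.
    by have := prim_order_dvd pa 1; rewrite expr1 a1 eqxx.
  exists B; split.
  + by move=> i; rewrite /B; case: ifP.
  + move=> i j; rewrite /B; case: eqVneq => [->|i0]; case: eqVneq => [->|j0] //.
      by move/isomorphic_sym.
    by case: i j i0 j0 => [[|[|i]] Hi] [[|[|j]] Hj] // _ _ _; apply: val_inj.
  move=> A PA; have [C [Cxx [Q [s' [w [a' [isoA TQ _ qs' _]]]]]]] := cl A PA.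
  have ss : s' = s by apply: pow2_inj; rewrite -qs' qs.
  rewrite ss in TQ; have [w1|w1] := eqVneq w 1.
    exists 0; apply: isomorphic_trans isoA _; rewrite /B eqxx.
    rewrite w1 in TQ; have [T UT mT] := twisted_iso phiE TQ T1.
    exact: (model_iso _ _ UT mT).
  exists 1; apply: isomorphic_trans isoA _; rewrite /B /=.
  have [_ w5 _] := TQ; have [r wr] := prim5_pow pa w5 w1.
  have := twisted_rot r TQ; rewrite wr => TQ'.
  have [T UT mT] := twisted_iso phiE TQ' T2.
  exact: (model_iso _ _ UT mT).
Qed.

End PartC.

(** * Transvectants *)

Section BinaryForms.
Variables (F : fieldType) (n : nat).
Notation m := (n + n)%N.
Notation V := 'rV[F]_m.+1.

Definition ev (j : nat) : V := \row_i (i == j :> nat)%:R.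

Definition lin2 (a b : F) : {poly F} := b%:P + a *: 'X.

Definition pw (a b : F) : V := \row_i (a ^+ i * b ^+ (m - i) *+ 'C(m, i)).

(** The symmetric power of the natural representation, on forms dehomogenized at [Y = 1]:
    [X^i Y^(m-i)] goes to the product of the same powers of the images of [X] and [Y]. *)
Definition subst (g : 'M[F]_2) : 'M[F]_m.+1 :=
  \matrix_i poly_rV (lin2 (g 0 0) (g 1 0) ^+ i * lin2 (g 0 1) (g 1 1) ^+ (m - i)).

Lemma ev_subst g j : (j <= m)%N -> ev j *m subst g =
  poly_rV (lin2 (g 0 0) (g 1 0) ^+ j * lin2 (g 0 1) (g 1 1) ^+ (m - j)).
Proof.
move=> jm; have -> : ev j = delta_mx 0 (inord j).
  apply/rowP => i; rewrite !mxE eqxx /=; congr (_%:R); congr (nat_of_bool _).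
  by rewrite -val_eqE /= inordK.
by rewrite -rowE rowK inordK.
Qed.

Lemma ev_poly j : (j <= m)%N -> ev j = poly_rV 'X^j.
Proof. by move=> jm; apply/rowP => i; rewrite !mxE coefXn. Qed.

Lemma pw_sum a b : pw a b = \sum_(i < m.+1) (a ^+ i * b ^+ (m - i) *+ 'C(m, i)) *: ev i.
Proof.
apply/rowP => j; rewrite summxE (bigD1 j) //= big1 ?addr0 => [|i ij].
  by rewrite !mxE eqxx mulr1.
by rewrite !mxE eq_sym (negPf (_ : i != j :> nat)) ?mulr0.
Qed.

Lemma pw_poly a b : pw a b = poly_rV (lin2 a b ^+ m).
Proof.
rewrite pw_sum /lin2 exprDn linear_sum; apply: eq_bigr => i _ /=.
rewrite ev_poly; last by rewrite -ltnS.
rewrite -linearZ /=; congr poly_rV.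
by rewrite -!mul_polyC !(polyCMn, polyCM, polyC_exp) !exprMn; ring.
Qed.

Lemma lin2_mulmx (g : 'M[F]_2) a b :
  a *: lin2 (g 0 0) (g 1 0) + b *: lin2 (g 0 1) (g 1 1) =
  lin2 (g 0 0 * a + g 0 1 * b) (g 1 0 * a + g 1 1 * b).
Proof.
rewrite /lin2 !scalerDr !scalerA addrACA -scalerDl !scale_polyC -polyCD.
by rewrite (mulrC a) (mulrC b) (mulrC a) (mulrC b).
Qed.

Lemma pw_subst (g : 'M[F]_2) a b :
  pw a b *m subst g = pw (g 0 0 * a + g 0 1 * b) (g 1 0 * a + g 1 1 * b).
Proof.
rewrite [RHS]pw_poly -lin2_mulmx pw_sum mulmx_suml addrC exprDn linear_sum.
apply: eq_bigr => i _ /=; rewrite -scalemxAl ev_subst; last by rewrite -ltnS.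
rewrite -linearZ /=; congr poly_rV.
by rewrite -!mul_polyC !(polyCMn, polyCM, polyC_exp) !exprMn; ring.
Qed.

(* The form (l1 l2)^n for l1 = b + aX and l2 = d + cX. *)
Definition thn (a b c d : F) : V := \sum_(k < n.+1) \sum_(l < n.+1)
  ((a ^+ k * b ^+ (n - k) *+ 'C(n, k)) * (c ^+ l * d ^+ (n - l) *+ 'C(n, l))) *: ev (k + l).

Lemma thnC a b c d : thn a b c d = thn c d a b.
Proof.
rewrite /thn exchange_big; apply: eq_bigr => k _; apply: eq_bigr => l _.
by rewrite mulrC addnC.
Qed.

Lemma thn_subst (g : 'M[F]_2) a b c d : thn a b c d *m subst g =
  thn (g 0 0 * a + g 0 1 * b) (g 1 0 * a + g 1 1 * b)
      (g 0 0 * c + g 0 1 * d) (g 1 0 * c + g 1 1 * d).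
Proof.
(* For arbitrary polynomials in place of [X] and 1: this yields both the product form of [thn] and
   its image under the substitution. *)
have E u v w x (p q : {poly F}) :
    \sum_(k < n.+1) \sum_(l < n.+1)
     ((u ^+ k * v ^+ (n - k) *+ 'C(n, k)) * (w ^+ l * x ^+ (n - l) *+ 'C(n, l))) *:
       poly_rV (p ^+ (k + l) * q ^+ (m - (k + l)))
    = poly_rV ((u *: p + v *: q) ^+ n * (w *: p + x *: q) ^+ n) :> V.
  rewrite !(addrC (_ *: p)) !exprDn mulr_suml linear_sum; apply: eq_bigr => k _ /=.
  rewrite mulr_sumr linear_sum; apply: eq_bigr => l _ /=.
  rewrite -linearZ /=; congr poly_rV.
  have km : (m - (k + l) = (n - k) + (n - l))%N.
    by rewrite subnDA -addnBAC ?addnBA // -ltnS.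
  by rewrite km !exprD -!mul_polyC !(polyCMn, polyCM, polyC_exp) !exprMn; ring.
have E' a' b' c' d' : \sum_(k < n.+1) \sum_(l < n.+1)
     ((a' ^+ k * b' ^+ (n - k) *+ 'C(n, k)) * (c' ^+ l * d' ^+ (n - l) *+ 'C(n, l))) *:
       ev (k + l) = poly_rV (lin2 a' b' ^+ n * lin2 c' d' ^+ n).
  rewrite /lin2 ![_%:P + _]addrC -[b'%:P]mulr1 -[d'%:P]mulr1 !mul_polyC -E.
  apply: eq_bigr => k _; apply: eq_bigr => l _; congr (_ *: _).
  rewrite !expr1n !mulr1 ev_poly //; apply: leq_add; by rewrite -ltnS.
rewrite {2}/thn E' -!lin2_mulmx -E /thn mulmx_suml; apply: eq_bigr => k _.
rewrite mulmx_suml; apply: eq_bigr => l _.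
by rewrite -scalemxAl ev_subst // leq_add // -ltnS.
Qed.

Lemma ev_eq0 j : (j <= m)%N -> ev j != 0.
Proof.
move=> jm; apply/eqP => /rowP/(_ (inord j)); rewrite !mxE inordK // eqxx => /eqP.
by rewrite oner_eq0.
Qed.

(* The n-th transvectant; u 0 i / 'C(m, i) is a^i b^(m - i) if u = (b + aX)^m. *)
Definition trv (u w : V) : V := \sum_(r < n.+1) \sum_(k < n.+1) \sum_(l < n.+1)
  ((-1) ^+ r * 'C(n, r)%:R * 'C(n, k)%:R * 'C(n, l)%:R *
   (u 0 (inord (n - r + k)) / 'C(m, n - r + k)%:R) *
   (w 0 (inord (r + l)) / 'C(m, r + l)%:R)) *: ev (k + l).

Lemma trv_bilinear : bilinear_for *:%R *:%R trv.
Proof.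
split=> z a x y; rewrite /applyr /trv /= scaler_sumr -big_split; apply: eq_bigr => r _;
  rewrite /= scaler_sumr -big_split; apply: eq_bigr => k _;
  rewrite /= scaler_sumr -big_split; apply: eq_bigr => l _ /=;
  rewrite !mxE scalerA -scalerDl; congr (_ *: _); ring.
Qed.

HB.instance Definition _ := bilinear_isBilinear.Build F V V V *:%R *:%R trv trv_bilinear.

Hypothesis nat_neq0 : forall k, (0 < k <= m)%N -> k%:R != 0 :> F.

Lemma bin_neq0 k : (k <= m)%N -> 'C(m, k)%:R != 0 :> F.
Proof.
move=> km; have fact0 j : (j <= m)%N -> (j`!)%:R != 0 :> F.
  elim: j => [|j IH] jm; first by rewrite oner_neq0.
  by rewrite factS natrM mulf_neq0 ?IH ?nat_neq0 // ltnW.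
have := fact0 m (leqnn m); rewrite -(bin_fact km) natrM mulf_eq0 negb_or.
by case/andP.
Qed.

(** The sum over [r] is the binomial expansion of the determinant power and the sums over [k] and
    [l] are those of [thn]; the terms match one by one. *)
Lemma trv_pw a b c d : trv (pw a b) (pw c d) = (a * d - b * c) ^+ n *: thn a b c d.
Proof.
rewrite exprBn scaler_suml /trv; apply: eq_bigr => r _.
rewrite /thn scaler_sumr; apply: eq_bigr => k _; rewrite scaler_sumr; apply: eq_bigr => l _.
rewrite scalerA; congr (_ *: _).
have [rn kn ln] : [/\ (r <= n)%N, (k <= n)%N & (l <= n)%N] by split; rewrite -ltnS.
have i1 : (n - r + k <= m)%N by rewrite leq_add // leq_subr.
have i2 : (r + l <= m)%N by rewrite leq_add.
rewrite !mxE !inordK // -[_ *+ 'C(m, n - r + k)]mulr_natr -[_ *+ 'C(m, r + l)]mulr_natr.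
rewrite !mulfK ?bin_neq0 //.
have -> : (m - (n - r + k) = r + (n - k))%N.
  by rewrite subnDA -addnBAC ?leq_subr // subKn // -addnBA.
have -> : (m - (r + l) = (n - r) + (n - l))%N by rewrite subnDA -addnBAC // -addnBA.
by rewrite !exprD !exprMn; ring.
Qed.

Lemma natr_inj i j : (i <= m)%N -> (j <= m)%N -> i%:R = j%:R :> F -> i = j.
Proof.
wlog ij : i j / (i <= j)%N.
  by move=> H im jm E; case: (leqP i j) => [ij|/ltnW ij]; [exact: H|apply/esym/H].
move=> im jm E; apply/eqP; rewrite eqn_leq ij -subn_eq0; apply/negPn/negP => d.
have H : (0 < j - i <= m)%N by rewrite lt0n d (leq_trans (leq_subr _ _)).
by have := nat_neq0 H; rewrite natrB // E subrr eqxx.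
Qed.

Definition pwmx : 'M[F]_m.+1 := \matrix_(j < m.+1) pw j%:R 1.

(** A relation among the columns is, up to binomial factors, a polynomial of degree at most [m] with
    the distinct roots [0, ..., m]. *)
Lemma pwmx_unit : pwmx \in unitmx.
Proof.
rewrite -unitmx_tr -row_free_unit; apply/inj_row_free => v E.
pose p : {poly F} := \poly_(i < m.+1) (v 0 (inord i) *+ 'C(m, i)).
have rp (j : nat) : (j < m.+1)%N -> root p j%:R.
  move=> jm; rewrite rootE horner_poly.
  have := congr1 (fun w : V => w 0 (Ordinal jm)) E; rewrite !mxE => /eqP; congr (_ == 0).
  apply: eq_bigr => i _; rewrite !mxE inord_val expr1n mulr1.
  by rewrite mulrnAl mulrnAr.
have p0 : p = 0.
  apply: (@roots_geq_poly_eq0 _ _ [seq j%:R | j <- iota 0 m.+1]).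
  - by apply/allP => x /mapP[j]; rewrite mem_iota => /rp rj ->.
  - rewrite map_inj_in_uniq ?iota_uniq // => i j; rewrite !mem_iota /= !add0n !ltnS.
    exact: natr_inj.
  - by rewrite size_map size_iota size_poly.
apply/rowP => i; rewrite mxE; have := congr1 (fun r : {poly F} => r`_i) p0.
rewrite coef0 coef_poly ltn_ord inord_val -mulr_natr => /eqP.
by rewrite mulf_eq0 (negPf (bin_neq0 _)) ?orbF -1?ltnS // => /eqP.
Qed.

Lemma pw_ext (M N : 'M[F]_m.+1) : (forall a b, pw a b *m M = pw a b *m N) -> M = N.
Proof.
move=> E; apply: (can_inj (mulKmx pwmx_unit)); apply/row_matrixP => j.
by rewrite !row_mul rowK E.
Qed.

(** The powers span, so equivariance and the sign rule of [trv] need only be checked where [trv_pw]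
    gives a closed formula. *)
Lemma pw_bilinear_ext (f g : {bilinear V -> V -> V}) :
  (forall a b c d, f (pw a b) (pw c d) = g (pw a b) (pw c d)) -> forall x y, f x y = g x y.
Proof.
move=> E x y; rewrite -(mulmxKV pwmx_unit x) -(mulmxKV pwmx_unit y) !mulmx_sum_row.
rewrite !linear_sumlz; apply: eq_bigr => i _; rewrite !linear_sumr; apply: eq_bigr => j _.
by rewrite !linearZl_LR !linearZr_LR /= !rowK E.
Qed.

Lemma mulmx2 (g h : 'M[F]_2) i j : (g *m h) i j = g i 0 * h 0 j + g i 1 * h 1 j.
Proof.
rewrite mxE !big_ord_recl big_ord0 addr0.
by congr (g i _ * h _ j + g i _ * h _ j); apply: val_inj.
Qed.

Lemma det2 (g : 'M[F]_2) : \det g = g 0 0 * g 1 1 - g 0 1 * g 1 0.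
Proof.
rewrite (expand_det_row _ 0) !big_ord_recl big_ord0 addr0 /cofactor !det_mx11 !mxE /=.
rewrite expr0 expr1 mul1r mulN1r mulrN; congr (g _ _ * g _ _ - g _ _ * g _ _);
  exact: val_inj.
Qed.

(** Matrices act on row vectors from the right, hence the reversed order. *)
Lemma substM (g h : 'M[F]_2) : subst (g *m h) = subst h *m subst g.
Proof.
apply: pw_ext => a b; rewrite mulmxA !pw_subst !mulmx2; congr pw; ring.
Qed.

Lemma subst1 : subst 1%:M = 1%:M.
Proof.
apply: pw_ext => a b; rewrite pw_subst mulmx1 !mxE /=; congr pw; ring.
Qed.

Lemma substN1 : subst (- 1%:M) = 1%:M.
Proof.
apply: pw_ext => a b; rewrite pw_subst mulmx1 !mxE /=.
have -> : - (1 *+ true) * a + - (1 *+ false) * b = - a :> F by rewrite /=; ring.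
have -> : - (1 *+ false) * a + - (1 *+ true) * b = - b :> F by rewrite /=; ring.
apply/rowP => i; rewrite !mxE (exprNn a) (exprNn b) mulrACA -exprD.
have -> : (i + (m - i) = m)%N by rewrite subnKC // -ltnS.
by rewrite -signr_odd oddD addbb mul1r.
Qed.

Lemma subst_unit g : \det g = 1 -> subst g \in unitmx.
Proof.
move=> dg; have Ug : g \in unitmx by rewrite unitmxE dg unitr1.
by have /mulmx1_unit[] : subst (invmx g) *m subst g = 1%:M by rewrite -substM mulmxV // subst1.
Qed.

Lemma trv_subst g x y : \det g = 1 -> trv x y *m subst g = trv (x *m subst g) (y *m subst g).
Proof.
move=> dg.
have lf : bilinear_for *:%R *:%R (fun x y => trv x y *m subst g).
  by split=> z a u v; rewrite /applyr /= !(linearDl, linearDr, linearZl_LR, linearZr_LR).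
pose lfL := bilinear_isBilinear.Build F V V V *:%R *:%R _ lf.
pose L : {bilinear V -> V -> V} := HB.pack (fun x y => trv x y *m subst g) lfL.
have rf : bilinear_for *:%R *:%R (fun x y => trv (x *m subst g) (y *m subst g)).
  by split=> z a u v; rewrite /applyr /= !(mulmxDl, linearDl, linearDr, linearZl_LR, linearZr_LR).
pose rfL := bilinear_isBilinear.Build F V V V *:%R *:%R _ rf.
pose R : {bilinear V -> V -> V} := HB.pack (fun x y => trv (x *m subst g) (y *m subst g)) rfL.
apply: (@pw_bilinear_ext L R) => a b c d /=.
rewrite trv_pw -scalemxAl thn_subst !pw_subst trv_pw; congr (_ ^+ _ *: _).
by rewrite -[LHS]mul1r -dg det2; ring.
Qed.

Hypotheses (n_odd : odd n) (two_neq0 : 2%:R != 0 :> F).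

Lemma trv_anti x y : trv x y = - trv y x.
Proof.
have rf : bilinear_for *:%R *:%R (fun x y => - trv y x).
  split=> z a u v; rewrite /applyr /= !(linearDl, linearDr, linearZl_LR, linearZr_LR);
    by rewrite /= opprD -scalerN.
pose rfL := bilinear_isBilinear.Build F V V V *:%R *:%R _ rf.
pose R : {bilinear V -> V -> V} := HB.pack (fun x y => - trv y x) rfL.
apply: (@pw_bilinear_ext trv R) => a b c d /=.
rewrite !trv_pw thnC -scaleNr; congr (_ *: _).
have -> : a * d - b * c = - (c * b - d * a) by ring.
by rewrite exprNn -signr_odd n_odd expr1 mulN1r.
Qed.

Lemma trvxx x : trv x x = 0.
Proof.
apply/eqP; have /eqP := trv_anti x x; rewrite -addr_eq0 -mulr2n -scaler_nat.
by rewrite scaler_eq0 (negPf two_neq0).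
Qed.

Lemma trv_n0 : trv (pw 0 1) (pw 1 0) != 0.
Proof.
rewrite trv_pw mul0r mul1r sub0r scaler_eq0 expf_eq0 oppr_eq0 oner_eq0 andbF /=.
rewrite /thn big_ord_recl [X in _ + X]big1 ?addr0; last first.
  move=> k _; rewrite big1 // => l _.
  by rewrite /bump /= expr0n /= !mul0r mul0rn mul0r scale0r.
rewrite big_ord_recr big1 ?add0r /=; last first.
  move=> l _; rewrite [X in _ * (_ * X *+ _)]expr0n subn_eq0 leqNgt ltn_ord.
  by rewrite mulr0 mul0rn mulr0 scale0r.
rewrite add0n subnn subn0 !expr1n !expr0 bin0 binn !mulr1 scale1r add0r ev_eq0 //.
exact: leq_addr.
Qed.

Definition tcf i j := trv (delta_mx 0 i) (delta_mx 0 j).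

Lemma trvE x y : trv x y = tbr tcf x y.
Proof. exact: tbr_unique. Qed.

Lemma tcfxx x : tbr tcf x x = 0.
Proof. by rewrite -trvE trvxx. Qed.

Lemma subst_isaut g : \det g = 1 -> isaut (tbr tcf) (subst g).
Proof.
by move=> dg; split=> [|x y]; [exact: subst_unit | rewrite -!trvE trv_subst].
Qed.

Lemma subst_eq1 g : (0 < n)%N -> \det g = 1 -> subst g = 1%:M -> g = 1 \/ g = -1.
Proof.
move=> n0 dg E.
have Eab a b i : (g 0 0 * a + g 0 1 * b) ^+ i * (g 1 0 * a + g 1 1 * b) ^+ (m - i) *+ 'C(m, i) =
    a ^+ i * b ^+ (m - i) *+ 'C(m, i).
  have [im|im] := leqP i m; last by rewrite bin_small // !mulr0n.
  have := pw_subst g a b; rewrite E mulmx1 => /rowP/(_ (inord i)).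
  by rewrite !mxE !inordK.
have m0 : (0 < m)%N by rewrite addn_gt0 n0.
have g01 : g 0 1 = 0.
  have := Eab 0 1 m; rewrite !mulr0 !mulr1 !add0r subnn !expr0 !mulr1 binn !mulr1n.
  by rewrite expr0n eqn0Ngt m0 => /eqP; rewrite expf_eq0 => /andP[_ /eqP].
have g10 : g 1 0 = 0.
  have := Eab 1 0 0; rewrite !mulr0 !mulr1 !addr0 subn0 !expr0 !mul1r bin0 !mulr1n.
  by rewrite expr0n eqn0Ngt m0 => /eqP; rewrite expf_eq0 => /andP[_ /eqP].
move: dg; rewrite det2 g01 mul0r subr0 => dg.
(* Now [g] is diagonal with [g00 g11 = 1]. The coefficient of index [n + 1] in the image of
   [(1 + X)^m] is multiplied by [g00^(n+1) g11^(n-1) = g00^2], and its binomial is non-zero. *)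
have g2 : g 0 0 ^+ 2 = 1.
  have := Eab 1 1 n.+1; rewrite g01 g10 !(mul0r, mulr1, add0r, addr0) !expr1n mulr1.
  have n1m : (n.+1 <= m)%N by rewrite -addn1 leq_add2l.
  have bn := bin_neq0 n1m; rewrite -[LHS]mulr_natr -[RHS]mulr_natr => /(mulIf bn).
  have -> : (m - n.+1 = n.-1)%N by rewrite -addn1 subnDA addnK subn1.
  move=> E1; rewrite -{}E1 -{1}(prednK n0).
  by rewrite -[n.-1.+2]addn2 exprD mulrAC -exprMn dg expr1n mul1r.
have g11 : g 1 1 = g 0 0.
  by rewrite -[LHS]mul1r -g2 expr2 -mulrA dg mulr1.
have H c : g 0 0 = c -> g = c%:M.
  move=> gc; apply/matrixP => i j; rewrite mxE.
  case: i j => [[|[|i]] Hi] [[|[|j]] Hj] //=;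
    [rewrite -gc|rewrite -[RHS]g01|rewrite -[RHS]g10|rewrite -gc -[RHS]g11];
    by congr (g _ _); apply: val_inj.
have /eqP : (g 0 0 - 1) * (g 0 0 + 1) = 0 by rewrite -subr_sqr g2 expr1n subrr.
rewrite mulf_eq0 subr_eq0 addr_eq0 => /orP[] /eqP /H ->; [by left | right].
by rewrite raddfN.
Qed.

End BinaryForms.

(** * Absolute irreducibility of the binary forms *)

Section AbsIrr.
Variables (F : fieldType) (n : nat).
Notation m := (n + n)%N.
Hypothesis nat_neq0 : forall k, (0 < k <= m)%N -> k%:R != 0 :> F.

(** Acts on polynomials by [X |-> X + t]. *)
Definition transl (t : F) : 'M[F]_2 := \matrix_(i, j) ((i == j)%:R + t *+ ((i == 1) && (j == 0))).

Definition weyl : 'M[F]_2 := \matrix_(i, j) ((-1) ^+ i *+ (i != j)).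

Lemma det_transl t : \det (transl t) = 1.
Proof. by rewrite det2 !mxE /= !(mulr0n, mulr1n); ring. Qed.

Lemma det_weyl : \det weyl = 1.
Proof. by rewrite det2 !mxE /= !(mulr0n, mulr1n); ring. Qed.

Lemma subst_transl t (i k : 'I_m.+1) :
  subst n (transl t) i k = t ^+ (i - k) *+ 'C(i, k).
Proof.
rewrite !mxE /= !(mulr0n, mulr1n, addr0, add0r).
have -> : lin2 1 t = 'X + t%:P by rewrite /lin2 scale1r addrC.
have -> : lin2 0 1 = 1 :> {poly F} by rewrite /lin2 scale0r addr0.
rewrite expr1n mulr1 addrC exprDn coef_sum.
have [ki|ik] := leqP k i; last first.
  rewrite bin_small // mulr0n big1 // => j _.
  rewrite coefMn -polyC_exp coefCM coefXn [nat_of_ord k == _](_ : _ = false) ?mulr0 ?mul0rn //.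
  by apply/negP => /eqP E; move: (ltn_ord j); rewrite -E ltnS leqNgt ik.
rewrite (bigD1 (Ordinal (ki : (k < i.+1)%N))) //= big1 ?addr0.
  by rewrite coefMn -polyC_exp coefCM coefXn eqxx mulr1.
move=> j jk; rewrite coefMn -polyC_exp coefCM coefXn.
rewrite [nat_of_ord k == _](_ : _ = false) ?mulr0 ?mul0rn //.
by apply/negP => /eqP E; case/negP: jk; apply/eqP/val_inj.
Qed.

Lemma ev0_weyl : ev F n 0 *m subst n weyl = ev F n m.
Proof.
rewrite ev_subst // !mxE /= !(mulr0n, mulr1n) subn0 ev_poly // expr0 mul1r.
by rewrite /lin2 expr0 scale1r add0r.
Qed.

Section Extension.
Variables (K : fieldType) (iota : {rmorphism F -> K}) (k : nat) (W : 'M[K]_(k, m.+1)).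
Hypothesis stW : forall g, \det g = 1 -> (W *m map_mx iota (subst n g) <= W)%MS.

(** The Hasse derivative of order [d], that is the coefficient of [t^d] in [f(X + t)]. *)
Definition taylor (d : nat) (x : 'rV[K]_m.+1) : 'rV[K]_m.+1 :=
  \row_k (if (k + d < m.+1)%N then x 0 (inord (k + d)) *+ 'C(k + d, k) else 0).

Lemma taylor_sum t (x : 'rV[K]_m.+1) :
  x *m map_mx iota (subst n (transl t)) = \sum_(d < m.+1) iota t ^+ d *: taylor d x.
Proof.
apply/rowP => j; rewrite summxE mxE.
pose f i := x 0 (inord i) * (iota t ^+ (i - j) *+ 'C(i, j)).
pose h d := if (j + d < m.+1)%N then
  iota t ^+ d * (x 0 (inord (j + d)) *+ 'C(j + d, j)) else 0.
have -> : \sum_i x 0 i * map_mx iota (subst n (transl t)) i j = \sum_(0 <= i < m.+1) f i.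
  rewrite big_mkord; apply: eq_bigr => i _.
  by rewrite mxE subst_transl /f inord_val rmorphMn rmorphXn.
have -> : \sum_(d < m.+1) (iota t ^+ d *: taylor d x) 0 j = \sum_(0 <= d < m.+1) h d.
  rewrite big_mkord; apply: eq_bigr => d _; rewrite !mxE /h.
  by case: ifP; rewrite ?mulr0.
have jm : (j <= m.+1)%N by apply: ltnW.
rewrite (big_cat_nat _ (n := j)) //= [X in X + _]big_nat_cond [X in X + _]big1 ?add0r; last first.
  by move=> i; rewrite andbT /= => ij; rewrite /f bin_small // mulr0n mulr0.
rewrite [RHS](big_cat_nat _ (n := (m.+1 - j)%N)) //= ?leq_subr //.
rewrite [X in _ = _ + X]big_nat_cond [X in _ = _ + X]big1 ?addr0; last first.
  by move=> d; rewrite andbT leq_subLR => /andP[jd _]; rewrite /h ltnNge jd.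
rewrite -{1}[nat_of_ord j]add0n big_addn; apply: eq_big_nat => d /=.
by rewrite ltn_subRL /f /h => ->; rewrite addnK addnC !mulrnAr mulrC.
Qed.

(** [W] contains the translates [f(X + t)] for the distinct scalars [t = 0, ..., m]; inverting their
    Vandermonde matrix puts each Hasse derivative into [W]. *)
Lemma taylor_in d x : (d <= m)%N -> (x <= W)%MS -> (taylor d x <= W)%MS.
Proof.
move=> dm xW.
pose Y : 'M[K]_m.+1 := \matrix_(d < m.+1) taylor d x.
pose T : 'M[K]_m.+1 := \matrix_(i, j) (iota i%:R) ^+ j.
have UT : T \in unitmx.
  have -> : T = (Vandermonde m.+1 (\row_i iota i%:R))^T by apply/matrixP => i j; rewrite !mxE.
  rewrite unitmx_tr unitmxE det_Vandermonde unitfE.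
  apply/prodf_neq0 => i _; apply/prodf_neq0 => j ij; rewrite !mxE -rmorphB fmorph_eq0.
  rewrite subr_eq0; apply/negP => /eqP E; have := ltn_ord i; have := ltn_ord j; rewrite !ltnS.
  by move=> jm im; have := natr_inj nat_neq0 jm im E => E'; move: ij; rewrite E' ltnn.
have TY : (T *m Y <= W)%MS.
  apply/row_subP => i.
  have -> : row i (T *m Y) = x *m map_mx iota (subst n (transl i%:R)).
    rewrite taylor_sum row_mul mulmx_sum_row; apply: eq_bigr => j _.
    by rewrite !mxE rowK.
  by apply: submx_trans (stW (det_transl _)); apply: submxMr.
have : (Y <= W)%MS by rewrite -(mulKmx UT Y); apply: submx_trans (submxMl _ _) TY.
move/row_subP/(_ (inord d)); rewrite rowK inordK //.
Qed.

(** The top derivative of a non-zero element of [W] is a non-zero constant. The Weyl element turns 1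
    into [X^m], whose Hasse derivatives are all the monomials, up to the non-zero factors
    ['C(m, l)]. *)
Lemma abs_irr : W = 0 \/ row_full W.
Proof.
have [->|W0] := eqVneq W 0; [by left | right].
have [i ri] : exists i, row i W != 0.
  apply/existsP; apply: contraNT W0; rewrite negb_exists => /forallP H.
  by apply/eqP/row_matrixP => i; rewrite row0; apply/eqP; rewrite -[_ == _]negbK H.
have [x xW x0] : exists2 x : 'rV[K]_m.+1, (x <= W)%MS & x != 0.
  by exists (row i W) => //; apply: row_sub.
have evK j : map_mx iota (ev F n j) = ev K n j.
  by apply/rowP => l; rewrite !mxE rmorph_nat.
have [j xj] : exists j, x 0 j != 0.
  apply/existsP; apply: contraNT x0; rewrite negb_exists => /forallP H.
  by apply/eqP/rowP => l; rewrite [RHS]mxE; apply/eqP; rewrite -[_ == _]negbK H.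
have [d xd dmax] := @arg_maxnP _ j (fun l => x 0 l != 0) (fun l => l : nat) xj.
have e0 : (ev K n 0 <= W)%MS.
  have dm : (d <= m)%N by rewrite -ltnS.
  have := taylor_in dm xW; have -> : taylor d x = x 0 d *: ev K n 0.
    apply/rowP => l; rewrite !mxE; have [->|l0] := eqVneq (l : nat) 0%N.
      by rewrite add0n ltn_ord inord_val bin0 mulr1.
    rewrite mulr0; case: ifP => // ld.
    have -> : x 0 (inord (l + d)) = 0; last by rewrite mul0rn.
    apply/eqP; apply: contraNT l0 => /dmax; rewrite /= inordK // -{2}(add0n d) leq_add2r.
    by rewrite leqn0.
  by rewrite eqmx_scale.
have em : (ev K n m <= W)%MS.
  rewrite -evK -ev0_weyl map_mxM evK.
  by apply: submx_trans (stW det_weyl); apply: submxMr.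
have el (l : nat) : (l <= m)%N -> (ev K n l <= W)%MS.
  move=> lm; have := taylor_in (leq_subr l m) em.
  have -> : taylor (m - l) (ev K n m) = 'C(m, l)%:R *: ev K n l.
    apply/rowP => r; rewrite !mxE; case: ifP => rl.
      rewrite inordK //; have [E|E] := eqVneq (r : nat) l.
        by rewrite E subnKC // eqxx mulr1.
      rewrite mulr0 [_ == m](_ : _ = false) ?mul0rn //; apply/negP => /eqP E'.
      by move: E; rewrite -(eqn_add2r (m - l)) E' subnKC // eqxx.
    have [E|E] := eqVneq (r : nat) l; last by rewrite mulr0.
    by move: rl; rewrite E subnKC // ltnSn.
  rewrite eqmx_scale // -(rmorph_nat iota) fmorph_eq0.
  exact: bin_neq0.
rewrite -sub1mx; apply/row_subP => l; rewrite row1.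
have <- : ev K n l = delta_mx 0 l by apply/rowP => r; rewrite !mxE eqxx.
by apply: el; rewrite -ltnS.
Qed.

End Extension.
End AbsIrr.

(** Absolute irreducibility is stated in the coordinates of [vbasis], while a model has its standard
    ones; the base change [T] intertwines the two matrices of each endomorphism. *)
Lemma model_abs_irr (F : fieldType) d (C : 'I_d -> 'I_d -> 'rV[F]_d) Cxx
    (G : 'End(@model F d C Cxx) -> Prop) : (0 < d)%N ->
  (forall (K : fieldType) (iota : {rmorphism F -> K}) k (W : 'M[K]_(k, d)),
     (forall f, G f -> (W *m map_mx iota (lfmx f) <= W)%MS) -> W = 0 \/ row_full W) ->
  absolutely_irreducible_action G.
Proof.
set A := model _; move=> d0 irr; have dA : \dim {:A} = d by apply: dim_model.
split; first by rewrite -dimv_eq0 dA -lt0n.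
move=> K iota U stU; pose e := vbasis {:A}.
have be : basis_of {:A} e by apply: vbasisP.
pose T : 'M[F]_(\dim {:A}, d) := \matrix_i (e`_i : 'rV[F]_d).
have vecT (u : 'rV_(\dim {:A})) : u *m T = passmx.vecof e u.
  rewrite mulmx_sum_row /passmx.vecof; apply: eq_bigr => i _.
  by rewrite rowK.
have comm (f : 'End(A)) : passmx.mxof e e f *m T = T *m lfmx f.
  apply/row_matrixP => i; rewrite !rowE !mulmxA vecT passmx.mul_mxof.
  by rewrite passmx.rVofK // vecT lfmxE.
have fT : row_free T.
  apply/inj_row_free => u; rewrite vecT => u0.
  by rewrite -(passmx.vecofK be u) u0; apply/rowP => i; rewrite !mxE linear0.
pose W := U *m map_mx iota T.
have rW : \rank W = \rank U by rewrite mxrankMfree // row_free_map.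
have [|W0|fW] := irr K iota _ W.
- move=> f Gf; rewrite /W -mulmxA -map_mxM -comm map_mxM mulmxA.
  by apply: submxMr; apply: stU.
- by left; apply/eqP; rewrite -mxrank_eq0 -rW W0 mxrank0.
- by right; rewrite /row_full -rW -[X in _ == X]dA in fW *.
Qed.

Theorem transvectant_algebra (F : fieldType) (m : nat) :
  (2 <= m)%N -> (m = 2 %[mod 4])%N ->
  [pchar F] =i pred0 \/ (exists2 p, p \in [pchar F] & (2 * m < p)%N) ->
  exists (A : acAlg F) (rho : 'M[F]_2 -> 'End(A)),
    [/\ \dim {:A} = m.+1, IAC A, ~ abelian_alg A, SL2_action rho
      & absolutely_irreducible_action (SL2_image rho)].
Proof.
move=> m2 m4 chF; pose n := m./2.
have [n_odd mE] : odd n /\ m = (n + n)%N.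
  have mq : m = (m %/ 4 * 4 + 2)%N by rewrite {1}(divn_eq m 4) m4.
  have nE : n = (m %/ 4 * 2 + 1)%N.
    rewrite /n {1}mq -[(2)%N]/(1 + 1)%N; move: (m %/ 4)%N => t.
    have -> : (t * 4 + (1 + 1) = (t * 2 + 1).*2)%N.
      by rewrite -addnn addnACA -mulnDr.
    by rewrite doubleK.
  split; first by rewrite nE oddD oddM andbF.
  by rewrite {1}mq nE addnACA -mulnDr.
have n0 : (0 < n)%N by case: (n) n_odd.
move: m2 chF; rewrite {m4}mE => m2 chF; move: n n_odd n0 m2 chF => {m} n n_odd n0 m2 chF.
have nat_neq0 k : (0 < k <= n + n)%N -> k%:R != 0 :> F.
  case/andP => k0 km; case: chF => [ch0|[p chp pm]].
    by rewrite ((pcharf0P F).1 ch0) -lt0n.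
  rewrite -(dvdn_pcharf chp); apply/negP => /(dvdn_leq k0).
  by rewrite leqNgt (leq_ltn_trans _ pm) // (leq_trans km) // leq_pmull.
have two0 : 2%:R != 0 :> F by apply: nat_neq0.
pose Cxx := tcfxx nat_neq0 n_odd two0.
pose A := model Cxx.
pose rho (g : 'M[F]_2) : 'End(A) := linfun (mulmxr (subst n g)).
have rhoE g (x : 'rV[F]_(n + n).+1) : rho g x = x *m subst n g by apply: mulmxr_lfunE.
have lfE g : lfmx (rho g) = subst n g.
  by apply/row_matrixP => i; rewrite !rowE lfmxE rhoE.
exists A, rho; split.
- exact: dim_model.
- apply: irr_IAC => // U stU.
  apply: (@abs_irr F n nat_neq0 F idfun _ U) => g dg; rewrite map_mx_id //.
  exact: stU _ (subst_isaut nat_neq0 dg).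
- move=> /model_abelian ab; have := trv_n0 nat_neq0.
  by rewrite trvE ab eqxx.
- split.
  + by move=> g dg; apply: isaut_is_aut; apply: subst_isaut.
  + move=> g h _ _; apply/lfunP => x.
    by rewrite comp_lfunE !rhoE substM // mulmxA.
  + move=> g dg; split=> [E|].
      apply: (subst_eq1 nat_neq0) => //; rewrite -lfE E.
      by apply/row_matrixP => i; rewrite !rowE lfmxE id_lfunE mulmx1.
    move=> gE; apply/lfunP => x; rewrite rhoE id_lfunE.
    case: gE => ->; first by rewrite subst1 // mulmx1.
    by rewrite substN1 // mulmx1.
- apply: model_abs_irr => // K iota k W stW.
  apply: (@abs_irr F n nat_neq0 K iota _ W) => g dg.
  by rewrite -lfE; apply: stW; exists g.
Qed.

Theorem theorem1p2 :
  (* (a) *)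
  (forall (F : fieldType) (A : acAlg F), IAC A ->
     exists (n : nat) (U : 'I_n -> {vspace A}),
       [/\ (\sum_(i < n) U i)%VS = {:A}%VS /\ directv (\sum_(i < n) U i),
           forall i, is_ideal (U i),
           forall i, simple_alg (subalg (U i)) /\ IAC (subalg (U i))
         & forall i j, isomorphic (subalg (U i)) (subalg (U j))])
  /\
  (* (b) *)
  (forall (F : fieldType) (A : acAlg F),
     2%N \notin [pchar F] -> \dim {:A} = 3%N -> IAC A -> ~ abelian_alg A ->
     is_Lie A /\ simple_alg A)
  /\
  (* (c) *)
  (forall (F : finFieldType) (p f : nat),
     prime p -> odd p -> #|F| = (p ^ f)%N ->
     let P := fun A : acAlg F =>
       [/\ \dim {:A} = 4%N, IAC A & ~ abelian_alg A] in
     [/\ p = 5%N -> num_iso_types P 0,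
         p <> 5%N ->
           ~~ odd f \/ (p = 1 %[mod 5])%N \/ (p = 4 %[mod 5])%N ->
           num_iso_types P 1
       & odd f -> (p = 2 %[mod 5])%N \/ (p = 3 %[mod 5])%N ->
           num_iso_types P 2])
  /\
  (* (d) *)
  (forall (F : fieldType) (m : nat),
     (2 <= m)%N -> (m = 2 %[mod 4])%N ->
     [pchar F] =i pred0 \/ (exists2 p, p \in [pchar F] & (2 * m < p)%N) ->
     exists (A : acAlg F) (rho : 'M[F]_2 -> 'End(A)),
       [/\ \dim {:A} = m.+1, IAC A, ~ abelian_alg A, SL2_action rho
         & absolutely_irreducible_action (SL2_image rho)]).
Proof.
split; first exact: IAC_decomposition.
split.
  by move=> F A _ dA iacA nab; split; [exact: dim3_Lie | exact: dim3_simple].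
split; last exact: transvectant_algebra.
by move=> F p f p_pr p_odd cardF; apply: num_dim4_types p_pr p_odd cardF.
Qed.
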